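(* Let $G$ be a complex reductive algebraic group. For every finitely generated group $\Gamma$, the set of good $G$-representations of $\Gamma$ is Zariski open in the space $Hom(\Gamma,G)$ of all $G$-representations of $\Gamma$.
   Context: Reductive groups are connected complex affine algebraic groups whose radical is an algebraic torus. $Hom(\Gamma,G)$ is the algebraic set of all homomorphisms $\Gamma\to G$, with $G$ acting by conjugation. A representation $\rho:\Gamma\to G$ is good if its orbit under this action is closed and its stabilizer (the centralizer of $\rho(\Gamma)$ in $G$) is the center of $G$. Equivalently, $\rho$ is irreducible ($\rho(\Gamma)$ lies in no proper parabolic subgroup of $G$) and the centralizer of $\rho(\Gamma)$ is the center of $G$. *)

(* Defs.v *)
From HB Require Import structures.
From mathcomp Require Import all_boot all_order all_algebra.
From mathcomp Require Import mpoly complex.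
From mathcomp Require Import classical_sets reals.

Set Implicit Arguments.
Unset Strict Implicit.
Unset Printing Implicit Defensive.

Import GRing.Theory.
Local Open Scope classical_set_scope.
Local Open Scope ring_scope.

(* A variety (algebraic set) is presented as a type, or a subset A of a type,
   together with a coordinate map c into an affine space 'rV[K]_n which is
   injective with Zariski closed image.  Since only points are considered, the
   notions below are meant for an algebraically closed field K. *)
Section Zariski.
Variable K : fieldType.

(* The topology induced along c; relative to the image of c when c is
   injective. *)
Definition zariski_closed (T : Type) (n : nat) (c : T -> 'rV[K]_n)
    (S : set T) : Prop :=
  exists I : set {mpoly K[n]}, S = [set x | forall p, I p -> p.@[c x 0] = 0].

Definition zariski_open (T : Type) (n : nat) (c : T -> 'rV[K]_n)
    (S : set T) : Prop :=
  zariski_closed c (~` S).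

Definition zariski_connected (T : Type) (n : nat) (c : T -> 'rV[K]_n)
    (S : set T) : Prop :=
  ~ exists A B : set T,
      [/\ zariski_closed c A /\ zariski_closed c B, S `<=` A `|` B,
          S `&` A !=set0, S `&` B !=set0 & S `&` A `&` B = set0].

(* Morphisms of affine varieties: f is, on A, the restriction of a polynomial
   map of the ambient affine spaces. *)
Definition regular_on (T U : Type) (m n : nat) (c : T -> 'rV[K]_m)
    (d : U -> 'rV[K]_n) (A : set T) (f : T -> U) : Prop :=
  exists P : 'I_n -> {mpoly K[m]},
    forall x, A x -> forall j, d (f x) 0 j = (P j).@[c x 0].

End Zariski.

Section AbstractGroups.
Local Open Scope group_scope.
Variable gT : groupType.
Implicit Types H A : set gT.

Definition is_subgroup H : Prop :=
  [/\ H 1, (forall x y, H x -> H y -> H (x * y)) & (forall x, H x -> H x^-1)].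

Definition is_normal H : Prop := forall x g, H x -> H (x ^ g).

Definition generated_subgroup A : set gT :=
  [set x | forall H, is_subgroup H -> A `<=` H -> H x].

Definition derived_subgroup H : set gT :=
  generated_subgroup [set [~ x, y] | x in H & y in H].

Definition is_solvable H : Prop :=
  exists n, iter n derived_subgroup H = [set 1].

Definition group_center : set gT := [set g | forall h, commute g h].

End AbstractGroups.

Record affineAlgGroup (K : fieldType) := AffineAlgGroup {
  aag_sort :> groupType;
  aag_dim : nat;
  aag_coord : aag_sort -> 'rV[K]_aag_dim;
  aag_coord_inj : injective aag_coord;
  aag_coord_closed : zariski_closed id (range aag_coord);
  aag_mul_regular :
    regular_on (fun xy : aag_sort * aag_sort =>
                  row_mx (aag_coord xy.1) (aag_coord xy.2))
      aag_coord setT (fun xy => (xy.1 * xy.2)%g);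
  aag_inv_regular : regular_on aag_coord aag_coord setT (fun x => x^-1%g)
}.

Section Reductive.
Variables (K : fieldType) (G : affineAlgGroup K).

(* The torus (K\{0})^r, realised as the closed subset of K^(2r) of all pairs
   (t, t^-1), so that its regular functions are the Laurent polynomials. *)
Definition torus_points {r : nat} : set 'rV[K]_r :=
  [set t | forall i, t 0 i != 0].

Definition torus_coord (r : nat) (t : 'rV[K]_r) : 'rV[K]_(r + r) :=
  row_mx t (\row_i (t 0 i)^-1).

(* H is isomorphic, as an algebraic group, to some (K\{0})^r; phi and psi are the
   mutually inverse isomorphisms. *)
Definition is_torus (H : set G) : Prop :=
  exists (r : nat) (phi : 'rV[K]_r -> G) (psi : G -> 'rV[K]_r),
    [/\ phi @` torus_points = H,
        (forall t, torus_points t -> psi (phi t) = t),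
        (forall t u, torus_points t -> torus_points u ->
           phi (\row_i (t 0 i * u 0 i)) = (phi t * phi u)%g),
        regular_on (@torus_coord r) (@aag_coord K G) torus_points phi
      & regular_on (@aag_coord K G) (@torus_coord r) H psi].

Definition closed_connected_solvable_normal (H : set G) : Prop :=
  [/\ is_subgroup H, is_normal H, is_solvable H,
      zariski_closed (@aag_coord K G) H & zariski_connected (@aag_coord K G) H].

(* The radical: the largest closed connected solvable normal subgroup. *)
Definition is_radical (H : set G) : Prop :=
  closed_connected_solvable_normal H /\
  forall H', closed_connected_solvable_normal H' -> H' `<=` H.

Definition reductive : Prop :=
  zariski_connected (@aag_coord K G) setT /\
  exists H, is_radical H /\ is_torus H.

End Reductive.

Section Representations.
Variables (K : fieldType) (G : affineAlgGroup K) (Gamma : groupType).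
Implicit Types rho : {multiplicative Gamma -> G}.

(* For generators s_0, ..., s_(k-1) of Gamma this is the embedding
   rho |-> (rho s_0, ..., rho s_(k-1)) of Hom(Gamma, G) into G^k, followed by
   the coordinates of G; it defines the structure of algebraic set (and the
   Zariski topology) on Hom(Gamma, G), independently of the generators. *)
Definition hom_coord (k : nat) (s : 'I_k -> Gamma) rho :
    'rV[K]_(k * aag_dim G) :=
  mxvec (\matrix_(i < k) aag_coord (rho (s i))).

Definition conj_orbit rho : set {multiplicative Gamma -> G} :=
  [set rho' | exists g : G, forall x, rho' x = (g * rho x * g^-1)%g].

Definition conj_stabilizer rho : set G :=
  [set g | forall x, (g * rho x * g^-1)%g = rho x].

Definition good (k : nat) (s : 'I_k -> Gamma) rho : Prop :=
  zariski_closed (hom_coord s) (conj_orbit rho) /\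
  conj_stabilizer rho = @group_center G.

End Representations.

(* Main.v *)
(* Let V be a faithful representation of G, a_1, ..., a_d coordinates on the linear
   span of V(G), and C the action of G by conjugation in these coordinates, so that
   the kernel of C is the center of G.  A representation rho is encoded by the
   matrix B(rho) whose columns are the coordinates of the rho(s_i), and
   B(g rho g^-1) = C(g) B(rho).  If rho_0 is good, then b_0 = B(rho_0) has a closed
   orbit isomorphic to C(G), and there is a polynomial map F with F(C(g) b) = C(g) F(b)
   and F(b_0) = 1.  Conversely every rho with det F(B(rho)) <> 0 is good: F makes its
   orbit a copy of C(G), closed in Hom(Gamma, G).

   To find F, one proves that a regular function on G which is invariant under the
   stabilizer of b_0 is a polynomial in C(g) b_0, writes C(g) = F_0(C(g) b_0), and
   averages: F(b) is the mean over g of C(g)^-1 F_0(C(g) b).  The mean value on regular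
   functions exists because the complement of the invariants of a rational
   representation is in the image of the Lie algebra: the Casimir element of the trace
   form acts invertibly on it.  The trace form is nondegenerate because the Lie algebra
   of a reductive group has no nonzero invariant space of nilpotent matrices and is
   stable under replicas: the semisimple part of X may be replaced by its complex
   conjugate X', and tr(X X') = 0 forces X to be nilpotent.  Invariant functions are compared
   with polynomials on the orbit by the Nullstellensatz, which is elementary over an
   uncountable field, and by Krull's intersection theorem at the identity. *)

Require Import Defs.
From HB Require Import structures.
From mathcomp Require Import all_boot all_order all_algebra all_field.
From mathcomp Require Import mpoly complex.
From mathcomp Require Import ring lra.
From mathcomp Require Import boolp classical_sets reals.

Set Implicit Arguments.
Unset Strict Implicit.
Unset Printing Implicit Defensive.

Import Order.TTheory GRing.Theory Num.Theory.
Local Open Scope classical_set_scope.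
Local Open Scope ring_scope.


(** * Ideals of polynomial rings *)

(** The main obstacle is the orbit map of [b_0]: that a function constant on its fibres is
    polynomial on the orbit is usually drawn from the normality of the orbit and Zariski's main
    theorem. Here the mean value H supplies the pairing H(f a). Regular functions split into
    polynomials on the orbit and their orthogonal complement, and it remains to exclude a nonzero
    invariant function in the complement. Closedness of the orbit serves at this point: polynomials
    on the orbit without common zero generate 1, and 1 is not orthogonal to itself. The second
    obstacle is complete reducibility without the structure theory of semisimple Lie algebras and
    without a compact form. Conjugating eigenvalues replaces the compact form: the trace of a matrix
    times its replica is a sum of terms |l|^2 times a rank, so it vanishes only if every term does.
    Replicas stay in the Lie algebra because conjugation is additive, hence compatible with the
    Leibniz rule. The condition on the stabilizer is used in the form that C(g) b_0 = b_0 implies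
    C(g) = 1, which makes the entries of C themselves invariant functions. *)

Lemma nat_ind_mono (f : nat -> nat) :
  (forall k, f k < f k.+1)%N -> forall i j, (i < j)%N -> (f i < f j)%N.
Proof.
move=> hf i; elim=> // j IH; rewrite ltnS leq_eqVlt => /predU1P[->//|/IH h].
exact: ltn_trans h (hf j).
Qed.

(** After each chosen index, the next one is a place where [f] attains its minimum over the
    remaining tail. *)
Lemma nondecreasing_subseq (f : nat -> nat) :
  exists phi : nat -> nat, (forall i j, (i < j)%N -> (phi i < phi j)%N) /\
    forall i j, (i < j)%N -> (f (phi i) <= f (phi j))%N.
Proof.
have argmin N : exists i, (N <= i)%N /\ forall j, (N <= j)%N -> (f i <= f j)%N.
  have ex : exists v, `[< exists i, (N <= i)%N /\ f i = v >].
    by exists (f N); apply/asboolP; exists N.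
  case: (ex_minnP ex) => v /asboolP[i [Ni fi]] vmin; exists i; split=> // j Nj.
  by rewrite fi; apply: vmin; apply/asboolP; exists j.
have [nxt hn] := choice argmin.
pose phi := fix phi k := if k is k'.+1 then nxt (phi k').+1 else nxt 0%N.
have phiS k : (phi k < phi k.+1)%N by have [] := hn (phi k).+1.
have mphi := nat_ind_mono phiS.
exists phi; split=> // i j ij.
case: i ij => [|i] ij; first by have [_ ->] := hn 0%N.
by have [_ -> //] := hn (phi i).+1; apply: ltn_trans (mphi _ _ ij); exact: phiS.
Qed.

Lemma nondecreasing_subseqs (s : seq (nat -> nat)) :
  exists phi : nat -> nat, (forall i j, (i < j)%N -> (phi i < phi j)%N) /\
    forall k, (k < size s)%N -> forall i j, (i < j)%N ->
      (nth id s k (phi i) <= nth id s k (phi j))%N.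
Proof.
elim: s => [|f s [phi [hphi IH]]]; first by exists id.
have [psi [hpsi hf]] := nondecreasing_subseq (f \o phi).
exists (phi \o psi); split=> [i j /hpsi /hphi //|[|k] hk i j ij] /=.
  exact: hf.
by apply: IH => //; apply: hpsi.
Qed.

(** Along a subsequence on which every exponent is nondecreasing, any two terms are comparable. *)
Lemma dickson n (m : nat -> 'X_{1..n}) :
  exists i j, (i < j)%N /\ (m i <= m j)%MM.
Proof.
have [phi [hphi h]] := nondecreasing_subseqs [seq (fun k => m k i) | i <- enum 'I_n].
exists (phi 0%N), (phi 1%N); split; first exact: hphi.
apply/mnm_lepP => i.
have := h i _ 0%N 1%N isT; rewrite size_map size_enum_ord ltn_ord => /(_ isT).
by rewrite (nth_map i) ?size_enum_ord // nth_ord_enum.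
Qed.

Section Ideals.
Variable A : comNzRingType.

Definition is_ideal (I : set A) : Prop :=
  [/\ I 0, (forall x y, I x -> I y -> I (x + y)) & (forall a x, I x -> I (a * x))].

Section IdealTheory.
Variable I : set A.
Hypothesis idI : is_ideal I.

Lemma ideal0 : I 0. Proof. by case: idI. Qed.
Lemma idealD x y : I x -> I y -> I (x + y). Proof. by case: idI => _ + _; apply. Qed.
Lemma idealMl a x : I x -> I (a * x). Proof. by case: idI => _ _; apply. Qed.
Lemma idealMr a x : I x -> I (x * a). Proof. by rewrite mulrC; exact: idealMl. Qed.
Lemma idealN x : I x -> I (- x). Proof. by rewrite -mulN1r; apply: idealMl. Qed.
Lemma idealB x y : I x -> I y -> I (x - y).
Proof. by move=> hx hy; apply: idealD => //; apply: idealN. Qed.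
Lemma idealDl x y : I x -> I (x + y) -> I y.
Proof. by move=> hx hxy; rewrite -(addKr x y) addrC; apply: idealB. Qed.
Lemma idealDr x y : I y -> I (x + y) -> I x.
Proof. by rewrite addrC; apply: idealDl. Qed.
Lemma ideal_sum (J : Type) (r : seq J) (P : pred J) F :
  (forall j, P j -> I (F j)) -> I (\sum_(j <- r | P j) F j).
Proof. by move=> h; apply: big_ind => //; [exact: ideal0|exact: idealD]. Qed.

End IdealTheory.

(** Zorn's lemma; maximality means that adjoining any further [x] makes the ideal meet [S]. The
    Nullstellensatz takes for [S] the powers of a polynomial, Krull's theorem a single
    polynomial. *)
Lemma maximal_ideal_avoiding (I S : set A) : is_ideal I ->
   (forall s, S s -> ~ I s) ->
  exists M : set A, [/\ is_ideal M, I `<=` M, (forall s, S s -> ~ M s) &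
    forall x, ~ M x -> exists2 s, S s & exists a, M (s - a * x)].
Proof.
move=> idI SI.
(* [Zorn_bigcup] also requires [P] for the union of the empty chain, which is empty and not an
   ideal; hence the condition that [M] be inhabited. *)
pose P (M : set A) := (forall s, S s -> ~ M s) /\
  ((exists x, M x) -> is_ideal M /\ I `<=` M).
have [F FP totF|M [[MS MI] Mmax]] := @Zorn_bigcup A P.
  split=> [s Ss [X /FP[XS _] /XS]|[x [X FX Xx]]]; first exact.
  have idX Y : F Y -> (exists y, Y y) -> is_ideal Y /\ I `<=` Y.
    by move=> /FP[_ h]; apply: h.
  have [iX sX] := idX _ FX (ex_intro _ x Xx).
  split; last by move=> y /sX; exists X.
  split; first by exists X => //; case: iX.
    move=> y z [Y FY Yy] [Z FZ Zz].
    have [iY _] := idX _ FY (ex_intro _ y Yy).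
    have [iZ _] := idX _ FZ (ex_intro _ z Zz).
    have [YZ|ZY] := totF _ _ FY FZ.
      by exists Z => //; apply: (idealD iZ) => //; apply: YZ.
    by exists Y => //; apply: (idealD iY) => //; apply: ZY.
  move=> a y [Y FY Yy]; exists Y => //.
  by have [[_ _ h] _] := idX _ FY (ex_intro _ y Yy); apply: h.
have {}[iM IM] : is_ideal M /\ I `<=` M.
  have [/MI //|/forallNP M0] := pselect (exists x, M x).
  exfalso; apply: (Mmax I); last by split=> // _; split.
  split=> [x /M0//|/(_ 0) h]; apply: (M0 0); apply: h; exact: ideal0.
exists M; split=> // x Mx.
apply: contrapT => hx.
pose N := [set y | exists a, M (y - a * x)].
have [iM0 iMD iMM] := iM.
have MN : M `<=` N by move=> y My; exists 0; rewrite mul0r subr0.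
apply: (Mmax N).
  split=> // NM; apply: Mx; apply: NM; exists 1; rewrite mul1r subrr; exact: iM0.
split=> [s Ss [a Ma]|_]; first by apply: hx; exists s => //; exists a.
split; last by move=> y /IM /MN.
split; first exact: MN.
  move=> y z [a ha] [b hb]; exists (a + b).
  by rewrite mulrDl opprD addrACA; apply: iMD.
by move=> c y [a ha]; exists (c * a); rewrite -mulrA -mulrBr; apply: iMM.
Qed.

End Ideals.

Section MPolyIdeals.
Variables (K : fieldType) (n : nat).
Implicit Types (p q : {mpoly K[n]}) (a : 'I_n -> K).

Lemma mpoly_alg_ind (P : {mpoly K[n]} -> Prop) :
  (forall c, P c%:MP) -> (forall i, P 'X_i) ->
  (forall p q, P p -> P q -> P (p + q)) ->
  (forall p q, P p -> P q -> P (p * q)) -> forall p, P p.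
Proof.
move=> hC hX hD hM p; elim/mpolyind: p => [|c m p _ _ IH]; first by rewrite -mpolyC0.
apply: (hD) => //; rewrite -mul_mpolyC; apply: (hM) => //.
rewrite mpolyXE_id; apply: (big_ind P) => [||i _]; [by rewrite -mpolyC1|exact: hM|].
by elim: (m i) => [|k IHk]; rewrite ?expr0 -?mpolyC1 // exprS; apply: (hM).
Qed.

Lemma mpoly_sub_eval (I : set {mpoly K[n]}) a : is_ideal I ->
  (forall i, I ('X_i - (a i)%:MP)) -> forall p, I (p - (p.@[a])%:MP).
Proof.
move=> iI hX; elim/mpoly_alg_ind => [c|i|p q hp hq|p q hp hq].
- by rewrite mevalC subrr; apply: ideal0.
- by rewrite mevalXU.
- by rewrite mevalD mpolyCD opprD addrACA; apply: idealD.
- rewrite mevalM mpolyCM.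
  have -> : p * q - (p.@[a])%:MP * (q.@[a])%:MP =
    (p - (p.@[a])%:MP) * q + (p.@[a])%:MP * (q - (q.@[a])%:MP).
    by rewrite mulrBl mulrBr addrA subrK.
  by apply: idealD => //; [apply: idealMr|apply: idealMl].
Qed.

(** A Groebner argument. If no [p k] lay in the ideal of its predecessors, each could be reduced
    modulo them to some [q k] with least leading monomial. Dickson's lemma finds [i < j] with
    [mlead (q i)] dividing [mlead (q j)], and cancelling the leading term of [q j] contradicts
    minimality. *)
Lemma mpoly_noetherian (p : nat -> {mpoly K[n]}) :
  exists k, forall I, is_ideal I -> (forall i, (i < k)%N -> I (p i)) -> I (p k).
Proof.
apply: contrapT => /forallNP hp.
pose J k := [set x | forall I, is_ideal I -> (forall i, (i < k)%N -> I (p i)) -> I x].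
have iJ k : is_ideal (J k).
  split=> [I iI _|x y hx hy I iI hI|a x hx I iI hI]; first exact: ideal0.
  - by apply: idealD => //; [apply: hx|apply: hy].
  - by apply: idealMl => //; apply: hx.
have pJ k : ~ J k (p k) by exact: hp.
have red k : exists q, [/\ J k (p k - q), J k.+1 q &
    forall r, J k (p k - r) -> ~~ (mlead r < mlead q)%O].
  have : J k (p k - p k) by rewrite subrr; apply: ideal0.
  have Jk x : J k x -> J k.+1 x.
    move=> hx I iI hI; apply: hx => // i ik; apply: hI; exact: ltnW.
  have pk1 : J k.+1 (p k) by move=> I _; apply.
  elim/mleadrect: {2}(p k) => q IH hq.
  have [[r [hr rq]]|/forallNP no] := pselect (exists r, J k (p k - r) /\ (mlead r < mlead q)%O).
    exact: IH rq hr.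
  exists q; split=> // [|r hr].
    rewrite -(subKr (p k) q); apply: (idealB (iJ _)); [exact: pk1|exact: Jk].
  by apply/negP => rq; apply: (no r).
have [q hq] := choice red.
have q0 k : q k != 0.
  have [h _ _] := hq k; apply/eqP => qk.
  by apply: (pJ k); rewrite qk subr0 in h.
have [i [j [ij hm]]] := dickson (fun k => mlead (q k)).
have [hj _ minj] := hq j; have [_ hi _] := hq i.
have {}hi : J j (q i) by move=> I iI hI; apply: hi => // l li; apply: hI; apply: leq_trans li ij.
pose c := mleadc (q j) / mleadc (q i).
pose m := (mlead (q j) - mlead (q i))%MM.
pose r := c *: 'X_[m] * q i.
have c0 : c != 0 by rewrite mulf_neq0 ?invr_eq0 ?mleadc_eq0.
have r0 : c *: 'X_[m] != 0 :> {mpoly K[n]}.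
  by rewrite scaler_eq0 negb_or c0 -msupp_eq0 msuppX.
have lr : mlead r = mlead (q j).
  by rewrite mleadM // mleadZ // mleadXm submK.
have cr : mleadc r = mleadc (q j).
  rewrite /r mleadM // mleadcM mleadZ // mleadXm mcoeffZ mcoeffX eqxx mulr1 /c divfK //.
  by rewrite mleadc_eq0.
have hr : J j (p j - (q j - r)).
  rewrite opprB addrCA addrC; apply: (idealD (iJ _)); first exact: hj.
  exact: (idealMl (iJ _)).
have := minj _ hr; suff -> : (mlead (q j - r) < mlead (q j))%O by [].
have d0 : q j - r != 0.
  by apply/eqP => d0; apply: (pJ j); rewrite d0 subr0 in hr.
rewrite lt_neqAle; apply/andP; split; last first.
  by apply: le_trans (mleadB_le _ _) _; rewrite lr joinxx.
apply: contraNneq d0 => h; rewrite -mleadc_eq0 h mcoeffB.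
by rewrite -{2}lr cr subrr.
Qed.

(** Powers of the maximal ideal of the point [a], with one generator split off at a time so that
    proofs go by induction on [r]. *)
Fixpoint max_pow a r : set {mpoly K[n]} :=
  if r is r'.+1 then
    [set p | exists q : 'I_n -> {mpoly K[n]},
       (forall i, max_pow a r' (q i)) /\ p = \sum_i ('X_i - (a i)%:MP) * q i]
  else setT.

Lemma max_pow_ideal a r : is_ideal (max_pow a r).
Proof.
elim: r => [|r IH] //=; split.
- exists (fun=> 0); split=> [i|]; first exact: ideal0.
  by rewrite big1 // => i _; rewrite mulr0.
- move=> _ _ [p [hp ->]] [q [hq ->]]; exists (fun i => p i + q i).
  split=> [i|]; first exact: idealD.
  by rewrite -big_split; apply: eq_bigr => i _; rewrite mulrDr.
- move=> c _ [p [hp ->]]; exists (fun i => c * p i).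
  split=> [i|]; first exact: idealMl.
  by rewrite mulr_sumr; apply: eq_bigr => i _; rewrite mulrCA.
Qed.

Lemma max_pow_sub a (B : set {mpoly K[n]}) (k : 'I_n -> nat) : is_ideal B ->
  (forall i, B (('X_i - (a i)%:MP) ^+ (k i).+1)) ->
  exists r, max_pow a r `<=` B.
Proof.
move=> iB hk; pose y i : {mpoly K[n]} := 'X_i - (a i)%:MP.
(* [e] records the factors already extracted: each new factor either pushes an exponent past [k i],
   which lands in [B], or lowers the sum of the truncated differences [k i - e i]. *)
suff main r (e : 'I_n -> nat) p : (\sum_i (k i - e i) < r)%N -> max_pow a r p ->
    B ((\prod_i y i ^+ e i) * p).
  exists (\sum_i k i).+1 => p /(main _ (fun=> 0%N)).
  under eq_bigr do rewrite subn0.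
  by move=> /(_ (leqnn _)); rewrite big1 ?mul1r.
elim: r e p => [//|r IH] e p he [q [hq ->]].
rewrite mulr_sumr; apply: ideal_sum => // i _.
pose e' j := (e j + (j == i))%N.
have -> : (\prod_j y j ^+ e j) * (y i * q i) = (\prod_j y j ^+ e' j) * q i.
  rewrite mulrA; congr (_ * _); under [RHS]eq_bigr do rewrite exprD.
  rewrite big_split /=; congr (_ * _).
  by rewrite (bigD1 i) //= eqxx expr1 big1 ?mulr1 // => j /negbTE ->.
have [ki|ki] := leqP (k i) (e i).
  apply: idealMr => //; rewrite (bigD1 i) //=; apply: idealMr => //.
  rewrite /e' eqxx addn1.
  have -> : (e i).+1 = ((e i - k i) + (k i).+1)%N by rewrite addnS subnK.
  by rewrite exprD; apply: (idealMl iB); exact: hk.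
apply: IH; last exact: hq.
rewrite ltnS in he; apply: leq_trans he.
rewrite (bigD1 i) //= [in X in (_ < X)%N](bigD1 i) //= /e' eqxx addn1.
rewrite -addSn; apply: leq_add; first by rewrite subnS prednK // subn_gt0.
by apply: leq_sum => j /negbTE ->; rewrite addn0.
Qed.

(* Krull intersection: an ideal B maximal among those containing I and m psi but
   not psi contains a power of m, because each chain (B : y^k) is stationary. *)
Lemma krull_intersection (I : set {mpoly K[n]}) a p : is_ideal I ->
  (forall r, exists2 q, max_pow a r q & I (p - q)) ->
  exists2 s, s.@[a] = 1 & I (s * p).
Proof.
move=> iI hp; pose y i : {mpoly K[n]} := 'X_i - (a i)%:MP.
(* [C] is [I + m p], with m the maximal ideal of [a]. If [p] belongs to it, then [(1 - e) p] lies in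
   [I] for some [e] vanishing at [a]. *)
pose C := [set x | exists2 e, e.@[a] = 0 & I (x - e * p)].
have iC : is_ideal C.
  split.
  - by exists 0; rewrite ?meval0 // mul0r subrr; apply: ideal0.
  - move=> u v [e he hu] [f hf hv]; exists (e + f); first by rewrite mevalD he hf addr0.
    by rewrite mulrDl opprD addrACA; apply: idealD.
  - move=> c u [e he hu]; exists (c * e); first by rewrite mevalM he mulr0.
    by rewrite -mulrA -mulrBr; apply: idealMl.
have [[e he h]|Cp] := pselect (C p).
  exists (1 - e); first by rewrite mevalB meval1 he subr0.
  by rewrite mulrBl mul1r.
exfalso.
have [s ->|B [iB CB Bp maxB]] := maximal_ideal_avoiding iC (S := [set p]); first by [].
have hy i : exists k, B (y i ^+ k.+1).
  pose Q k := [set x | B (y i ^+ k * x)].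
  have iQ k : is_ideal (Q k).
    split; first by rewrite /Q /= mulr0; apply: ideal0.
      by move=> u v hu hv; rewrite /Q /= mulrDr; apply: idealD.
    by move=> c u hu; rewrite /Q /= mulrCA; apply: idealMl.
  have QS k x : Q k x -> Q k.+1 x.
    by rewrite /Q /= exprS -mulrA; apply: idealMl.
  (* If the chain stops at [k] and [y^k] is not in [B], maximality writes [p] as [c y^k] modulo [B].
     Since [y p] is in [B], so is [c y^(k+1)], hence [c y^k], hence [p]. *)
  have [[k hk]|/forallNP hQ] := pselect (exists k, forall x, Q k.+1 x -> Q k x).
    have [Byk|Byk] := pselect (B (y i ^+ k)).
      by exists k; rewrite exprS; apply: idealMl.
    have [_ -> [c hc]] := maxB _ Byk.
    exfalso; apply: (Bp p) => //.
    rewrite mulrC in hc.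
    suff h : B (y i ^+ k * c) by apply: (idealDr iB _ hc); apply: idealN.
    apply: (hk c); rewrite /Q /= exprS -mulrA.
    have h2 : B (y i * p).
      by apply: CB; exists (y i); rewrite ?subrr ?mevalB ?mevalXU ?mevalC ?subrr //; apply: ideal0.
    have := idealB iB h2 (idealMl iB (y i) hc).
    by rewrite mulrBr opprB addrCA subrr addr0.
  have {}hQ k : exists x, Q k.+1 x /\ ~ Q k x.
    apply: contrapT => /forallNP h; apply: (hQ k) => x Qx.
    by apply: contrapT => nQ; apply: (h x).
  have [f hf] := choice hQ.
  have [k hk] := mpoly_noetherian f.
  have [_ []] := hf k; apply: hk => // j jk.
  have {}jk : (j.+1 <= k)%N := jk.
  have [h _] := hf j; elim: k jk => [//|k IH]; rewrite leq_eqVlt => /predU1P[<-//|].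
  by rewrite ltnS => /IH /QS.
have [k hk] := choice hy.
have [r hr] := max_pow_sub iB hk.
have [q /hr Bq Ipq] := hp r.
apply: (Bp p) => //; rewrite -(subrK q p); apply: idealD => //; apply: CB.
by exists 0; rewrite ?meval0 // mul0r subr0.
Qed.

End MPolyIdeals.

(** * The Nullstellensatz *)

(** Stands for uncountability: every colouring with countably many colours has an infinite fibre. *)
Definition big_fibre (T : eqType) : Prop := forall f : T -> nat,
  exists n, forall s : seq T, exists2 a, a \notin s & f a = n.

Lemma big_fibre_uniq (T : eqType) (f : T -> nat) : big_fibre T ->
  exists n, forall k, exists s, [/\ uniq s, size s = k & forall a, a \in s -> f a = n].
Proof.
move=> /(_ f)[n hn]; exists n; elim=> [|k [s [us ss fs]]]; first by exists [::].
have [a as_ fa] := hn s; exists (a :: s); split=> /=; rewrite ?as_ ?ss // => b.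
by rewrite inE => /predU1P[->|/fs].
Qed.

Section Nullstellensatz.
Variables (K : closedFieldType) (n : nat).
Hypothesis uncK : big_fibre K.
Implicit Types (p q : {mpoly K[n]}).

Lemma mpoly_dependent d r (q : 'I_r -> {mpoly K[n]}) :
  (forall i, msize (q i) <= d)%N -> (#|{: 'X_{1..n < d}}| < r)%N ->
  exists2 c : 'I_r -> K, (exists i, c i != 0) & \sum_i c i *: q i = 0.
Proof.
move=> hq hr; pose M := \matrix_(i < r, j < #|{: 'X_{1..n < d}}|) (q i)@_(enum_val j).
have : kermx M != 0.
  rewrite -mxrank_eq0 mxrank_ker subn_eq0 -ltnNge.
  exact: leq_ltn_trans (rank_leq_col M) hr.
move/rowV0Pn => [v /sub_kermxP vM v0].
exists (fun i => v 0 i).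
  apply: contrapT => /forallNP h; case/negP: v0; apply/eqP/rowP => i.
  by rewrite mxE; apply/eqP; apply: contrapT => /negP; apply: h.
apply/mpolyP => m; rewrite mcoeff0 raddf_sum /=.
have [md|md] := ltnP (mdeg m) d; last first.
  rewrite big1 // => i _; rewrite mcoeffZ memN_msupp_eq0 ?mulr0 //.
  by apply/negP => /msize_mdeg_lt; rewrite ltnNge (leq_trans (hq i) md).
have := congr1 (fun A : 'M_(_, _) => A 0 (enum_rank (BMultinom md))) vM.
rewrite !mxE => h; rewrite -[RHS]h; apply: eq_bigr => i _.
by rewrite mcoeffZ !mxE enum_rankK.
Qed.

Section PrimeIdeal.
Variables (M : set {mpoly K[n]}) (p : {mpoly K[n]}).
Hypotheses (iM : is_ideal M) (pM : forall k, ~ M (p ^+ k))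
  (maxM : forall x, ~ M x -> exists2 s, [set p ^+ k | k in setT] s & exists a, M (s - a * x)).

Lemma avoiding_prime x y : M (x * y) -> M x \/ M y.
Proof.
move=> hxy; apply: contrapT => /not_orP[/maxM[_ [k _ <-] [a ha]] /maxM[_ [l _ <-] [b hb]]].
apply: (pM (k := k + l)); rewrite exprD.
have -> : p ^+ k * p ^+ l =
    (p ^+ k - a * x) * p ^+ l + (a * x) * (p ^+ l - b * y) + (a * b) * (x * y).
  by rewrite mulrBl mulrBr addrA subrK mulrACA subrK.
by apply: (idealD iM); [apply: (idealD iM); [apply: idealMr|apply: idealMl]|apply: idealMl].
Qed.

Lemma avoiding_proper (c : K) : c != 0 -> ~ M c%:MP.
Proof.
move=> c0 h; apply: (pM (k := 0)); rewrite expr0.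
have := idealMl iM (c^-1)%:MP h; rewrite -mpolyCM mulVf //.
Qed.

(** Otherwise each [X_i - a] divides a power of [p] modulo [M]. For infinitely many [a] the exponent
    and the size of the quotient agree, so finitely many of these quotients are linearly dependent:
    the fractions [1/(X_i - a)] would be independent in a space of countable dimension. Clearing
    denominators puts [p^k P(X_i)] in [M] with [P] nonzero in one variable; [P] splits into linear
    factors and [M] is prime. *)
Lemma avoiding_linear i : exists a : K, M ('X_i - a%:MP).
Proof.
apply: contrapT => /forallNP noa.
have h a : exists kq : nat * {mpoly K[n]}, M (p ^+ kq.1 - kq.2 * ('X_i - a%:MP)).
  by have [_ [k _ <-] [q hq]] := maxM (noa a); exists (k, q).
have [kq hkq] := choice h.
have [N hN] := big_fibre_uniq (fun a => pickle ((kq a).1, msize (kq a).2)) uncK.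
have [[|a0 s0] [_ // _ /(_ a0 (mem_head _ _)) hd]] := hN 1%N.
pose k := (kq a0).1; pose d := msize (kq a0).2.
have [s [us ss fs]] := hN (#|{: 'X_{1..n < d}}|).+1.
have {}fs a : a \in s -> (kq a).1 = k /\ msize (kq a).2 = d.
  move=> /fs; rewrite -hd => /(pcan_inj pickleK) [-> ->]; by split.
pose t := tnth (in_tuple s).
have [||c [i0 ci0] hc] := @mpoly_dependent d (size s) (fun j => (kq (t j)).2).
- by move=> j; have [_ ->] := fs _ (mem_tnth j (in_tuple s)).
- by rewrite ss.
(* In this Lagrange form only the term [i0] survives at the node [t i0], so [P] is nonzero once
   [c i0] is. *)
pose P : {poly K} := \sum_j c j *: \prod_(l | l != j) ('X - (t l)%:P).
have P0 : P != 0.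
  have : P.[t i0] = c i0 * \prod_(l | l != i0) (t i0 - t l).
    rewrite horner_sum (bigD1 i0) //= [X in _ + X]big1 ?addr0 => [|j ji0].
      rewrite hornerZ horner_prod; congr (_ * _).
      by apply: eq_bigr => l _; rewrite hornerXsubC.
    rewrite hornerZ horner_prod (bigD1 i0) ?(eq_sym i0) //=.
    by rewrite hornerXsubC subrr mul0r mulr0.
  apply: contra_eq_neq => ->; rewrite horner0 eq_sym mulf_neq0 //.
  apply/prodf_neq0 => l li0; rewrite subr_eq0; apply: contraNneq li0 => e.
  rewrite -(inj_eq val_inj) /= -(nth_uniq 0 (ltn_ord l) (ltn_ord i0) us).
  by rewrite -!(tnth_nth 0 (in_tuple s)) -/(t _) -e.
pose ev (Q : {poly K}) : {mpoly K[n]} := (map_poly (@mpolyC n K) Q).['X_i].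
have evD : {morph ev : Q R / Q + R} by move=> Q R; rewrite /ev rmorphD hornerD.
have evM : {morph ev : Q R / Q * R} by move=> Q R; rewrite /ev rmorphM hornerM.
have evC a : ev a%:P = a%:MP by rewrite /ev map_polyC hornerC.
have evX a : ev ('X - a%:P) = 'X_i - a%:MP.
  by rewrite -polyCN evD evC mpolyCN /ev map_polyX hornerX.
have ev1 : ev 1 = 1 by rewrite -[1]/(1%:P) evC mpolyC1.
have evprod (J : finType) (A : pred J) F : ev (\prod_(j | A j) F j) = \prod_(j | A j) ev (F j).
  exact: (big_morph ev evM ev1).
have MP : M (p ^+ k * ev P).
  have -> : ev P = \sum_j (c j)%:MP * \prod_(l | l != j) ('X_i - (t l)%:MP).
    rewrite /P (big_morph ev evD (_ : ev 0 = 0)); last by rewrite -[0]/(0%:P) evC mpolyC0.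
    apply: eq_bigr => j _; rewrite -mul_polyC evM evC evprod.
    by congr (_ * _); apply: eq_bigr => l _; rewrite evX.
  have -> : p ^+ k * (\sum_j (c j)%:MP * \prod_(l | l != j) ('X_i - (t l)%:MP)) =
      \sum_j ((c j)%:MP * \prod_(l | l != j) ('X_i - (t l)%:MP))
        * (p ^+ k - (kq (t j)).2 * ('X_i - (t j)%:MP)).
    rewrite [RHS](_ : _ = \sum_j ((c j)%:MP * \prod_(l | l != j) ('X_i - (t l)%:MP)) * p ^+ k
      - (\sum_j c j *: (kq (t j)).2) * \prod_l ('X_i - (t l)%:MP)).
      by rewrite hc mul0r subr0 mulr_sumr; apply: eq_bigr => j _; rewrite mulrC.
    rewrite mulr_suml -sumrB; apply: eq_bigr => j _; rewrite mulrBr; congr (_ - _).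
    rewrite [in RHS](bigD1 j) //= -mul_mpolyC.
    by rewrite mulrACA -!mulrA; congr (_ * (_ * _)); rewrite mulrC.
  apply: ideal_sum => // j _; apply: idealMl => //.
  by have [<- _] := fs _ (mem_tnth j (in_tuple s)); apply: hkq.
have {MP}[/pM//|] := avoiding_prime MP.
have [r ->] := closed_field_poly_normal P.
rewrite -mul_polyC evM evC => /avoiding_prime[|]; first by apply: avoiding_proper; rewrite lead_coef_eq0.
elim: r => [|b r IH]; first by rewrite big_nil ev1 -mpolyC1; apply: avoiding_proper; apply: oner_neq0.
by rewrite big_cons evM evX => /avoiding_prime[/noa|].
Qed.

End PrimeIdeal.

(** An ideal maximal among those that contain [I] and no power of [p] is the maximal ideal of a
    point; [p] vanishes there, hence lies in it. *)
Theorem nullstellensatz (I : set {mpoly K[n]}) p : is_ideal I ->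
  (forall a, (forall q, I q -> q.@[a] = 0) -> p.@[a] = 0) ->
  exists k, I (p ^+ k).
Proof.
move=> iI hp; apply: contrapT => /forallNP pI.
have [_ [k _ <-]|M [iM IM MS maxM]] :=
  maximal_ideal_avoiding (S := [set p ^+ k | k in setT]) iI; first exact: pI.
have pM k : ~ M (p ^+ k) by apply: MS; exists k.
have [a ha] := choice (avoiding_linear iM pM maxM).
have Ma q : M q -> q.@[a] = 0.
  move=> Mq; apply/eqP; apply: contrapT => /negP q0; apply: (avoiding_proper iM pM q0).
  have := idealB iM Mq (mpoly_sub_eval iM ha q).
  by rewrite opprB addrCA subrr addr0.
apply: (pM 1%N); rewrite expr1.
have := mpoly_sub_eval iM ha p.
by rewrite (hp a) ?subr0 // => q /IM /Ma.
Qed.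

Corollary nullstellensatz1 (I : set {mpoly K[n]}) : is_ideal I ->
  (forall a, exists2 q, I q & q.@[a] != 0) -> I 1.
Proof.
move=> iI h; have [|k] := nullstellensatz (p := 1) iI; last by rewrite expr1n.
by move=> a ha; have [q /ha -> /eqP] := h a.
Qed.

End Nullstellensatz.

(** * Uncountability of the real and complex numbers *)

Lemma interval_avoiding (R : realFieldType) (s : seq R) (a b : R) : a < b ->
  exists c d, [/\ a <= c, c < d, d <= b & forall x, x \in s -> ~ (c <= x <= d)].
Proof.
move=> ab; elim: s => [|x s [c [d [ac cd db hs]]]]; first by exists a, b; split.
have [xm|mx] := ltP x ((c + d) / 2).
  exists ((c + d) / 2), d; split=> //; try lra.
  move=> y; rewrite inE => /predU1P[-> /andP[] |/hs hy /andP[h1 h2]]; first by lra.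
  by apply: hy; apply/andP; split; lra.
exists c, ((3 * c + d) / 4); split=> //; try lra.
move=> y; rewrite inE => /predU1P[-> /andP[] |/hs hy /andP[h1 h2]]; first by lra.
by apply: hy; apply/andP; split; lra.
Qed.

(** Cantor's nested intervals: if all fibres of [f] were finite, interval number [n + 1] could be
    chosen to miss the fibre of [n], and a common point of the intervals would have no value. *)
Lemma realType_big_fibre (R : realType) : big_fibre R.
Proof.
move=> f; apply: contrapT => /forallNP h.
have {}h n : exists s : seq R, forall a, f a = n -> a \in s.
  apply: contrapT => /forallNP hn; apply: (h n) => s.
  apply: contrapT => hs; apply: (hn s) => a fa.
  by apply: contrapT => /negP as_; apply: hs; exists a.
have [s hs] := choice h.
have step (nI : nat * (R * R)) : exists J : R * R, nI.2.1 < nI.2.2 ->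
    [/\ nI.2.1 <= J.1, J.1 < J.2, J.2 <= nI.2.2 &
    forall x, x \in s nI.1 -> ~ (J.1 <= x <= J.2)].
  have [ab|_] := boolP (nI.2.1 < nI.2.2); last by exists nI.2.
  by have [c [d hcd]] := interval_avoiding (s nI.1) ab; exists (c, d).
have [nxt hnxt] := choice step.
pose I := fix I n : R * R := if n is n'.+1 then nxt (n', I n') else (0, 1).
have lt n : (I n).1 < (I n).2.
  by elim: n => [|n IH] /=; [exact: ltr01|have [] := hnxt (n, I n) IH].
have mono m n : (m <= n)%N -> (I m).1 <= (I n).1 /\ (I n).2 <= (I m).2.
  move=> /subnK <-; elim: (n - m)%N => [|k [IH1 IH2]]; first by split.
  have [h1 _ h2 _] := hnxt ((k + m)%N, I (k + m)%N) (lt _).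
  by rewrite addSn; split; [exact: le_trans h1|exact: le_trans h2 _].
have lub m n : (I m).1 <= (I n).2.
  have [h1 _] := mono _ _ (leq_maxl m n); have [_ h2] := mono _ _ (leq_maxr m n).
  exact: le_trans h1 (le_trans (ltW (lt _)) h2).
pose E := [set (I n).1 | n in setT]; pose c := sup E.
have E0 : E !=set0 by exists (I 0%N).1; exists 0%N.
have hE : has_sup E by split=> //; exists (I 0%N).2 => _ [n _ <-].
have c1 n : (I n).1 <= c by apply: sup_upper_bound => //; exists n.
have c2 n : c <= (I n).2 by apply: ge_sup => // _ [m _ <-].
have [_ _ _ hc] := hnxt (f c, I (f c)) (lt _).
by apply: (hc c); [exact: hs|have := c1 (f c).+1; have := c2 (f c).+1 => /= -> ->].
Qed.

Lemma complex_big_fibre (R : realType) : big_fibre R[i].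
Proof.
move=> f; have [n hn] := realType_big_fibre (fun x : R => f (Complex x 0)).
exists n => s; have [a as_ fa] := hn [seq complex.Re z | z <- s].
by exists (Complex a 0) => //; apply: contra as_ => /(map_f (@complex.Re R)).
Qed.

(** * Tangent vectors *)

Definition linear_set (K : fieldType) (E : lmodType K) (S : set E) : Prop :=
  [/\ S 0, (forall x y, S x -> S y -> S (x + y)) & (forall c x, S x -> S (c *: x))].

Lemma linear_set_sum (K : fieldType) (E : lmodType K) (S : set E) (J : Type)
    (r : seq J) (P : pred J) F : linear_set S ->
  (forall j, P j -> S (F j)) -> S (\sum_(j <- r | P j) F j).
Proof. by move=> [S0 SD _] h; apply: big_ind. Qed.

Lemma linear_setN (K : fieldType) (E : lmodType K) (S : set E) x :
  linear_set S -> S x -> S (- x).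
Proof. by move=> [_ _ SZ] Sx; rewrite -scaleN1r; apply: SZ. Qed.

Lemma linear_setB (K : fieldType) (E : lmodType K) (S : set E) x y :
  linear_set S -> S x -> S y -> S (x - y).
Proof. by move=> h; have [_ SD _] := h => Sx /(linear_setN h); apply: SD. Qed.

(** A subspace of largest dimension inside [S] exhausts it. Sets defined by a property thus become
    [{vspace E}], where dimensions can be counted. *)
Lemma linear_set_vspace (K : fieldType) (E : vectType K) (S : set E) :
  linear_set S -> exists U : {vspace E}, forall x, S x <-> x \in U.
Proof.
move=> lS; have [S0 SD SZ] := lS.
pose P d := `[< exists U : {vspace E}, (forall x, x \in U -> S x) /\ \dim U = d >].
have exP : exists d, P d.
  exists 0%N; apply/asboolP; exists 0%VS; rewrite dimv0; split=> // x.
  by rewrite memv0 => /eqP ->.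
have ubP d : P d -> (d <= \dim {:E})%N by move=> /asboolP[U [_ <-]]; exact/dimvS/subvf.
case: (ex_maxnP exP ubP) => d /asboolP[U [US dU]] maxd.
exists U => x; split=> [Sx|/US//]; apply: contrapT => /negP xU.
suff : (\dim (U + <[x]>) <= d)%N.
  rewrite -dU => h; case/negP: xU.
  have /eqP -> : (U == U + <[x]>)%VS by rewrite eqEdim addvSl.
  by rewrite memvE addvSr.
apply: maxd; apply/asboolP; exists (U + <[x]>)%VS; split=> // y.
by case/memv_addP => u uU [v /vlineP[k ->] ->]; apply: SD; [exact: US|exact: SZ].
Qed.

Section DirectionalDerivative.
Variables (K : fieldType) (n : nat).
Implicit Types (p q : {mpoly K[n]}) (a y : 'rV[K]_n).

Definition ddir p a y := \sum_i (p^`M(i)).@[a 0] * y 0 i.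

Lemma ddirC c a y : ddir c%:MP a y = 0.
Proof. by rewrite /ddir big1 // => i _; rewrite mderivC meval0 mul0r. Qed.

Lemma ddirX i a y : ddir 'X_i a y = y 0 i.
Proof.
rewrite /ddir (bigD1 i) //= big1 ?addr0 => [|j ji]; rewrite mderivX mnm1E.
  by rewrite eqxx scale1r mevalX big1 ?mul1r // => j _; rewrite mnmBE subnn.
by rewrite eq_sym (negbTE ji) scale0r meval0 mul0r.
Qed.

Lemma ddirD p q a y : ddir (p + q) a y = ddir p a y + ddir q a y.
Proof. by rewrite -big_split; apply: eq_bigr => i _; rewrite mderivD mevalD mulrDl. Qed.

Lemma ddirM p q a y : ddir (p * q) a y = ddir p a y * q.@[a 0] + p.@[a 0] * ddir q a y.
Proof.
rewrite /ddir mulr_suml mulr_sumr -big_split; apply: eq_bigr => i _ /=.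
by rewrite mderivM mevalD !mevalM mulrDl mulrAC mulrA.
Qed.

Lemma ddirZ c p a y : ddir (c *: p) a y = c * ddir p a y.
Proof. by rewrite -mul_mpolyC ddirM ddirC mul0r add0r mevalC. Qed.

Lemma ddirN p a y : ddir (- p) a y = - ddir p a y.
Proof. by rewrite -scaleN1r ddirZ mulN1r. Qed.

Lemma ddirB p q a y : ddir (p - q) a y = ddir p a y - ddir q a y.
Proof. by rewrite ddirD ddirN. Qed.

Lemma ddir_sum (J : Type) (r : seq J) (P : pred J) F a y :
  ddir (\sum_(j <- r | P j) F j) a y = \sum_(j <- r | P j) ddir (F j) a y.
Proof.
apply: (big_morph (fun p => ddir p a y)) => [p q|]; first exact: ddirD.
by rewrite -mpolyC0 ddirC.
Qed.

Lemma ddir_linear p a : linear (ddir p a : 'rV_n -> K^o).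
Proof.
move=> c y z; rewrite /ddir scaler_sumr -big_split; apply: eq_bigr => i _ /=.
by rewrite !mxE mulrDr mulrCA.
Qed.

Lemma ddir0 p a : ddir p a 0 = 0.
Proof. by rewrite /ddir big1 // => i _; rewrite mxE mulr0. Qed.

Lemma ddirDr p a y z : ddir p a (y + z) = ddir p a y + ddir p a z.
Proof. by have := ddir_linear p a 1 y z; rewrite !scale1r. Qed.

Lemma ddirZr c p a y : ddir p a (c *: y) = c * ddir p a y.
Proof. by have := ddir_linear p a c y 0; rewrite !addr0 ddir0 addr0. Qed.

Lemma ddir_mulmx p a y : ddir p a y = (y *m \col_i (p^`M(i)).@[a 0]) 0 0.
Proof. by rewrite mxE; apply: eq_bigr => i _; rewrite mxE mulrC. Qed.

Definition vfield (v : 'rV[{mpoly K[n]}]_n) p := \sum_i p^`M(i) * v 0 i.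

Lemma vfield_eval v p a :
  (vfield v p).@[a 0] = ddir p a (\row_i (v 0 i).@[a 0]).
Proof. by rewrite rmorph_sum; apply: eq_bigr => i _; rewrite rmorphM mxE. Qed.

Lemma vfieldC v c : vfield v c%:MP = 0.
Proof. by rewrite /vfield big1 // => i _; rewrite mderivC mul0r. Qed.

Lemma vfieldX v i : vfield v 'X_i = v 0 i.
Proof.
rewrite /vfield (bigD1 i) //= big1 ?addr0 => [|j ji]; rewrite mderivX mnm1E.
  rewrite eqxx scale1r (_ : (_ - _)%MM = 0%MM) ?mpolyX0 ?mul1r //.
  by apply/mnmP => j; rewrite mnmBE subnn mnm0E.
by rewrite eq_sym (negbTE ji) scale0r mul0r.
Qed.

Lemma vfieldD v p q : vfield v (p + q) = vfield v p + vfield v q.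
Proof. by rewrite -big_split; apply: eq_bigr => i _; rewrite mderivD mulrDl. Qed.

Lemma vfieldM v p q : vfield v (p * q) = vfield v p * q + p * vfield v q.
Proof.
rewrite /vfield mulr_suml mulr_sumr -big_split; apply: eq_bigr => i _ /=.
by rewrite mderivM mulrDl mulrAC mulrA.
Qed.

Lemma vfieldZ v c p : vfield v (c *: p) = c *: vfield v p.
Proof. by rewrite -mul_mpolyC vfieldM vfieldC mul0r add0r mul_mpolyC. Qed.

Lemma vfieldB v p q : vfield v (p - q) = vfield v p - vfield v q.
Proof. by rewrite vfieldD -scaleN1r vfieldZ scaleN1r. Qed.

Lemma vfield_sum v (J : Type) (r : seq J) (P : pred J) F :
  vfield v (\sum_(j <- r | P j) F j) = \sum_(j <- r | P j) vfield v (F j).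
Proof.
apply: (big_morph (vfield v)) => [p q|]; first exact: vfieldD.
by rewrite -mpolyC0 vfieldC.
Qed.

End DirectionalDerivative.

(** * Taylor expansion at a point along fields tangent to an ideal *)

Section Taylor.
Variables (K : numFieldType) (n : nat) (a : 'rV[K]_n).
Variable v : 'rV[K]_n -> 'rV[{mpoly K[n]}]_n.
Hypothesis v_lin : forall y, v y = \sum_i (y 0 i)%:MP *: v (delta_mx 0 i).
Hypothesis v_a : forall y i, (v y 0 i).@[a 0] = y 0 i.
Variable I : set {mpoly K[n]}.
Hypotheses (iI : is_ideal I) (Ia : forall p, I p -> p.@[a 0] = 0).
Implicit Types (p q : {mpoly K[n]}) (y : 'rV[K]_n).

Definition tangent : set 'rV[K]_n := [set y | forall p, I p -> ddir p a y = 0].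

Hypothesis Iv : forall y, tangent y -> forall p, I p -> I (vfield (v y) p).

Let t i : {mpoly K[n]} := 'X_i - (a 0 i)%:MP.
Let mp r := max_pow (a 0) r.
Let mpi r : is_ideal (mp r) := max_pow_ideal (a 0) r.

Lemma max_pow_mulX i r q : mp r q -> mp r.+1 (t i * q).
Proof.
move=> hq; exists (fun j => (j == i)%:R * q); split=> [j|]; first exact: idealMl.
by rewrite (bigD1 i) //= eqxx mul1r big1 ?addr0 // => j /negbTE ->; rewrite mul0r mulr0.
Qed.

Lemma max_pow1 p : p.@[a 0] = 0 -> mp 1 p.
Proof.
move=> p0; rewrite -[p]subr0 -mpolyC0 -p0; apply: mpoly_sub_eval => // i.
by rewrite -[_ - _]mulr1; apply: (@max_pow_mulX i 0).
Qed.

Lemma max_powM r s p q : mp r p -> mp s q -> mp (r + s) (p * q).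
Proof.
elim: r p => [|r IH] p; first by move=> _; rewrite add0n; apply: idealMl.
move=> [f [hf ->]] hq; rewrite mulr_suml; apply: ideal_sum => // i _.
by rewrite -mulrA addSn; apply: max_pow_mulX; apply: IH => //; exact: hf.
Qed.

Lemma vfield_sumE y p : vfield (v y) p = \sum_i y 0 i *: vfield (v (delta_mx 0 i)) p.
Proof.
rewrite /vfield v_lin; under [RHS]eq_bigr do rewrite scaler_sumr.
rewrite exchange_big; apply: eq_bigr => j _ /=; rewrite summxE mulr_sumr.
by apply: eq_bigr => i _; rewrite mxE -mul_mpolyC mulrCA.
Qed.

Lemma vfield_max_pow y r p : mp r.+1 p -> mp r (vfield (v y) p).
Proof.
elim: r p => [//|r IH] p [f [hf ->]]; rewrite vfield_sum; apply: ideal_sum => // i _.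
rewrite vfieldM; apply: idealD => //; first by apply: idealMl => //; exact: hf.
by apply: max_pow_mulX; apply: IH; exact: hf.
Qed.

(* Euler's identity for the leading form of p at the point a. *)
Lemma euler_max_pow r p : mp r p ->
  mp r.+1 (\sum_i t i * vfield (v (delta_mx 0 i)) p - r%:R *: p).
Proof.
elim: r p => [|r IH] p.
  move=> _; rewrite scale0r subr0; apply: ideal_sum => // i _.
  by apply: (@max_pow_mulX i 0).
move=> [f [hf ->]].
have -> : \sum_i t i * vfield (v (delta_mx 0 i)) (\sum_j t j * f j) -
    r.+1%:R *: (\sum_j t j * f j) =
  \sum_j (t j * (\sum_i t i * vfield (v (delta_mx 0 i)) (f j) - r%:R *: f j)
    + (\sum_i t i * vfield (v (delta_mx 0 i)) (t j) - t j) * f j).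
  rewrite [RHS](eq_bigr (fun j => \sum_i t i * vfield (v (delta_mx 0 i)) (t j * f j)
      - r.+1%:R *: (t j * f j))) => [|j _]; last first.
    set X := \sum_i _ * _ (f j); set Y := \sum_i _ * _ (t j).
    have -> : \sum_i t i * vfield (v (delta_mx 0 i)) (t j * f j) = Y * f j + t j * X.
      rewrite mulr_suml mulr_sumr -big_split; apply: eq_bigr => i _ /=.
      by rewrite vfieldM mulrDr !mulrA; congr (_ + _ * _); rewrite mulrC.
    move: X Y (t j) => X Y u; rewrite -natr1 scalerDl scale1r mulrBr mulrBl -scalerAr opprD.
    by rewrite addrACA; congr (_ + _); rewrite addrC.
  rewrite sumrB scaler_sumr; congr (_ - _).
  rewrite exchange_big; apply: eq_bigr => i _ /=.
  by rewrite vfield_sum mulr_sumr.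
apply: ideal_sum => // j _; apply: idealD => //; first exact/max_pow_mulX/IH/hf.
apply: (@max_powM 2 r); last exact: hf.
have -> : \sum_i t i * vfield (v (delta_mx 0 i)) (t j) - t j =
    \sum_i t i * (v (delta_mx 0 i) 0 j - (delta_mx 0 i : 'rV_n) 0 j *: 1).
  rewrite -[X in _ - X](_ : \sum_i t i * ((delta_mx 0 i : 'rV_n) 0 j *: 1) = _).
    rewrite -sumrB; apply: eq_bigr => i _; rewrite mulrBr; congr (_ * _ - _).
    by rewrite vfieldB vfieldC subr0 vfieldX.
  rewrite (bigD1 j) //= mxE !eqxx scale1r mulr1 big1 ?addr0 // => i ij.
  by rewrite mxE eqxx (eq_sym j) (negbTE ij) scale0r mulr0.
apply: ideal_sum => // i _; apply: max_pow_mulX; apply: max_pow1.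
by rewrite mevalB v_a mevalZ meval1 mulr1 subrr.
Qed.

Lemma tangent_linear_set : linear_set tangent.
Proof.
split=> [p _|x y hx hy p Ip|c x hx p Ip]; first exact: ddir0.
- by rewrite ddirDr hx ?hy ?addr0.
- by rewrite ddirZr hx ?mulr0.
Qed.

Let grad p : 'cV[K]_n := \col_i (p^`M(i)).@[a 0].

(** The gradients at [a] of the elements of [I] form a space with annihilator [tangent]; in finite
    dimension it equals its double annihilator. *)
Lemma tangent_dual (u : 'cV[K]_n) : (forall y, tangent y -> y *m u = 0) ->
  exists2 p, I p & grad p = u.
Proof.
move=> hu; pose S := [set w : 'cV[K]_n | exists2 p, I p & grad p = w].
have gE p : grad p = \col_i (p^`M(i)).@[a 0] by [].
have lS : linear_set S.
  split; first by exists 0; [exact: ideal0|apply/colP => i; rewrite !mxE mderiv0 meval0].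
    move=> _ _ [p Ip <-] [q Iq <-]; exists (p + q); first exact: idealD.
    by apply/colP => i; rewrite !mxE mderivD mevalD.
  move=> c _ [p Ip <-]; exists (c *: p).
    by rewrite -mul_mpolyC; apply: idealMl.
  by apply/colP => i; rewrite !mxE mderivZ mevalZ.
have [U hU] := linear_set_vspace lS.
apply/hU; pose A := \matrix_(i < \dim U) ((vbasis U)`_i)^T.
have UA w : w \in U <-> (w^T <= A)%MS.
  split=> [wU|/submxP[D wD]].
    rewrite (coord_vbasis wU) linear_sum; apply: summx_sub => i _.
    by rewrite linearZ scalemx_sub // -[X in (X <= _)%MS](rowK (fun i => ((vbasis U)`_i)^T)) row_sub.
  have -> : w = \sum_i D 0 i *: (vbasis U)`_i.
    apply: trmx_inj; rewrite wD mulmx_sum_row linear_sum; apply: eq_bigr => i _.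
    by rewrite rowK linearZ.
  by apply: rpred_sum => i _; apply: rpredZ; apply: vbasis_mem; rewrite mem_nth ?size_tuple.
apply/UA; rewrite submxE; apply/eqP/rowP => j; rewrite mxE.
pose y := (col j (cokermx A))^T.
have ty : tangent y.
  move=> p Ip; rewrite ddir_mulmx -gE.
  have /UA/submxP[D hD] : grad p \in U by apply/hU; exists p.
  rewrite -[grad p]trmxK hD -trmx_mul -mulmxA.
  suff -> : A *m col j (cokermx A) = 0 by rewrite mulmx0 !mxE.
  by rewrite colE mulmxA mulmx_coker mul0mx.
have := congr1 (fun M : 'M_1 => M 0 0) (hu y ty).
rewrite !mxE => h; rewrite -[RHS]h; apply: eq_bigr => i _.
by rewrite !mxE mulrC.
Qed.

(** Euler's identity in degree 1 expresses [p], up to order 2, by products of the [t i] with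
    derivatives of [p], and these derivatives vanish at [a]. *)
Lemma max_pow2 p : p.@[a 0] = 0 -> grad p = 0 -> mp 2 p.
Proof.
move=> p0 gp; have := euler_max_pow (max_pow1 p0).
rewrite scale1r; set S := \sum_i _ => h; rewrite -(subKr S p).
apply: (idealB (mpi 2)) => //; apply: (ideal_sum (mpi 2)) => i _.
apply: max_pow_mulX; apply: max_pow1; rewrite vfield_eval.
by rewrite ddir_mulmx -[X in _ *m X]/(grad p) gp mulmx0 mxE.
Qed.

(** To raise the order of [q] by one, Euler's identity recovers [r.+1%:R *: q] from the derivatives
    of [q]. Those along [tangent] fall in [I]; the transverse ones are multiplied by linear forms
    that have order 2 modulo [I]. The division by [r.+1] uses characteristic 0. *)
Lemma taylor_ideal p : p.@[a 0] = 0 ->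
  (forall y, tangent y -> I (vfield (v y) p)) ->
  forall r, exists2 q, mp r q & I (p - q).
Proof.
move=> p0 hp; case=> [|r]; first by exists p => //; rewrite subrr; apply: ideal0.
elim: r => [|r [q hq Ipq]].
  by exists p; [exact: max_pow1|rewrite subrr; apply: ideal0].
have [U hU] := linear_set_vspace tangent_linear_set.
pose P := lin1_mx (projv U).
have PE y : y *m P = projv U y by rewrite mul_rV_lin1.
(* [P] projects onto the tangent space, so the linear form [u l] vanishes on it and has the gradient
   of an element of [I]. *)
pose u l := \sum_i ((1%:M - P) i l) *: t i.
have hu l : exists2 s, mp 2 s & I (u l - s).
  have [|f If gf] := @tangent_dual (col l (1%:M - P)).
    move=> y /hU yU; rewrite colE mulmxA mulmxBr mulmx1 PE projv_id // subrr.
    by rewrite mul0mx.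
  exists (u l - f); last by rewrite opprB addrC subrK.
  have tu i : (t i).@[a 0] = 0 by rewrite mevalB mevalXU mevalC subrr.
  apply: max_pow2.
    rewrite mevalB (Ia If) subr0 raddf_sum big1 // => i _.
    by rewrite /= mevalZ tu mulr0.
  apply/colP => j; rewrite !mxE mderivB mevalB.
  have := congr1 (fun M : 'cV_n => M j 0) gf; rewrite !mxE => ->.
  rewrite /u [mderiv _ _]raddf_sum [meval _ _]raddf_sum (bigD1 j) //= big1 => [|i ij].
    rewrite addr0 mderivZ mevalZ mderivB mderivC subr0 mderivX mnm1E eqxx scale1r.
    rewrite mevalX big1 ?mulr1 ?mxE ?subrr // => k _; by rewrite mnmBE subnn.
  by rewrite mderivZ mevalZ mderivB mderivC subr0 mderivX mnm1E (negbTE ij) scale0r meval0 mulr0.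
have {}hu l : exists s, mp 2 s /\ I (u l - s) by have [s h1 h2] := hu l; exists s.
have [s hs] := choice hu.
pose w := \sum_l s l * vfield (v (delta_mx 0 l)) q.
have hw : mp r.+2 w.
  apply: ideal_sum => // l _; apply: (@max_powM 2 r); first by have [] := hs l.
  exact: vfield_max_pow.
have euler := euler_max_pow hq.
pose e := \sum_i t i * vfield (v (delta_mx 0 i)) q - r.+1%:R *: q.
have Iew : I (e + r.+1%:R *: q - w).
  rewrite subrK.
  have -> : \sum_i t i * vfield (v (delta_mx 0 i)) q =
      \sum_i t i * vfield (v (delta_mx 0 i *m P)) q + \sum_l u l * vfield (v (delta_mx 0 l)) q.
    have vD y z : vfield (v (y + z)) q = vfield (v y) q + vfield (v z) q.
      rewrite !(vfield_sumE _ q) -big_split; apply: eq_bigr => i _.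
      by rewrite mxE scalerDl.
    transitivity (\sum_i (t i * vfield (v (delta_mx 0 i *m P)) q +
        t i * vfield (v (delta_mx 0 i *m (1%:M - P))) q)).
      apply: eq_bigr => i _; rewrite -mulrDr -vD -mulmxDr.
      by rewrite addrC subrK mulmx1.
    rewrite big_split /=; congr (_ + _).
    under eq_bigr do rewrite vfield_sumE mulr_sumr.
    rewrite exchange_big; apply: eq_bigr => l _ /=; rewrite mulr_suml.
    apply: eq_bigr => i _; rewrite -rowE -scalerAl -scalerAr.
    by rewrite [row _ _ _ _]mxE.
  rewrite -addrA; apply: idealD => //.
    apply: ideal_sum => // i _; apply: idealMl => //.
    have ty : tangent (delta_mx 0 i *m P) by apply/hU; rewrite PE memv_proj.
    rewrite -(subKr p q) vfieldB; apply: idealB => //; first exact: hp.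
    exact: Iv.
  rewrite -sumrB; apply: ideal_sum => // l _; rewrite -mulrBl.
  by apply: idealMr => //; have [] := hs l.
have r0 : r.+1%:R != 0 :> K by rewrite pnatr_eq0.
exists ((r.+1%:R)^-1 *: (w - e)).
  by rewrite -mul_mpolyC; apply: idealMl => //; apply: idealB.
have -> : p - (r.+1%:R)^-1 *: (w - e) =
    (p - q) + (r.+1%:R)^-1%:MP * (e + r.+1%:R *: q - w).
  have -> : e + r.+1%:R *: q - w = r.+1%:R *: q - (w - e).
    by rewrite opprB addrA [_ + e]addrC.
  by rewrite mul_mpolyC [in RHS]scalerBr scalerA mulVf // scale1r addrA subrK.
apply: idealD => //; exact: idealMl.
Qed.

(** Krull's theorem turns vanishing to all orders modulo [I] into vanishing near [a]: [s] is a
    denominator invertible at [a]. *)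
Lemma annihilated_locally p : p.@[a 0] = 0 ->
  (forall y, tangent y -> I (vfield (v y) p)) ->
  exists2 s, s.@[a 0] = 1 & I (s * p).
Proof. by move=> p0 hp; apply: krull_intersection => //; apply: taylor_ideal. Qed.

End Taylor.

(** * Polynomial functions and rational representations *)

Section PolynomialFunctions.
Variables (K : fieldType) (T : Type) (N : nat) (c : T -> 'rV[K]_N).
Implicit Types f h : T -> K.

Definition polyf (f : T -> K) : Prop :=
  exists p : {mpoly K[N]}, forall x, f x = p.@[c x 0].

Lemma polyf_ext f h : f =1 h -> polyf f -> polyf h.
Proof. by move=> fh [p hp]; exists p => x; rewrite -fh. Qed.

Lemma polyf_cst a : polyf (fun=> a).
Proof. by exists a%:MP => x; rewrite mevalC. Qed.

Lemma polyf_coord i : polyf (fun x => c x 0 i).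
Proof. by exists 'X_i => x; rewrite mevalXU. Qed.

Lemma polyfD f h : polyf f -> polyf h -> polyf (fun x => f x + h x).
Proof. by move=> [p hp] [q hq]; exists (p + q) => x; rewrite mevalD hp hq. Qed.

Lemma polyfM f h : polyf f -> polyf h -> polyf (fun x => f x * h x).
Proof. by move=> [p hp] [q hq]; exists (p * q) => x; rewrite mevalM hp hq. Qed.

Lemma polyfZ a f : polyf f -> polyf (fun x => a * f x).
Proof. by apply: polyfM; apply: polyf_cst. Qed.

Lemma polyfN f : polyf f -> polyf (fun x => - f x).
Proof. by move=> /(polyfZ (-1)); apply: polyf_ext => x; rewrite mulN1r. Qed.

Lemma polyfB f h : polyf f -> polyf h -> polyf (fun x => f x - h x).
Proof. by move=> hf /polyfN; apply: polyfD. Qed.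

Lemma polyf_sum (J : Type) (r : seq J) (P : pred J) (F : J -> T -> K) :
  (forall j, polyf (F j)) -> polyf (fun x => \sum_(j <- r | P j) F j x).
Proof.
move=> hF; elim: r => [|j r IH].
  by apply: polyf_ext (polyf_cst 0) => x; rewrite big_nil.
apply: (polyf_ext (f := fun x => (if P j then F j x else 0) +
                                 \sum_(j <- r | P j) F j x)) => [x|].
  by rewrite big_cons; case: (P j); rewrite ?add0r.
by apply: polyfD => //; case: (P j) => //; apply: polyf_cst.
Qed.

Lemma polyf_prod (J : Type) (r : seq J) (P : pred J) (F : J -> T -> K) :
  (forall j, polyf (F j)) -> polyf (fun x => \prod_(j <- r | P j) F j x).
Proof.
move=> hF; elim: r => [|j r IH].
  by apply: polyf_ext (polyf_cst 1) => x; rewrite big_nil.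
apply: (polyf_ext (f := fun x => (if P j then F j x else 1) *
                                 \prod_(j <- r | P j) F j x)) => [x|].
  by rewrite big_cons; case: (P j); rewrite ?mul1r.
by apply: polyfM => //; case: (P j) => //; apply: polyf_cst.
Qed.

Definition polymx m n (A : T -> 'M[K]_(m, n)) : Prop :=
  forall i j, polyf (fun x => A x i j).

Lemma polymx_cst m n (A : 'M_(m, n)) : polymx (fun=> A).
Proof. by move=> i j; apply: polyf_cst. Qed.

Lemma polymx_mul m n p (A : T -> 'M_(m, n)) (B : T -> 'M_(n, p)) :
  polymx A -> polymx B -> polymx (fun x => A x *m B x).
Proof.
move=> hA hB i j; apply: polyf_ext (_ : polyf (fun x => \sum_k A x i k * B x k j)).
  by move=> x; rewrite mxE.
by apply: polyf_sum => k; apply: polyfM.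
Qed.

Lemma polymxB m n (A B : T -> 'M_(m, n)) :
  polymx A -> polymx B -> polymx (fun x => A x - B x).
Proof.
move=> hA hB i j; apply: polyf_ext (polyfB (hA i j) (hB i j)) => x.
by rewrite !mxE.
Qed.

Lemma polyf_det n (A : T -> 'M_n) : polymx A -> polyf (fun x => \det (A x)).
Proof.
move=> hA; apply: polyf_sum => s; apply: polyfZ.
by apply: polyf_prod => i; apply: hA.
Qed.

Lemma polyf_pullback n (d : T -> 'rV[K]_n) (p : {mpoly K[n]}) :
  polymx d -> polyf (fun x => p.@[d x 0]).
Proof.
move=> hd; elim/mpoly_alg_ind: p => [a|i|p q hp hq|p q hp hq].
- by apply: polyf_ext (polyf_cst a) => x; rewrite mevalC.
- by apply: polyf_ext (hd 0 i) => x; rewrite mevalXU.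
- by apply: polyf_ext (polyfD hp hq) => x; rewrite mevalD.
- by apply: polyf_ext (polyfM hp hq) => x; rewrite mevalM.
Qed.

Lemma polymx_mxvec m n (A : T -> 'M[K]_(m, n)) :
  polymx (fun x => mxvec (A x)) <-> polymx A.
Proof.
split=> h i j; last by rewrite ord1; case/mxvec_indexP: j => i' j';
  apply: polyf_ext (h i' j') => x; rewrite mxvecE.
by apply: polyf_ext (h 0 (mxvec_index i j)) => x; rewrite mxvecE.
Qed.

End PolynomialFunctions.

Lemma polymx_coord (K : fieldType) (T : Type) m n (A : T -> 'M[K]_(m, n)) :
  polymx (fun x => mxvec (A x)) A.
Proof.
move=> i j; apply: polyf_ext (polyf_coord _ (mxvec_index i j)) => x.
by rewrite mxvecE.
Qed.

Lemma polyf_trans (K : fieldType) (T : Type) N n (c : T -> 'rV[K]_N)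
    (d : T -> 'rV[K]_n) f : polymx c d -> polyf d f -> polyf c f.
Proof. by move=> hd [p hp]; apply: polyf_ext (polyf_pullback p hd) => x; rewrite hp. Qed.

Lemma polyf_precomp (K : fieldType) (T U : Type) N n (c : T -> 'rV[K]_N)
    (d : U -> 'rV[K]_n) (u : U -> T) f :
  polymx d (fun x => c (u x)) -> polyf c f -> polyf d (fun x => f (u x)).
Proof. by move=> hd [p hp]; apply: polyf_ext (polyf_pullback p hd) => x; rewrite hp. Qed.

(** While the chosen columns have rank less than [r], a nonzero row vector annihilates them all; a
    column that it does not annihilate raises the rank. *)
Lemma row_free_columns (K : fieldType) (J : Type) r (c : J -> 'cV[K]_r) :
  (forall w : 'rV_r, (forall j, w *m c j = 0) -> w = 0) ->
  exists m (j : 'I_m -> J) (D : 'M_(m, r)), (\matrix_(i, l) c (j l) i 0) *m D = 1%:M.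
Proof.
move=> hc; pose Q m (j : 'I_m -> J) := \matrix_(i, l) c (j l) i 0.
suff [m [j hj]] : exists m (j : 'I_m -> J), row_free (Q m j).
  by exists m, j, (pinvmx (Q m j)); exact: mulmxVp.
suff [m [j hj]] : exists m (j : 'I_m -> J), (r <= \rank (Q m j))%N.
  by exists m, j; rewrite /row_free eqn_leq rank_leq_row.
suff h d : (d <= r)%N -> exists m (j : 'I_m -> J), (d <= \rank (Q m j))%N by exact: h.
elim: d => [_|d IH dr].
  have j0 : 'I_0 -> J by case.
  by exists 0%N, j0.
have [m [j hj]] := IH (ltnW dr).
have [//|dj] := ltnP d (\rank (Q m j)); first by exists m, j.
have : kermx (Q m j) != 0.
  by rewrite kermx_eq0 /row_free neq_ltn (leq_ltn_trans dj dr).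
move/rowV0Pn => [w /sub_kermxP wQ w0].
have [j1 hj1] : exists j1, w *m c j1 != 0.
  apply: contrapT => /forallNP h; case/eqP: w0; apply: hc => j1.
  by apply/eqP; apply: contrapT => /negP; apply: h.
pose j' (l : 'I_(m + 1)) := if split l is inl l' then j l' else j1.
exists (m + 1)%N, j'.
have -> : Q _ j' = row_mx (Q _ j) (c j1).
  apply/matrixP => i l; rewrite !mxE /j'; case: split => l'; first by rewrite mxE.
  by rewrite ord1.
rewrite ltnNge; apply: contra hj1 => h.
have : (kermx (Q m j) <= kermx (row_mx (Q m j) (c j1)))%MS.
  have sub : (kermx (row_mx (Q m j) (c j1)) <= kermx (Q m j))%MS.
    apply/sub_kermxP; have := mulmx_ker (row_mx (Q m j) (c j1)).
    by rewrite mul_mx_row -[RHS](row_mx0 K _ m 1) => /eq_row_mx[].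
  rewrite -(geq_leqif (mxrank_leqif_sup sub)) !mxrank_ker.
  by apply: leq_sub2l; apply: leq_trans h hj.
move/submxP => [D hD].
have /sub_kermxP : (w <= kermx (row_mx (Q m j) (c j1)))%MS.
  by apply: submx_trans (_ : _ <= kermx (Q m j))%MS _; [apply/sub_kermxP|rewrite hD submxMl].
by rewrite mul_mx_row -[RHS](row_mx0 K _ m 1) => /eq_row_mx[_ ->].
Qed.

(** * Local finiteness of translations; affine algebraic groups are linear *)

Section LocalFiniteness.
Variables (K : fieldType) (G : groupType) (N : nat) (c : G -> 'rV[K]_N).
Hypothesis mul_split : forall f, polyf c f ->
  exists r (a b : 'I_r -> G -> K), [/\ forall k, polyf c (a k), forall k, polyf c (b k) &
    forall g h, f (g * h)%g = \sum_k a k g * b k h].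

Lemma polyf_rtrans f h : polyf c f -> polyf c (fun g => f (g * h)%g).
Proof.
move=> /mul_split[r [a [b [ha hb E]]]].
apply: polyf_ext (_ : polyf c (fun g => \sum_k b k h * a k g)).
  by move=> g; rewrite E; apply: eq_bigr => k _; rewrite mulrC.
by apply: polyf_sum => k; apply: polyfZ.
Qed.

Lemma mul_split_family s (f : G -> 'rV[K]_s) : polymx c f ->
  exists r (a : G -> 'rV_r) (b : G -> 'M_(r, s)), [/\ polymx c a, polymx c b &
    forall g h, f (g * h)%g = a g *m b h].
Proof.
move=> hf.
have h i : exists rab : {r : nat & (('I_r -> G -> K) * ('I_r -> G -> K))%type},
    [/\ forall k, polyf c ((tagged rab).1 k), forall k, polyf c ((tagged rab).2 k) &
     forall g h, f (g * h)%g 0 i = \sum_k (tagged rab).1 k g * (tagged rab).2 k h].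
  by have [r [a [b hab]]] := mul_split (hf 0 i); exists (existT _ r (a, b)).
have [F hF] := choice h.
pose J : finType := {i : 'I_s & 'I_(tag (F i))}.
pose a g := \row_(k < #|J|) (tagged (F (tag (enum_val k)))).1 (tagged (enum_val k)) g.
pose b g := \matrix_(k < #|J|, i < s)
  ((tag (enum_val k) == i)%:R * (tagged (F (tag (enum_val k)))).2 (tagged (enum_val k)) g).
exists #|J|, a, b; split=> [i k|k i|g h'].
- apply: polyf_ext (_ : polyf c ((tagged (F (tag (enum_val k)))).1 (tagged (enum_val k)))).
    by move=> g; rewrite mxE.
  by have [] := hF (tag (enum_val k)).
- apply: polyf_ext (_ : polyf c (fun g => (tag (enum_val k) == i)%:R *
     (tagged (F (tag (enum_val k)))).2 (tagged (enum_val k)) g)).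
    by move=> g; rewrite mxE.
  by apply: polyfZ; have [] := hF (tag (enum_val k)).
- apply/rowP => i; have [_ _ ->] := hF i; rewrite mxE.
  under [RHS]eq_bigr do rewrite !mxE.
  rewrite -(big_enum_val (A := J) (fun x : J => (tagged (F (tag x))).1 (tagged x) g *
     ((tag x == i)%:R * (tagged (F (tag x))).2 (tagged x) h'))) /=.
  rewrite -(sig_big_dep (fun _ => true) (fun _ _ => true) (fun j (x : 'I_(tag (F j))) =>
    (tagged (F j)).1 x g * ((j == i)%:R * (tagged (F j)).2 x h'))) /=.
  rewrite [RHS](bigD1 i) //= [X in _ + X]big1 ?addr0 => [|j /negbTE ->].
    by apply: eq_bigr => k _; rewrite eqxx mul1r.
  by rewrite big1 // => k _; rewrite mul0r mulr0.
Qed.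

(** [1 - u w] annihilates the nonzero column [u], so it is singular and factors through its smaller
    rank. *)
Lemma mx_split_lt r (u : 'cV[K]_r) (w : 'rV[K]_r) : w *m u = 1%:M ->
  exists r' (C : 'M_(r, r')) (D : 'M_(r', r)), (r' < r)%N /\ 1%:M - u *m w = C *m D.
Proof.
move=> wu; set A := 1%:M - u *m w.
exists (\rank A), (col_base A), (row_base A); split; last by rewrite mulmx_base.
rewrite ltn_neqAle rank_leq_row andbT; apply/eqP => fA.
have Au : A *m u = 0 by rewrite mulmxBl -mulmxA wu mulmx1 mul1mx subrr.
have : A \in unitmx by rewrite -row_full_unit /row_full fA.
move=> /mulKmx /(_ u) ; rewrite Au mulmx0 => u0.
by have := wu; rewrite -u0 mulmx0 => /matrixP/(_ 0 0)/eqP; rewrite !mxE eq_sym oner_eq0.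
Qed.

Lemma row_dual r (u : 'cV[K]_r) : u != 0 -> exists w : 'rV_r, w *m u = 1%:M.
Proof.
move=> u0; have [i ui] : exists i, u i 0 != 0.
  apply: contrapT => /forallNP h; case/eqP: u0; apply/colP => i; rewrite mxE.
  by apply/eqP; apply: contrapT => /negP; apply: h.
exists ((u i 0)^-1 *: delta_mx 0 i); apply/rowP => j.
by rewrite !ord1 -scalemxAl -rowE !mxE mulVf.
Qed.

(** In a decomposition [f (g * h) = a g *m b h] of least length, the entries of [a] and the rows of
    [b] are linearly independent. The entries of [a] are then combinations of translates of [f],
    translations preserve their span, and [W] is the matrix of translation in this basis. *)
Lemma local_finite s (f : G -> 'rV[K]_s) : polymx c f ->
  exists r (a : G -> 'rV_r) (W : G -> 'M_r) (B : 'M_(r, s)),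
  [/\ polymx c a, polymx c W, (forall u : 'cV_r, (forall g, a g *m u = 0) -> u = 0),
      forall g, f g = a g *m B &
      [/\ forall g h, a (g * h)%g = a g *m W h, W 1%g = 1%:M &
          forall g h, W (g * h)%g = W g *m W h]].
Proof.
move=> hf.
pose P r := exists (a : G -> 'rV_r) (b : G -> 'M_(r, s)), [/\ polymx c a, polymx c b &
    forall g h, f (g * h)%g = a g *m b h].
have exP : exists r, `[< P r >].
  by have [r hr] := mul_split_family hf; exists r; apply/asboolP.
case: (ex_minnP exP) => r /asboolP[a [b [ha hb E]]] minr.
(* If [a u w b] vanishes, [1 - u w] may be inserted between [a] and [b], and its rank factorisation
   shortens the decomposition. *)
have reduce (u : 'cV_r) (w : 'rV_r) : w *m u = 1%:M ->
    (forall g h, a g *m u *m (w *m b h) = 0) -> False.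
  move=> /mx_split_lt[r' [C [D [r'r uw]]]] h.
  suff : (r <= r')%N by rewrite leqNgt r'r.
  apply: minr; apply/asboolP; exists (fun g => a g *m C), (fun g => D *m b g); split.
  - by apply: polymx_mul => //; apply: polymx_cst.
  - by apply: polymx_mul => //; apply: polymx_cst.
  - move=> g h'; rewrite E mulmxA -[X in _ = X *m _]mulmxA -uw mulmxBr mulmx1 mulmxBl.
    by rewrite -[X in _ - X]mulmxA -!mulmxA mulmxA h subr0.
have inda (u : 'cV_r) : (forall g, a g *m u = 0) -> u = 0.
  move=> h; apply/eqP; apply: contrapT => /negP /row_dual[w wu].
  by apply: (reduce _ _ wu) => g h'; rewrite h mul0mx.
have [|m [j [D QD]]] := @row_free_columns K (G * 'I_s) r (fun x => col x.2 (b x.1)).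
  move=> w hw; apply: trmx_inj; rewrite trmx0; apply/eqP; apply: contrapT => /negP w0.
  have [v vw] := row_dual w0; apply: (@reduce v^T w).
    by rewrite -[w]trmxK -trmx_mul vw tr_scalar_mx.
  move=> g h; suff -> : w *m b h = 0 by rewrite mulmx0.
  apply/rowP => i; have := hw (h, i); rewrite /= colE mulmxA -colE.
  by move=> /colP/(_ 0); rewrite !mxE.
pose Q h := \matrix_(i, l) b (h * (j l).1)%g i (j l).2.
have aQ g h : a (g * h)%g = a g *m (Q h *m D).
  rewrite -[LHS]mulmx1 -QD !mulmxA; congr (_ *m _); apply/rowP => l.
  have := congr1 (fun A : 'rV_s => A 0 (j l).2) (E (g * h)%g (j l).1).
  rewrite -mulgA E !mxE => h'.
  rewrite (eq_bigr (fun k => a (g * h)%g 0 k * b (j l).1 k (j l).2)) => [|k _].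
    by rewrite -h'; apply: eq_bigr => k _; rewrite !mxE.
  by rewrite !mxE.
exists r, a, (fun h => Q h *m D), (b 1%g); split=> //.
- apply: polymx_mul; last exact: polymx_cst.
  move=> i l; apply: polyf_ext (polyf_rtrans (j l).1 (hb i (j l).2)) => h.
  by rewrite mxE.
- by move=> g; rewrite -E mulg1.
- have inj m' (A B : 'M_(r, m')) : (forall g, a g *m A = a g *m B) -> A = B.
    move=> h; apply/eqP; rewrite -subr_eq0; apply/eqP/matrixP => i k.
    have := inda (col k (A - B)); move=> /(_ _)/colP/(_ i); rewrite !mxE => -> //.
    by move=> g; rewrite colE mulmxA mulmxBr h subrr mul0mx.
  split=> //.
    by apply: inj => g; rewrite -aQ mulg1 mulmx1.
  by move=> g h; apply: inj => x; rewrite -aQ mulgA !aQ !mulmxA.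
Qed.

End LocalFiniteness.

Lemma polyf_split (K : fieldType) (T U : Type) M N (c : T -> 'rV[K]_M) (d : U -> 'rV[K]_N) f :
  polyf (fun xy : T * U => row_mx (c xy.1) (d xy.2)) f ->
  exists r (a : 'I_r -> T -> K) (b : 'I_r -> U -> K),
  [/\ forall k, polyf c (a k), forall k, polyf d (b k) &
    forall x y, f (x, y) = \sum_k a k x * b k y].
Proof.
move=> [p hp]; suff [r [a [b [ha hb H]]]] : exists r (a : 'I_r -> T -> K) (b : 'I_r -> U -> K),
    [/\ forall k, polyf c (a k), forall k, polyf d (b k) &
    forall g h, p.@[row_mx (c g) (d h) 0] = \sum_k a k g * b k h].
  by exists r, a, b; split=> // g h; rewrite hp H.
move: p {f hp}; elim/mpoly_alg_ind => [x|i|p q [r [a [b [ha hb H]]]] [r' [a' [b' [ha' hb' H']]]]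
  |p q [r [a [b [ha hb H]]]] [r' [a' [b' [ha' hb' H']]]]].
- exists 1%N, (fun _ _ => x), (fun _ _ => 1); split=> *; try exact: polyf_cst.
  by rewrite mevalC big_ord1 mulr1.
- exists 1%N, (fun _ g => if split i is inl j then c g 0 j else 1),
    (fun _ h => if split i is inr j then d h 0 j else 1).
  split=> [_|_|g h].
  + by case: split => j; [apply: polyf_coord|apply: polyf_cst].
  + by case: split => j; [apply: polyf_cst|apply: polyf_coord].
  + by rewrite mevalXU big_ord1 mxE; case: split => j; rewrite ?mulr1 ?mul1r.
- exists (r + r')%N,
    (fun k g => match split k with inl j => a j g | inr j => a' j g end),
    (fun k g => match split k with inl j => b j g | inr j => b' j g end).
  split=> [k|k|g h]; try by case: split.
  rewrite mevalD H H' big_split_ord /=; congr (_ + _); apply: eq_bigr => k _.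
    by rewrite (unsplitK (inl k : 'I_r + 'I_r')).
  by rewrite (unsplitK (inr k : 'I_r + 'I_r')).
- exists #|{: 'I_r * 'I_r'}|, (fun k g => a (enum_val k).1 g * a' (enum_val k).2 g),
    (fun k g => b (enum_val k).1 g * b' (enum_val k).2 g).
  split=> [k|k|g h]; try exact: polyfM.
  rewrite mevalM H H' mulr_suml.
  rewrite -(big_enum_val (A := {: 'I_r * 'I_r'}) (fun k : 'I_r * 'I_r' =>
    (a k.1 g * a' k.2 g) * (b k.1 h * b' k.2 h))) /=.
  rewrite -(pair_big_dep (fun _ => true) (fun _ _ => true) (fun i j =>
    (a i g * a' j g) * (b i h * b' j h))) /=.
  by apply: eq_bigr => i _; rewrite mulr_sumr; apply: eq_bigr => j _; rewrite mulrACA.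
Qed.

Lemma mul_split_of (K : fieldType) (G : groupType) N (c : G -> 'rV[K]_N) :
  (forall i, polyf (fun xy : G * G => row_mx (c xy.1) (c xy.2)) (fun xy => c (xy.1 * xy.2)%g 0 i)) ->
  forall f, polyf c f ->
  exists r (a b : 'I_r -> G -> K), [/\ forall k, polyf c (a k), forall k, polyf c (b k) &
    forall g h, f (g * h)%g = \sum_k a k g * b k h].
Proof.
move=> hc f hf.
have [|r [a [b [ha hb E]]]] := @polyf_split _ _ _ _ _ c c (fun xy : G * G => f (xy.1 * xy.2)%g).
  by apply: polyf_precomp hf => i j; rewrite ord1; apply: hc.
by exists r, a, b; split=> // g h; rewrite -(E g h).
Qed.

(** Translations on a finite-dimensional space of functions from which the coordinates are obtained.
    Since [aag_coord g] is read off linearly from the matrix of [g], the representation is faithful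
    and closedness passes from the coordinates to the matrices. *)
Lemma aag_faithful_rep (K : fieldType) (G : affineAlgGroup K) :
  exists n (V : G -> 'M[K]_n.+1),
  [/\ [/\ V 1%g = 1, (forall g h, V (g * h)%g = V g * V h) & injective V],
      polymx (@aag_coord K G) V,
      polymx (fun g => mxvec (V g)) (@aag_coord K G) &
      forall A, (forall p, (forall g, p.@[mxvec (V g) 0] = 0) -> p.@[mxvec A 0] = 0) ->
        exists g, V g = A].
Proof.
(* The constant coordinate 1 forces a positive dimension, as the type of [V] demands. *)
pose c : G -> 'rV[K]_(1 + aag_dim G) := fun g => row_mx 1%:M (aag_coord g).
have hmul : forall i, polyf (fun xy : G * G => row_mx (aag_coord xy.1) (aag_coord xy.2))
   (fun xy => aag_coord (xy.1 * xy.2)%g 0 i).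
  by have [P hP] := @aag_mul_regular K G => i; exists (P i) => x; apply: hP.
have pc : polymx (@aag_coord K G) c.
  move=> i j; rewrite /c; case: (split_ordP j) => k ->.
    by apply: polyf_ext (polyf_cst _ (1%:M i k)) => g; rewrite row_mxEl.
  by apply: polyf_ext (polyf_coord _ k) => g; rewrite row_mxEr ord1.
have [r [a [W [B [pa pW inda ca [aW W1 WM]]]]]] := local_finite (mul_split_of hmul) pc.
case: r a W B pa pW inda ca aW W1 WM => [|n] a W B pa pW inda ca aW W1 WM.
  have := ca 1%g; rewrite [a 1%g]thinmx0 mul0mx => /rowP/(_ (lshift _ 0))/eqP.
  by rewrite row_mxEl !mxE oner_eq0.
have cW g : aag_coord g = rsubmx (a 1%g *m W g *m B).
  by rewrite -aW mul1g -ca row_mxKr.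
have pcW : polymx (fun g => mxvec (W g)) (@aag_coord K G).
  move=> i j; apply: polyf_ext (_ : polyf _ (fun g => (a 1%g *m W g *m B) i (rshift 1 j))).
    by move=> g; rewrite cW [RHS]mxE.
  apply: polymx_mul; last exact: polymx_cst.
  apply: polymx_mul; first exact: polymx_cst.
  exact: polymx_coord.
exists n, W; split=> //.
  split=> // g h Wgh; apply: aag_coord_inj; by rewrite !cW Wgh.
move=> A hA; pose x := rsubmx (a 1%g *m A *m B).
have [I hI] := @aag_coord_closed K G.
have [g _ gx] : range (@aag_coord K G) x.
  rewrite hI => p Ip.
  have [q hq] : polyf (fun M : 'M[K]_n.+1 => mxvec M)
      (fun M => p.@[rsubmx (a 1%g *m M *m B) 0]).
    apply: (polyf_pullback (d := fun M => rsubmx (a 1%g *m M *m B))) => i j.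
    apply: polyf_ext (_ : polyf _ (fun M => (a 1%g *m M *m B) i (rshift 1 j))).
      by move=> M; rewrite [RHS]mxE.
    apply: polymx_mul; last exact: polymx_cst.
    apply: polymx_mul; first exact: polymx_cst.
    exact: polymx_coord.
  rewrite [LHS](hq A); apply: hA => g; rewrite -hq -cW.
  have : range (@aag_coord K G) (aag_coord g) by exists g.
  by rewrite hI; apply.
exists g; apply/matrixP => i j.
have [w hw] := pW i j.
have [q hq] : polyf (fun M : 'M[K]_n.+1 => mxvec M)
    (fun M => M i j - w.@[rsubmx (a 1%g *m M *m B) 0]).
  apply: polyfB; first by apply: polyf_ext (polyf_coord _ (mxvec_index i j)) => M; rewrite mxvecE.
  apply: (polyf_pullback (d := fun M => rsubmx (a 1%g *m M *m B))) => k l.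
  apply: polyf_ext (_ : polyf _ (fun M => (a 1%g *m M *m B) k (rshift 1 l))).
    by move=> M; rewrite [RHS]mxE.
  apply: polymx_mul; last exact: polymx_cst.
  apply: polymx_mul; first exact: polymx_cst.
  exact: polymx_coord.
rewrite hw gx; apply/eqP; rewrite eq_sym -subr_eq0; apply/eqP.
by rewrite [LHS](hq A); apply: hA => h; rewrite -hq -cW hw subrr.
Qed.

(** * The Lie algebra *)

Lemma linear_subst (K : fieldType) n m (L : 'M[K]_(n, m)) (p : {mpoly K[m]}) :
  exists q : {mpoly K[n]}, (forall a : 'rV_n, q.@[a 0] = p.@[(a *m L) 0]) /\
    forall a y, ddir q a y = ddir p (a *m L) (y *m L).
Proof.
elim/mpoly_alg_ind: p => [c|i|p1 p2 [q1 [e1 d1]] [q2 [e2 d2]]|p1 p2 [q1 [e1 d1]] [q2 [e2 d2]]].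
- by exists c%:MP; split=> *; rewrite ?mevalC // !ddirC.
- exists (\sum_j L j i *: 'X_j); split=> [a|a y].
    rewrite raddf_sum /= mevalXU mxE; apply: eq_bigr => j _.
    by rewrite mevalZ mevalXU mulrC.
  rewrite ddir_sum ddirX mxE; apply: eq_bigr => j _.
  by rewrite ddirZ ddirX mulrC.
- by exists (q1 + q2); split=> *; rewrite ?mevalD ?e1 ?e2 // !ddirD d1 d2.
- by exists (q1 * q2); split=> *; rewrite ?mevalM ?e1 ?e2 // !ddirM d1 d2 e1 e2.
Qed.

Lemma zariski_closed_trans (K : fieldType) (T : Type) N n (c : T -> 'rV[K]_N)
    (d : T -> 'rV[K]_n) S : polymx c d -> zariski_closed d S -> zariski_closed c S.
Proof.
move=> hd [I ->]; exists [set q | exists2 p, I p & forall x, p.@[d x 0] = q.@[c x 0]].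
apply/seteqP; split=> x /= hx.
  by move=> q [p Ip <-]; apply: hx.
move=> p Ip; have [q hq] := polyf_pullback p hd.
by rewrite hq; apply: hx; exists p.
Qed.

Lemma zariski_closed_sep (K : fieldType) (T : Type) N (c : T -> 'rV[K]_N) (S : set T) :
  (forall x, ~ S x -> exists f, [/\ polyf c f, forall y, S y -> f y = 0 & f x <> 0]) ->
  zariski_closed c S.
Proof.
move=> h; exists [set p | forall y, S y -> p.@[c y 0] = 0].
apply/seteqP; split=> [x Sx p|x hx]; first by apply.
apply: contrapT => /h[f [[p hp] fS]]; apply; rewrite hp; apply: hx => y Sy.
by rewrite -hp fS.
Qed.

(** [lg_closed] asks for closedness among all matrices, not only among the invertible ones;
    accordingly the inverse is polynomial in the entries. *)
Record linear_group (K : fieldType) (G : groupType) n (V : G -> 'M[K]_n.+1) : Prop :=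
  LinearGroup {
    lg1 : V 1%g = 1;
    lgM : forall g h, V (g * h)%g = V g * V h;
    lg_inj : injective V;
    lg_closed : forall A, (forall p, (forall g, p.@[mxvec (V g) 0] = 0) ->
      p.@[mxvec A 0] = 0) -> exists g, V g = A;
    lg_inv : polymx (fun g => mxvec (V g)) (fun g => V g^-1%g)
  }.

Record rational_rep (K : fieldType) (G : groupType) n (V : G -> 'M[K]_n.+1)
    m (W : G -> 'M[K]_m) : Prop := RationalRep {
  rr_poly : polymx (fun g => mxvec (V g)) W;
  rr1 : W 1%g = 1%:M;
  rrM : forall g h, W (g * h)%g = W g *m W h
}.

Section LieAlgebra.
Variables (K : numFieldType) (G : groupType) (n : nat) (V : G -> 'M[K]_n.+1).
Hypothesis hV : linear_group V.
Notation ev p A := (p.@[mxvec A 0]).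
Notation P := {mpoly K[(n.+1 * n.+1)]}.
Implicit Types (p q : P) (X Y : 'M[K]_n.+1) (f : G -> K).

Definition reg f := polyf (fun g => mxvec (V g)) f.

Lemma lgV g : V g^-1%g = (V g)^-1.
Proof.
have gV : V g * V g^-1%g = 1 by rewrite -(lgM hV) mulgV (lg1 hV).
have Vg : V g^-1%g * V g = 1 by rewrite -(lgM hV) mulVg (lg1 hV).
have u : V g \is a GRing.unit by apply/unitrP; exists (V g^-1%g).
by rewrite -[RHS]mulr1 -gV mulKr.
Qed.

Lemma lg_unit g : V g \is a GRing.unit.
Proof.
by apply/unitrP; exists (V g^-1%g); rewrite -!(lgM hV) mulgV mulVg (lg1 hV).
Qed.

Definition IG : set P := [set p | forall g, ev p (V g) = 0].

Lemma IG_ideal : is_ideal IG.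
Proof.
split=> [g|p q hp hq g|a p hp g]; first by rewrite meval0.
- by rewrite mevalD hp hq addr0.
- by rewrite mevalM hp mulr0.
Qed.

Lemma matrix_subst (A B : 'M[K]_n.+1) p : exists q, (forall M, ev q M = ev p (A * M * B)) /\
  forall M Y, ddir q (mxvec M) (mxvec Y) = ddir p (mxvec (A * M * B)) (mxvec (A * Y * B)).
Proof.
pose L := lin_mx (mulmxr B \o mulmx A).
have LE M : mxvec M *m L = mxvec (A * M * B) by rewrite mul_vec_lin.
have [q [e d]] := linear_subst L p.
by exists q; split=> *; rewrite ?e ?d !LE.
Qed.

Definition gen_mx : 'M[P]_n.+1 := \matrix_(i, j) 'X_(mxvec_index i j).
Definition lvec X : 'rV[P]_(n.+1 * n.+1) := mxvec (gen_mx *m map_mx (@mpolyC (n.+1 * n.+1) K) X).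
(** The left-invariant field of [X]: at the matrix [A] it points along [A X]. *)
Definition lder X p : P := vfield (lvec X) p.

Lemma lder_eval X p A : ev (lder X p) A = ddir p (mxvec A) (mxvec (A * X)).
Proof.
rewrite vfield_eval; congr ddir; apply/rowP => k; case/mxvec_indexP: k => i j.
rewrite mxE !mxvecE !mxE rmorph_sum; apply: eq_bigr => l _.
by rewrite /= mevalM !mxE mevalXU mevalC mxvecE.
Qed.

Definition lie : set 'M[K]_n.+1 :=
  [set X | forall p, IG p -> ddir p (mxvec 1) (mxvec X) = 0].

Lemma lie_linear : linear_set lie.
Proof.
split=> [p _|X Y hX hY p Ip|c X hX p Ip].
- by rewrite linear0 ddir0.
- by rewrite linearD ddirDr hX ?hY ?addr0.
- by rewrite linearZ ddirZr hX ?mulr0.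
Qed.

(** Left translation by [g] preserves the ideal of the group and carries the field at 1 to the field
    at [V g]. *)
Lemma lie_der X : lie X -> forall p, IG p -> IG (lder X p).
Proof.
move=> hX p Ip g; have [q [e d]] := matrix_subst (V g) 1 p.
rewrite lder_eval -[in mxvec (V g)](mulr1 (V g)) -[V g * 1]mulr1 -(mulr1 (V g * X)) -d.
by apply: hX => h; rewrite e mulr1 -(lgM hV).
Qed.

Lemma lder_vfield (y : 'rV[K]_(n.+1 * n.+1)) :
  lvec (vec_mx y) = \sum_i (y 0 i)%:MP *: lvec (vec_mx (delta_mx 0 i)).
Proof.
have h : linear (fun M : 'M[P]_n.+1 => mxvec (gen_mx *m M)).
  by move=> c A B; rewrite mulmxDr -scalemxAr linearP.
rewrite /lvec; have -> : map_mx (@mpolyC (n.+1 * n.+1) K) (vec_mx y) =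
    \sum_i (y 0 i)%:MP *: map_mx (@mpolyC (n.+1 * n.+1) K) (vec_mx (delta_mx 0 i)).
  apply/matrixP => a b; rewrite summxE (bigD1 (mxvec_index a b)) //= big1.
    by rewrite !mxE !eqxx addr0 mpolyC1 mulr1.
  by move=> i iab; rewrite !mxE eqxx eq_sym (negbTE iab) mpolyC0 mulr0.
rewrite mulmx_sumr linear_sum; apply: eq_bigr => i _.
by rewrite -scalemxAr linearZ.
Qed.

(** The ideal is left general because two are used: the ideal of the group, and the one cutting out
    the stabilizer of [b0]. *)
Lemma lie_annihilated_locally (I : set P) p : is_ideal I -> (forall q, I q -> ev q 1 = 0) ->
  (forall X, (forall q, I q -> ddir q (mxvec 1) (mxvec X) = 0) ->
     forall q, I q -> I (lder X q)) ->
  ev p 1 = 0 ->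
  (forall X, (forall q, I q -> ddir q (mxvec 1) (mxvec X) = 0) -> I (lder X p)) ->
  exists2 s, ev s 1 = 1 & I (s * p).
Proof.
move=> iI I1 hI p1 hp.
apply: (@annihilated_locally K _ (mxvec 1) (fun y => lvec (vec_mx y)) _ _ I) => //.
- exact: lder_vfield.
- move=> y i; case/mxvec_indexP: i => i j.
  rewrite mxvecE mxE raddf_sum (bigD1 i) //= big1 => [|k ki]; rewrite !mxE mevalM mevalXU mxvecE mevalC mxE.
    by rewrite eqxx mul1r addr0.
  by rewrite eq_sym (negbTE ki) mul0r.
- move=> y ty q Iq; apply: (hI (vec_mx y)) => // r Ir; rewrite vec_mxK; exact: ty.
- move=> y ty; apply: (hp (vec_mx y)) => r Ir; rewrite vec_mxK; exact: ty.
Qed.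

(** An arbitrary polynomial expression of [f]; for [X] in [lie] the derivative computed from it does
    not depend on the choice ([der1E]). *)
Definition repoly f : P := xget 0 [set p | forall g, f g = ev p (V g)].

Lemma repolyE f : reg f -> forall g, f g = ev (repoly f) (V g).
Proof. by move=> [p hp]; apply: (xgetI 0 (hp : [set p | forall g, f g = ev p (V g)] p)). Qed.

Definition der1 X f : K := ddir (repoly f) (mxvec 1) (mxvec X).

Lemma der1E X f p : lie X -> (forall g, f g = ev p (V g)) ->
  der1 X f = ddir p (mxvec 1) (mxvec X).
Proof.
move=> hX hp; apply/eqP; rewrite -subr_eq0 -ddirB; apply/eqP; apply: hX => g.
by rewrite mevalB -hp -repolyE ?subrr //; exists p.
Qed.

Section Der1.
Variable X : 'M[K]_n.+1.
Hypothesis hX : lie X.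

Lemma der1_ext f h : f =1 h -> der1 X f = der1 X h.
Proof. by move=> /funext ->. Qed.

Lemma der1_cst c : der1 X (fun=> c) = 0.
Proof. by rewrite (der1E (p := c%:MP)) ?ddirC // => g; rewrite mevalC. Qed.

Lemma der1D f h : reg f -> reg h -> der1 X (fun g => f g + h g) = der1 X f + der1 X h.
Proof.
move=> [p hp] [q hq]; rewrite (der1E (p := p + q)) => [|//|g]; last by rewrite mevalD -hp -hq.
by rewrite ddirD (der1E hX hp) (der1E hX hq).
Qed.

Lemma der1M f h : reg f -> reg h ->
  der1 X (fun g => f g * h g) = der1 X f * h 1%g + f 1%g * der1 X h.
Proof.
move=> [p hp] [q hq]; rewrite (der1E (p := p * q)) => [|//|g]; last by rewrite mevalM -hp -hq.
by rewrite ddirM (der1E hX hp) (der1E hX hq) hp hq (lg1 hV).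
Qed.

Lemma der1Z c f : reg f -> der1 X (fun g => c * f g) = c * der1 X f.
Proof.
by move=> rf; rewrite der1M //; [rewrite der1_cst mul0r add0r|apply: polyf_cst].
Qed.

Lemma der1_sum (J : Type) (r : seq J) (F : J -> G -> K) : (forall j, reg (F j)) ->
  der1 X (fun g => \sum_(j <- r) F j g) = \sum_(j <- r) der1 X (F j).
Proof.
move=> hF; elim: r => [|j r IH].
  rewrite big_nil (der1_ext (h := fun=> 0)) ?der1_cst // => g.
  by rewrite big_nil.
rewrite big_cons -IH -der1D //; last exact: polyf_sum.
by apply: der1_ext => g; rewrite big_cons.
Qed.

Lemma der1V i j : der1 X (fun g => V g i j) = X i j.
Proof.
rewrite (der1E (p := 'X_(mxvec_index i j))) => [|//|g]; last by rewrite mevalXU mxvecE.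
by rewrite ddirX mxvecE.
Qed.

Definition dmx m r (W : G -> 'M[K]_(m, r)) := \matrix_(i, j) der1 X (fun g => W g i j).

Lemma dmx_mul m r s t (A : 'M_(m, r)) (W : G -> 'M_(r, s)) (B : 'M_(s, t)) :
  polymx (fun g => mxvec (V g)) W -> dmx (fun g => A *m W g *m B) = A *m dmx W *m B.
Proof.
move=> hW; apply/matrixP => i j; rewrite !mxE.
rewrite (der1_ext (h := fun g => \sum_k \sum_l A i l * B k j * W g l k)) => [|g].
  rewrite der1_sum => [|k]; last by apply: polyf_sum => l; apply: polyfZ; apply: hW.
  apply: eq_bigr => k _; rewrite der1_sum => [|l]; last by apply: polyfZ; apply: hW.
  rewrite mxE mulr_suml; apply: eq_bigr => l _; rewrite der1Z ?mxE; last exact: hW.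
  by rewrite mulrAC.
rewrite !mxE; apply: eq_bigr => k _; rewrite mxE mulr_suml.
by apply: eq_bigr => l _; rewrite mulrAC.
Qed.

Lemma dmxM m r s (A : G -> 'M_(m, r)) (B : G -> 'M_(r, s)) :
  polymx (fun g => mxvec (V g)) A -> polymx (fun g => mxvec (V g)) B ->
  dmx (fun g => A g *m B g) = dmx A *m B 1%g + A 1%g *m dmx B.
Proof.
move=> hA hB; apply/matrixP => i j; rewrite !mxE.
rewrite (der1_ext (h := fun g => \sum_k A g i k * B g k j)) => [|g]; last by rewrite mxE.
rewrite der1_sum => [|k]; last by apply: polyfM; [apply: hA|apply: hB].
rewrite -big_split; apply: eq_bigr => k _ /=; rewrite der1M ?mxE //; [exact: hA|exact: hB].
Qed.

Lemma dmx_cst m r (A : 'M[K]_(m, r)) : dmx (fun=> A) = 0.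
Proof. by apply/matrixP => i j; rewrite !mxE der1_cst. Qed.

Lemma dmx_mem m r (A : G -> 'M[K]_(m, r)) (U : {vspace 'M[K]_(m, r)}) :
  polymx (fun g => mxvec (V g)) A -> (forall g, A g \in U) -> dmx A \in U.
Proof.
move=> hA AU; pose L := lin_mx (projv U).
have LE M : (mxvec M *m (1%:M - L) == 0) = (M \in U).
  rewrite mulmxBr mulmx1 mul_vec_lin -linearB /= mxvec_eq0.
  by rewrite subr_eq0; apply/eqP/idP => [->|/projv_id ->//]; exact: memv_proj.
rewrite -LE; apply/eqP.
have <- : dmx (fun g => mxvec (A g)) = mxvec (dmx A).
  apply/rowP => k; case/mxvec_indexP: k => i j; rewrite mxvecE !mxE.
  by apply: der1_ext => g; rewrite mxvecE.
rewrite -[X in X *m _]mul1mx -dmx_mul; last by apply/polymx_mxvec.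
rewrite -[RHS](dmx_cst 0); congr dmx; apply: funext => g.
by rewrite mul1mx; apply/eqP; rewrite LE.
Qed.

End Der1.

Lemma der1Zr c X f : der1 (c *: X) f = c * der1 X f.
Proof. by rewrite /der1 linearZ ddirZr. Qed.

Lemma dmxDr X Y m r (W : G -> 'M[K]_(m, r)) : dmx (X + Y) W = dmx X W + dmx Y W.
Proof. by apply/matrixP => i j; rewrite !mxE /der1 linearD ddirDr. Qed.

Lemma dmxZr c X m r (W : G -> 'M[K]_(m, r)) : dmx (c *: X) W = c *: dmx X W.
Proof. by apply/matrixP => i j; rewrite !mxE der1Zr. Qed.

Lemma dmxV X : lie X -> dmx X V = X.
Proof. by move=> hX; apply/matrixP => i j; rewrite mxE der1V. Qed.

Lemma reg_mulx h f : reg f -> reg (fun g => f (h * g)%g).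
Proof.
move=> [p hp]; have [q [e _]] := matrix_subst (V h) 1 p.
by exists q => g; rewrite hp e mulr1 (lgM hV).
Qed.

Lemma reg_mulxr h f : reg f -> reg (fun g => f (g * h)%g).
Proof.
move=> [p hp]; have [q [e _]] := matrix_subst 1 (V h) p.
by exists q => g; rewrite hp e mul1r (lgM hV).
Qed.

Definition dleft X f : G -> K := fun g => der1 X (fun h => f (g * h)%g).

Lemma dleftE X f p : lie X -> (forall g, f g = ev p (V g)) ->
  forall g, dleft X f g = ev (lder X p) (V g).
Proof.
move=> hX hp g; have [q [e d]] := matrix_subst (V g) 1 p.
rewrite /dleft (der1E (p := q)) => [|//|h]; last by rewrite hp e mulr1 (lgM hV).
by rewrite d lder_eval !mulr1.
Qed.

Lemma dleft_reg X f : lie X -> reg f -> reg (dleft X f).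
Proof. by move=> hX [p hp]; exists (lder X p); apply: dleftE. Qed.

Lemma lie_conj X g : lie X -> lie (V g * X * (V g)^-1).
Proof.
move=> hX p Ip; have [q [e d]] := matrix_subst (V g) (V g)^-1 p.
have := d 1 X; rewrite mulr1 divrr ?lg_unit // => <-.
by apply: hX => h; rewrite e -lgV -!(lgM hV).
Qed.

Lemma der1_conj X g f : lie X -> reg f ->
  der1 (V g * X * (V g)^-1) f = der1 X (fun h => f (g * h * g^-1)%g).
Proof.
move=> hX [p hp]; have [q [e d]] := matrix_subst (V g) (V g)^-1 p.
rewrite (der1E (lie_conj g hX) hp) (der1E (p := q)) => [|//|h]; last first.
  by rewrite hp e -lgV -!(lgM hV).
by rewrite d mulr1 divrr ?lg_unit.
Qed.

Section Rep.
Variables (m : nat) (W : G -> 'M[K]_m).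
Hypothesis hW : rational_rep V W.

Lemma dmx_left X r s (A : 'M_(r, m)) (B : 'M_(m, s)) i j g : lie X ->
  dleft X (fun h => (A *m W h *m B) i j) g = (A *m W g *m dmx X W *m B) i j.
Proof.
move=> hX; rewrite -dmx_mul //; last exact: (rr_poly hW).
by rewrite mxE; apply: der1_ext => h; rewrite (rrM hW) !mulmxA.
Qed.

Lemma dmx_conj X g : lie X -> dmx (V g * X * (V g)^-1) W = W g *m dmx X W *m W g^-1%g.
Proof.
move=> hX; rewrite -dmx_mul //; last exact: (rr_poly hW).
apply/matrixP => i j; rewrite !mxE der1_conj //; last exact: (rr_poly hW).
by apply: der1_ext => h; rewrite !(rrM hW).
Qed.

Lemma rrV g : W g *m W g^-1%g = 1%:M.
Proof. by rewrite -(rrM hW) mulgV (rr1 hW). Qed.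

Lemma rrVl g : W g^-1%g *m W g = 1%:M.
Proof. by rewrite -(rrM hW) mulVg (rr1 hW). Qed.

Lemma dmx_comm X (e : 'M_m) : lie X -> (forall g, e *m W g = W g *m e) ->
  e *m dmx X W = dmx X W *m e.
Proof.
move=> hX he; have := dmx_mul hX e 1%:M (rr_poly hW).
have := dmx_mul hX 1%:M e (rr_poly hW).
rewrite mul1mx mulmx1 => <- <-; congr dmx; apply: funext => g.
by rewrite mulmx1 mul1mx he.
Qed.

End Rep.

Hypothesis hconn : zariski_connected (fun g => mxvec (V g)) setT.

(** Local annihilation, applied to [f (g * h) - f g] as a function of [h], makes [f] constant near
    every [g]. The level set of [f 1%g] and its complement are thus both closed. *)
Lemma der_eq0_const f : reg f -> (forall X, lie X -> dleft X f =1 fun=> 0) ->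
  forall g, f g = f 1%g.
Proof.
move=> rf hf.
have loc g : exists s, [/\ reg s, s g = 1 & forall h, s h * (f h - f g) = 0].
  have [p hp] : reg (fun h => f (g * h)%g - f g).
    by apply: polyfB; [exact: reg_mulx|exact: polyf_cst].
  have [||X hX q Iq|||s s1 Is] := @lie_annihilated_locally IG p.
  - exact: IG_ideal.
  - by move=> q Iq; rewrite -(lg1 hV); apply: Iq.
  - exact: lie_der.
  - by rewrite -(lg1 hV) -hp mulg1 subrr.
  - move=> X hX h; rewrite -(dleftE hX hp).
    rewrite /dleft der1D //; first 1 last.
    + apply: (@reg_mulx h (fun y => f (g * y)%g)); exact: reg_mulx.
    + exact: polyf_cst.
    rewrite der1_cst // addr0 -[RHS](hf X hX (g * h)%g) /dleft.
    by apply: der1_ext => x; rewrite mulgA.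
  exists (fun h => ev s (V (g^-1 * h)%g)); split.
  - by apply: (@reg_mulx _ (fun h => ev s (V h))); exists s.
  - by rewrite mulVg (lg1 hV).
  - by move=> h; have := Is (g^-1 * h)%g; rewrite mevalM -hp mulgA mulgV mul1g.
move=> g; apply: contrapT => fg; apply: hconn.
exists [set h | f h = f 1%g], [set h | f h <> f 1%g]; split.
- split; apply: zariski_closed_sep => x /= hx.
    exists (fun h => f h - f 1%g); split.
    + by apply: polyfB => //; apply: polyf_cst.
    + by move=> y ->; rewrite subrr.
    + by move=> /eqP; rewrite subr_eq0 => /eqP.
  have {hx}fx : f x = f 1%g by apply: contrapT.
  have [s [rs sx hs]] := loc x; exists s; split=> //; last first.
    by rewrite sx => /eqP; rewrite oner_eq0.
  move=> y fy; have /eqP := hs y; rewrite mulf_eq0 subr_eq0 fx => /orP[/eqP//|/eqP //].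
- by move=> x _; have [] := pselect (f x = f 1%g); [left|right].
- by exists 1%g; split.
- by exists g; split.
- by apply/seteqP; split=> // x [[_ h] /(_ h)].
Qed.

End LieAlgebra.

(** * Engel's theorem *)

Section Engel.
Variables (K : fieldType) (A : falgType K).
Implicit Types (L S T : {vspace A}) (x y : A).

Definition lie_closed L := forall x y, x \in L -> y \in L -> x * y - y * x \in L.

Section Extension.
Variables (S : {vspace A}) (y : A) (N m : nat).
Hypotheses (SN : (S ^+ N)%VS = 0%VS) (ym : y ^+ m = 0).
Hypothesis Sy : forall s, s \in S -> s * y - y * s \in S.

Let T := (S + <[y]>)%VS.
Let E := agenv T.

Let SE : (S <= S * E)%VS.
Proof. by rewrite -[X in (X <= _)%VS]prodv1 prodvSr // sub1_agenv. Qed.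

Let TS : (T * S <= S * E)%VS.
Proof.
rewrite prodvDl subv_add; apply/andP; split.
  by apply: prodvSr; apply: subv_trans (sub_agenv T); apply: addvSl.
apply/prodvP => _ s /vlineP[k ->] sS; rewrite -scalerAl; apply: rpredZ.
have -> : y * s = s * y - (s * y - y * s) by rewrite opprB addrC subrK.
apply: rpredB; last exact: (subvP SE) (Sy sS).
by apply: memv_mul => //; apply: (subvP (sub_agenv T)); rewrite memvE addvSr.
Qed.

Let TSE : (T * (S * E) <= S * E)%VS.
Proof.
by rewrite prodvA; apply: subv_trans (prodvSl _ TS) _; rewrite -prodvA agenvM.
Qed.

Let ES : (E * S <= S * E)%VS.
Proof. exact: subv_trans (prodvSr _ SE) (agenv_modl TSE). Qed.

Let ESk k : (E * S ^+ k <= S ^+ k * E)%VS.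
Proof.
elim: k => [|k IH]; first by rewrite expv0 prodv1 prod1v.
rewrite expvSl prodvA; apply: subv_trans (prodvSl _ ES) _.
by rewrite -!prodvA prodvSr.
Qed.

Let SEk k : ((S * E) ^+ k <= S ^+ k * E)%VS.
Proof.
elim: k => [|k IH]; first by rewrite !expv0 prod1v sub1_agenv.
rewrite !expvSl; apply: subv_trans (prodvSr _ IH) _.
rewrite prodvA -[X in (X * _ <= _)%VS]prodvA.
apply: subv_trans (prodvSl _ (prodvSr _ (ESk k))) _.
by rewrite -!prodvA agenvM.
Qed.

Let Tk k : (T ^+ k <= <[y ^+ k]> + S * E)%VS.
Proof.
elim: k => [|k IH]; first by rewrite expv0 expr0 addvSl.
rewrite expvSl; apply: subv_trans (prodvSr _ IH) _.
rewrite prodvDr subv_add; apply/andP; split; last first.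
  exact: subv_trans TSE (addvSr _ _).
rewrite prodvDl subv_add; apply/andP; split.
  apply: subv_trans (addvSr _ _); apply: prodvSr; rewrite -memvE.
  apply: (subvP (subX_agenv T k)); rewrite memvE -expv_line.
  by apply: expvS; apply: addvSr.
by rewrite prodv_line -exprS addvSl.
Qed.

(** Commuting [y] past [S] moves all factors from [S] to the left, so [(S E)^k] lies in [S^k E]. A
    product of [m] factors from [T] lies in [<y^m> + S E], and [y^m = 0]. *)
Lemma engel_extend : (T ^+ (m * N))%VS = 0%VS.
Proof.
apply/eqP; rewrite -subv0 expvM.
have h : (T ^+ m <= S * E)%VS by have := Tk m; rewrite ym add0v.
apply: subv_trans (expvS _ h) _.
by apply: subv_trans (SEk N) _; rewrite SN prod0v.
Qed.

End Extension.

(** [S] has largest dimension among the Lie subalgebras of [L] with a vanishing associative power.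
    If it were proper, an element of [L] outside [S] would normalise it and [engel_extend] would
    enlarge it. *)
Theorem engel L : lie_closed L -> (forall x, x \in L -> exists m, x ^+ m = 0) ->
  exists N, (L ^+ N)%VS = 0%VS.
Proof.
move=> Ll Lnil.
pose P d := exists S : {vspace A}, [/\ (S <= L)%VS, lie_closed S,
  exists N, (S ^+ N)%VS = 0%VS & \dim S = d].
have exP : exists d, `[< P d >].
  exists 0%N; apply/asboolP; exists 0%VS; rewrite dimv0 sub0v; split=> //.
    by move=> x y; rewrite !memv0 => /eqP -> _; rewrite mul0r mulr0 subr0.
  by exists 1%N; rewrite expv1.
have ubP d : `[< P d >] -> (d <= \dim L)%N by move=> /asboolP[S [SL _ _ <-]]; exact: dimvS.
case: (ex_maxnP exP ubP) => d /asboolP[S [SL Sl [N SN] dS]] maxd.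
have [LS|] := boolP (L <= S)%VS.
  by exists N; have -> : L = S by apply/eqP; rewrite eqEsubv LS.
case/subvPn => x xL xS; exfalso.
(* Otherwise iterated commutators with [S], starting from [x], never enter [S]. After [N + N] of
   them every term has at least [N] factors from [S] on one side of [x], so the result is 0, a
   member of [S]. *)
have [y [yL yS Sy]] : exists y, [/\ y \in L, y \notin S &
    forall s, s \in S -> s * y - y * s \in S].
  apply: contrapT => /forallNP h.
  have {}h y : y \in L -> y \notin S -> exists2 s, s \in S & s * y - y * s \notin S.
    move=> yL yS; apply: contrapT => h'; apply: (h y); split=> // s sS.
    by apply: contrapT => /negP sy; apply: h'; exists s.
  pose R a b := (S ^+ a * (<[x]> * S ^+ b))%VS.
  have main j : exists z, [/\ z \in L, z \notin S & z \in (\sum_(a < j.+1) R a (j - a)%N)%VS].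
    elim: j => [|j [z [zL zS zQ]]].
      exists x; split=> //; rewrite big_ord1 /R subn0 expv0 prod1v prodv1.
      exact: memv_line.
    have [s sS sz] := h z zL zS; exists (s * z - z * s); split=> //.
      by apply: Ll => //; apply: (subvP SL).
    have Q1 a b c : (a + b = c)%N -> (R a b <= \sum_(a < c.+1) R a (c - a)%N)%VS.
      move=> <-; have ac : (a < (a + b).+1)%N by rewrite ltnS leq_addr.
      by apply: subv_trans (sumv_sup (Ordinal ac) isT _); rewrite /= ?addKn //; apply: subvv.
    have SQ : (S * (\sum_(a < j.+1) R a (j - a)%N) <= \sum_(a < j.+2) R a (j.+1 - a)%N)%VS.
      rewrite big_distrr /=; apply/subv_sumP => a _.
      by rewrite /R prodvA -expvSl; apply: Q1; rewrite addSn subnKC // -ltnS.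
    have QS : ((\sum_(a < j.+1) R a (j - a)%N) * S <= \sum_(a < j.+2) R a (j.+1 - a)%N)%VS.
      rewrite big_distrl /=; apply/subv_sumP => a _.
      by rewrite /R -!prodvA -expvSr; apply: Q1; rewrite addnS subnKC // -ltnS.
    by apply: rpredB; [apply: (subvP SQ)|apply: (subvP QS)]; apply: memv_mul.
  have [z [_ zS zQ]] := main (N + N)%N; case/negP: zS.
  suff Q0 : (\sum_(a < (N + N).+1) R a (N + N - a)%N)%VS = 0%VS.
    by move: zQ; rewrite Q0 memv0 => /eqP ->; apply: mem0v.
  have Sk k : (N <= k)%N -> (S ^+ k)%VS = 0%VS.
    by move=> /subnK <-; rewrite addnC expvD SN prod0v.
  apply: big1 => a _; rewrite /R; have [Na|aN] := leqP N a; first by rewrite Sk ?prod0v.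
  by rewrite (Sk (N + N - a)%N) ?prodv0 // -addnBA ?leq_addr // ltnW.
have [m ym] := Lnil y yL.
suff : (\dim (S + <[y]>) <= d)%N.
  rewrite -dS leqNgt => /negP; apply.
  rewrite ltn_neqAle dimvS ?addvSl // andbT; apply: contra yS => /eqP dimE.
  have /eqP -> : (S == S + <[y]>)%VS by rewrite eqEdim addvSl dimE /=.
  by rewrite memvE addvSr.
apply: maxd; apply/asboolP; exists (S + <[y]>)%VS; split=> //.
- by rewrite subv_add SL -memvE.
- move=> u v /memv_addP[s sS [_ /vlineP[c ->] ->]] /memv_addP[t tS [_ /vlineP[e ->] ->]].
  apply: (subvP (addvSl _ _)).
  have brD (a b z : A) : (a + b) * z - z * (a + b) = (a * z - z * a) + (b * z - z * b).
    by rewrite mulrDl mulrDr opprD addrACA.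
  have brDr (a b z : A) : z * (a + b) - (a + b) * z = (z * a - a * z) + (z * b - b * z).
    by rewrite mulrDl mulrDr opprD addrACA.
  have yy : (c *: y) * (e *: y) - (e *: y) * (c *: y) = 0.
    by rewrite -!scalerAl -!scalerAr !scalerA mulrC subrr.
  rewrite brD !brDr yy addr0 -!scalerAl -!scalerAr -!scalerBr.
  apply: rpredD; first by apply: rpredD; [exact: Sl|apply: rpredZ; exact: Sy].
  by apply: rpredZ; rewrite -opprB rpredN; exact: Sy.
- by exists (m * N)%N; apply: engel_extend SN ym Sy.
Qed.

End Engel.

(** * Unipotent elements of the radical *)

Lemma aag_linear_group (K : fieldType) (G : affineAlgGroup K) :
  exists n (V : G -> 'M[K]_n.+1), [/\ linear_group V, polymx (@aag_coord K G) V &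
      polymx (fun g => mxvec (V g)) (@aag_coord K G)].
Proof.
have [n [V [[V1 VM Vinj] pV pc Vcl]]] := aag_faithful_rep G.
exists n, V; split=> //; split=> // i j.
apply: (polyf_trans pc); apply: (polyf_precomp _ (pV i j)) => x y.
have [P hP] := @aag_inv_regular K G.
by rewrite ord1; exists (P y) => g; apply: hP.
Qed.

Lemma poly_eq0_nat (K : numFieldType) (p : {poly K}) :
  (forall m : nat, p.[m%:R] = 0) -> p = 0.
Proof.
move=> h; apply: (@roots_geq_poly_eq0 K p [seq m%:R | m <- iota 0 (size p)]).
- by apply/allP => _ /mapP[m _ ->]; apply/rootP.
- rewrite map_inj_uniq ?iota_uniq // => a b /eqP.
  by rewrite eqr_nat => /eqP.
- by rewrite size_map size_iota.
Qed.

Lemma polyf_line (K : fieldType) (f : K -> K) : polyf (fun t => t%:M : 'rV_1) f ->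
  exists p : {poly K}, forall t, f t = p.[t].
Proof.
move=> [p hp]; suff [q hq] : exists q : {poly K}, forall t : K, p.@[(t%:M : 'rV_1) 0] = q.[t].
  by exists q => t; rewrite hp.
elim/mpoly_alg_ind: p {hp} => [c|i|p q [p' hp] [q' hq]|p q [p' hp] [q' hq]].
- by exists c%:P => t; rewrite mevalC hornerC.
- by exists 'X => t; rewrite mevalXU hornerX mxE ord1 eqxx.
- by exists (p' + q') => t; rewrite mevalD hp hq hornerD.
- by exists (p' * q') => t; rewrite mevalM hp hq hornerM.
Qed.

Lemma polyf_line_horner (K : fieldType) (p : {poly K}) :
  polyf (fun t => t%:M : 'rV_1) (fun t => p.[t]).
Proof.
elim/poly_ind: p => [|p c IH].
  by apply: polyf_ext (polyf_cst _ 0) => t; rewrite horner0.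
apply: polyf_ext (polyfD (polyfM IH (polyf_coord _ 0)) (polyf_cst _ c)) => t.
by rewrite hornerMXaddC mxE eqxx.
Qed.

(** * Polynomial curves through unipotent matrices *)

Section UnipotentCurve.
Variables (K : numFieldType) (n : nat) (j : 'M[K]_n.+1) (N : nat).
Hypothesis jN : j ^+ N = 0.

(** The binomial coefficient of [t] over [k], as a polynomial in [t]. *)
Definition binp k : {poly K} := (k`!%:R^-1) *: \prod_(i < k) ('X - (i%:R)%:P).

Lemma binp_nat k m : (binp k).[m%:R] = 'C(m, k)%:R.
Proof.
rewrite /binp hornerZ horner_prod.
have -> : \prod_(i < k) ('X - (i%:R)%:P).[m%:R] = (m ^_ k)%:R :> K.
  elim: k => [|k IH]; first by rewrite big_ord0 ffactn0.
  rewrite big_ord_recr IH /= hornerXsubC ffactnSr natrM.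
  have [km|mk] := leqP k m; first by rewrite natrB.
  by rewrite ffact_small // !mul0r.
by rewrite -bin_ffact natrM mulrCA mulVf ?mulr1 // pnatr_eq0 -lt0n fact_gt0.
Qed.

(** The power [(1 + j)^t] by the binomial series, which ends because [j] is nilpotent. *)
Definition unip (t : K) : 'M[K]_n.+1 := \sum_(k < N) (binp k).[t] *: j ^+ k.

Lemma unip_nat m : unip m%:R = (1 + j) ^+ m.
Proof.
rewrite exprDn_comm; last exact: commr1_sym || exact: commr_sym (commr1 j).
transitivity (\sum_(k < maxn N m.+1) (binp k).[m%:R] *: j ^+ k).
  rewrite /unip (big_ord_widen_cond _ xpredT (fun k => (binp k).[m%:R] *: j ^+ k) (leq_maxl N m.+1)).
  rewrite [RHS](bigID (fun k : 'I_ _ => (k < N)%N)) /= [X in _ + X]big1 ?addr0 // => k.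
  by rewrite -leqNgt => /subnK <-; rewrite exprD jN mulr0 scaler0.
rewrite (big_ord_widen_cond _ xpredT (fun k => 1 ^+ (m - k) * j ^+ k *+ 'C(m, k)) (leq_maxr N m.+1)).
rewrite [LHS](bigID (fun k : 'I_ _ => (k < m.+1)%N)) /= [X in _ + X]big1 ?addr0 => [|k].
  by apply: eq_bigr => k _; rewrite binp_nat expr1n mul1r scaler_nat.
by rewrite -leqNgt => mk; rewrite binp_nat bin_small // scale0r.
Qed.

Lemma unip_poly : polymx (fun t => t%:M : 'rV_1) unip.
Proof.
move=> a b; apply: polyf_ext (_ : polyf _ (fun t => \sum_(k < N) (j ^+ k) a b * (binp k).[t])).
  by move=> t; rewrite summxE; apply: eq_bigr => k _; rewrite mxE mulrC.
by apply: polyf_sum => k; apply: polyfZ; apply: polyf_line_horner.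
Qed.

End UnipotentCurve.

Section Exponential.
Variables (K : numFieldType) (n : nat) (X : 'M[K]_n.+1) (N : nat).
Hypothesis XN : X ^+ N = 0.
Notation P := {mpoly K[(n.+1 * n.+1)]}.

(** The matrix [exp(tX)], with entries polynomial in [t]. *)
Definition expp : 'M[{poly K}]_n.+1 :=
  \matrix_(a, b) \sum_(k < N) ((k`!%:R^-1) * (X ^+ k) a b) *: 'X^k.

Definition on_expp (p : P) : {poly K} := mmap (@polyC K) (fun i => mxvec expp 0 i) p.

Lemma on_exppC c : on_expp c%:MP = c%:P. Proof. exact: mmapC. Qed.
Lemma on_exppX i : on_expp 'X_i = mxvec expp 0 i. Proof. by rewrite /on_expp mmapX mmap1U. Qed.
Lemma on_exppD p q : on_expp (p + q) = on_expp p + on_expp q. Proof. exact: mmapD. Qed.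
Lemma on_exppM p q : on_expp (p * q) = on_expp p * on_expp q. Proof. exact: rmorphM. Qed.

Lemma expp_deriv a b : (expp a b)^`() = \sum_l expp a l * (X l b)%:P.
Proof.
rewrite mxE; transitivity (\sum_(k < N) ((k`!%:R^-1) * (X ^+ k.+1) a b) *: 'X^k : {poly K}).
  rewrite linear_sum /=; case: N XN => [|N'] XN'; first by rewrite !big_ord0.
  rewrite [LHS]big_ord_recl [RHS]big_ord_recr /= XN' [(0 : 'M_ _) _ _]mxE mulr0 scale0r addr0.
  rewrite linearZ /= derivXn mulr0n scaler0 add0r; apply: eq_bigr => k _.
  rewrite linearZ /= derivXn -scaler_nat scalerA factS natrM invfM /= /bump /= add1n.
  by congr (_ *: _); rewrite mulrC !mulrA divff ?mul1r // pnatr_eq0.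
under [RHS]eq_bigr do rewrite mxE mulr_suml.
rewrite exchange_big; apply: eq_bigr => k _ /=.
rewrite exprSr mxE mulr_sumr scaler_suml; apply: eq_bigr => l _.
by rewrite [RHS]mulrC mul_polyC scalerA mulrA [in RHS]mulrC.
Qed.

Lemma on_expp_deriv p : (on_expp p)^`() = on_expp (lder X p).
Proof.
elim/mpoly_alg_ind: p => [c|i|p q hp hq|p q hp hq].
- by rewrite on_exppC derivC /lder vfieldC -mpolyC0 on_exppC.
- rewrite on_exppX /lder vfieldX; case/mxvec_indexP: i => a b.
  rewrite !mxvecE expp_deriv.
  have -> : (gen_mx K n *m map_mx (@mpolyC _ K) X) a b =
      \sum_l 'X_(mxvec_index a l) * (X l b)%:MP.
    by rewrite mxE; apply: eq_bigr => l _; rewrite !mxE.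
  rewrite (big_morph on_expp on_exppD (_ : _ = 0)) => [|]; last by rewrite -mpolyC0 on_exppC.
  by apply: eq_bigr => l _; rewrite on_exppM on_exppX on_exppC mxvecE.
- by rewrite on_exppD derivD hp hq /lder vfieldD on_exppD.
- by rewrite on_exppM derivM hp hq /lder vfieldM on_exppD !on_exppM.
Qed.

Lemma on_expp_horner p t : (on_expp p).[t] = p.@[mxvec (map_mx (horner_eval t) expp) 0].
Proof.
elim/mpoly_alg_ind: p => [c|i|p q hp hq|p q hp hq].
- by rewrite on_exppC hornerC mevalC.
- by rewrite on_exppX mevalXU; case/mxvec_indexP: i => a b; rewrite !mxvecE [RHS]mxE.
- by rewrite on_exppD hornerD hp hq mevalD.
- by rewrite on_exppM hornerM hp hq mevalM.
Qed.

Lemma expp_at0 : (0 < N)%N -> map_mx (horner_eval 0) expp = 1.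
Proof.
move=> N0; apply/matrixP => a b; rewrite !mxE /horner_eval horner_sum (bigD1 (Ordinal N0)) //=.
rewrite big1 => [|k k0]; rewrite hornerZ hornerXn.
  by rewrite !expr0 mulr1 fact0 invr1 mul1r addr0 mxE.
have {}k0 : (k == 0 :> nat) = false by apply: negbTE; apply: contra k0 => /eqP k0; apply/eqP/val_inj.
by rewrite expr0n k0 mulr0.
Qed.

(** The [k]-th derivative at 0 of [p(exp(tX))] is the value at 1 of the [k]-th iterate of [lder X]
    on [p], an element of [I]. In characteristic 0 these derivatives determine the polynomial. *)
Lemma exp_mem (I : set P) : (0 < N)%N -> (forall p, I p -> I (lder X p)) ->
  (forall p, I p -> p.@[mxvec 1 0] = 0) ->
  forall p t, I p -> p.@[mxvec (map_mx (horner_eval t) expp) 0] = 0.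
Proof.
move=> N0 hI I1 p t Ip; rewrite -on_expp_horner; suff -> : on_expp p = 0 by rewrite horner0.
have hd k : I (iter k (lder X) p) /\ (on_expp p)^`(k) = on_expp (iter k (lder X) p).
  elim: k => [|k [IH1 IH2]]; first by rewrite derivn0.
  by rewrite iterS derivnS IH2 on_expp_deriv; split=> //; apply: hI.
apply/polyP => k; rewrite coef0; have [Ik dk] := hd k.
have := on_expp_horner (iter k (lder X) p) 0; rewrite expp_at0 // (I1 _ Ik) -dk.
rewrite horner_coef0 coef_derivn addn0 ffactnn => /eqP.
by rewrite mulrn_eq0 -[_ == 0%N]negbK -lt0n fact_gt0 => /eqP.
Qed.

End Exponential.

Section UnipotentRadical.
Variables (K : numFieldType) (G : affineAlgGroup K) (n : nat) (V : G -> 'M[K]_n.+1).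
Hypotheses (hV : linear_group V) (pV : polymx (@aag_coord K G) V)
  (pc : polymx (fun g => mxvec (V g)) (@aag_coord K G)).
Hypothesis Gred : reductive G.

(** * Congruence subgroups of a nilpotent ideal *)

Section NilpotentIdeal.
Variables (J : {vspace 'M[K]_n.+1}) (N : nat).
Hypotheses (VJ : forall g x, x \in J -> V g * x \in J)
  (JV : forall g x, x \in J -> x * V g \in J) (JN : (J ^+ N)%VS = 0%VS).

Lemma expv_stable_l k g x : x \in (J ^+ k.+1)%VS -> V g * x \in (J ^+ k.+1)%VS.
Proof.
have [U hU] : exists U : {vspace 'M[K]_n.+1}, forall x, V g * x \in (J ^+ k.+1)%VS <-> x \in U.
  apply: linear_set_vspace; split=> [|a b ha hb|c a ha] /=.
  - by rewrite mulr0 mem0v.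
  - by rewrite mulrDr; apply: rpredD.
  - by rewrite -scalerAr; apply: rpredZ.
move=> hx; apply/hU; move: hx; apply: subvP; rewrite expvSl; apply/prodvP => a b ha hb.
by apply/hU; rewrite mulrA expvSl; apply: memv_mul => //; apply: VJ.
Qed.

Lemma expv_stable_r k g x : x \in (J ^+ k.+1)%VS -> x * V g \in (J ^+ k.+1)%VS.
Proof.
have [U hU] : exists U : {vspace 'M[K]_n.+1}, forall x, x * V g \in (J ^+ k.+1)%VS <-> x \in U.
  apply: linear_set_vspace; split=> [|a b ha hb|c a ha] /=.
  - by rewrite mul0r mem0v.
  - by rewrite mulrDl; apply: rpredD.
  - by rewrite -scalerAl; apply: rpredZ.
move=> hx; apply/hU; move: hx; apply: subvP; rewrite expvSr; apply/prodvP => a b ha hb.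
by apply/hU; rewrite -mulrA expvSr; apply: memv_mul => //; apply: JV.
Qed.

(** The group intersected with [1 + J^(k+1)]. The shift keeps the exponent positive: the power 0 is
    the line of scalars. *)
Let F k : set G := [set g | V g - 1 \in (J ^+ k.+1)%VS].

Lemma congruence_subgroup k : is_subgroup (F k).
Proof.
split=> [|x y hx hy|x hx]; rewrite /F /=.
- by rewrite (lg1 hV) subrr mem0v.
- rewrite (lgM hV); have -> : V x * V y - 1 = (V x - 1) * V y + (V y - 1).
    by rewrite mulrBl mul1r addrA subrK.
  by apply: rpredD => //; apply: expv_stable_r.
- have -> : V x^-1%g - 1 = - (V x^-1%g * (V x - 1)).
    by rewrite mulrBr mulr1 -(lgM hV) mulVg (lg1 hV) opprB.
  by rewrite rpredN; apply: expv_stable_l.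
Qed.

Lemma congruence_normal k : is_normal (F k).
Proof.
move=> x g hx; rewrite /F /= conjgE !(lgM hV).
have -> : V g^-1%g * (V x * V g) - 1 = V g^-1%g * (V x - 1) * V g.
  by rewrite mulrBr mulrBl mulr1 -!(lgM hV) mulVg (lg1 hV) mulgA.
by apply: expv_stable_r; apply: expv_stable_l.
Qed.

Lemma congruence_closed k : zariski_closed (@aag_coord K G) (F k).
Proof.
apply: (zariski_closed_trans (d := fun g => mxvec (V g))); first by apply/polymx_mxvec.
apply: zariski_closed_sep => g hg.
pose L := lin_mx (projv (J ^+ k.+1)%VS).
have LE M : (mxvec M *m (1%:M - L) == 0) = (M \in (J ^+ k.+1)%VS).
  rewrite mulmxBr mulmx1 mul_vec_lin -linearB /= mxvec_eq0.
  by rewrite subr_eq0; apply/eqP/idP => [->|/projv_id ->//]; exact: memv_proj.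
have [i hi] : exists i, (mxvec (V g - 1) *m (1%:M - L)) 0 i <> 0.
  apply: contrapT => /forallNP h; apply: hg; rewrite /F /= -LE; apply/eqP/rowP => i.
  by rewrite [RHS]mxE; apply: contrapT; exact: h.
exists (fun h => (mxvec (V h - 1) *m (1%:M - L)) 0 i); split=> //.
- apply: polymx_mul; last exact: polymx_cst.
  by apply/polymx_mxvec; apply: polymxB; [exact: polymx_coord|exact: polymx_cst].
- by move=> h; rewrite /F /= -LE => /eqP ->; rewrite mxE.
Qed.

(** The commutator minus 1 is an invertible multiple of the additive commutator of [V x - 1] and
    [V y - 1], so exponents double; the predecessor undoes the shift in [F]. *)
Lemma congruence_commutator k x y : F k x -> F k y -> F (k.+1 + k.+1).-1 [~ x, y]%g.
Proof.
rewrite /F /= => hx hy; rewrite commgEl conjgE !(lgM hV).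
have -> : V x^-1%g * (V y^-1%g * (V x * V y)) - 1 =
    V (x^-1 * y^-1)%g * ((V x - 1) * (V y - 1) - (V y - 1) * (V x - 1)).
  have E (a b : 'M[K]_n.+1) : (a - 1) * (b - 1) = a * b - (a + b - 1).
    by rewrite mulrBl mulrBr mul1r mulr1 -addrA -opprD addrA.
  have E2 (a b c : 'M[K]_n.+1) : a - c - (b - c) = a - b by rewrite opprB addrA subrK.
  rewrite !E [V y + V x]addrC E2 mulrBr -!(lgM hV) !mulgA; congr (_ - _).
  by rewrite -(mulgA x^-1%g) mulVg mulg1 mulVg (lg1 hV).
apply: (@expv_stable_l (k + k.+1)).
have -> : (k + k.+1).+1 = (k.+1 + k.+1)%N by [].
by apply: rpredB; rewrite expvD; apply: memv_mul.
Qed.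

Lemma congruence_trivial k : (N <= k.+1)%N -> F k `<=` [set 1%g].
Proof.
move=> Nk g; rewrite /F /= -(subnK Nk) expvD JN prodv0 memv0 subr_eq0 => /eqP Vg.
by apply: (lg_inj hV); rewrite Vg (lg1 hV).
Qed.

Lemma derived_sub (A B : set G) : is_subgroup B ->
  (forall x y, A x -> A y -> B [~ x, y]%g) -> derived_subgroup A `<=` B.
Proof. by move=> hB h x; apply=> // _ [a Aa [b Ab <-]]; apply: h. Qed.

Lemma congruence_solvable : is_solvable (F 0).
Proof.
pose e k := iter k (fun m => (m.+1 + m.+1).-1) 0%N.
have hd k : iter k (@derived_subgroup G) (F 0) `<=` F (e k).
  elim: k => [//|k IH]; rewrite iterS; apply: derived_sub; first exact: congruence_subgroup.
  by move=> x y /IH hx /IH hy; apply: congruence_commutator.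
have le_e k : (k <= e k)%N.
  by elim: k => [//|k IH]; rewrite /e iterS -/(e k) addSn /= addnS ltnS; apply: leq_trans IH (leq_addr _ _).
exists N; apply/seteqP; split=> [x /hd|x ->].
  by apply: congruence_trivial; apply: leqW.
case: N => [|k] /=; first by have [] := congruence_subgroup 0.
by move=> H [].
Qed.

(** The curve is [x (1 + j)^t] with [j = V u - 1]. At natural [t] it passes through [x u^t]; as the
    naturals are Zariski dense in the line and the group is closed, it stays in the group. *)
Lemma congruence_curve x u : F 0 u -> exists gam : K -> G,
  [/\ forall t, F 0 (x^-1 * gam t)%g, gam 0 = x, gam 1 = (x * u)%g &
      polymx (fun t => t%:M : 'rV_1) (fun t => V (gam t))].
Proof.
rewrite /F /= expv1 => hu; pose j := V u - 1.
have jN : j ^+ N = 0.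
  apply/eqP; rewrite -memv0 -JN memvE -expv_line; apply: expvS; exact: hu.
have Vu : V u = 1 + j by rewrite addrC subrK.
have mem t : exists h, V h = unip j N t.
  apply: (lg_closed hV) => p hp.
  have [q hq] : exists q : {poly K}, forall t, p.@[mxvec (unip j N t) 0] = q.[t].
    apply: polyf_line; apply: polyf_pullback; apply/polymx_mxvec; exact: unip_poly.
  rewrite hq (_ : q = 0) ?horner0 //; apply: poly_eq0_nat => m.
  have -> : q.[m%:R] = p.@[mxvec (V (u ^+ m)%g) 0].
    rewrite -hq unip_nat // -Vu; congr (p.@[mxvec _ 0]).
    elim: m => [|m IH]; first by rewrite expr0 expg0 (lg1 hV).
    by rewrite exprS IH -(lgM hV) expgS.
  exact: hp.
have [h hh] := choice mem.
have jJ k : j ^+ k.+1 \in J.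
  elim: k => [|k IH]; first by rewrite expr1.
  by rewrite exprS /j mulrBl mul1r; apply: rpredB => //; apply: VJ.
exists (fun t => x * h t)%g; split.
- move=> t; rewrite mulgA mulVg mul1g hh /unip.
  case: N jN => [|N'] jN'.
    have := jN'; rewrite expr0 => /eqP; by rewrite oner_eq0.
  rewrite big_ord_recl expr0 /binp fact0 invr1 scale1r big_ord0 hornerC scale1r addrC addKr.
  by apply: rpred_sum => k _; apply: rpredZ; apply: jJ.
- have -> : h 0 = 1%g; last by rewrite mulg1.
  by apply: (lg_inj hV); rewrite hh (lg1 hV) -[0]/(0%:R) unip_nat // expr0.
- congr (_ * _)%g; apply: (lg_inj hV).
  by rewrite hh -[1]/(1%:R) unip_nat // expr1.
- move=> a b; apply: polyf_ext (_ : polyf _ (fun t => (V x *m unip j N t) a b)) => [t|].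
    by rewrite (lgM hV) hh.
  by apply: polymx_mul; [exact: polymx_cst|exact: unip_poly].
Qed.

(** Any two points of [F 0] lie on a polynomial curve inside it, and the line is irreducible. *)
Lemma congruence_connected : zariski_connected (@aag_coord K G) (F 0).
Proof.
have [F1 FM FV] := congruence_subgroup 0.
move=> [A [B [[[IA EA] [IB EB]] sAB [x [Fx Ax]] [y [Fy By]] AB0]]].
have [gam [Fg g0 g1 pg]] := congruence_curve x (FM _ _ (FV _ Fx) Fy).
rewrite mulgA mulgV mul1g in g1.
have Fgam t : F 0 (gam t).
  by rewrite -(mul1g (gam t)) -(mulgV x) -mulgA; apply: FM.
have closed (I : set {mpoly K[(aag_dim G)]}) (t0 : K) :
    ~ (forall p, I p -> p.@[aag_coord (gam t0) 0] = 0) ->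
    exists2 q : {poly K}, q != 0 &
     forall t, (forall p, I p -> p.@[aag_coord (gam t) 0] = 0) -> q.[t] = 0.
  move=> /existsNP[p /not_implyP[Ip pt0]].
  have [q hq] : exists q : {poly K}, forall t, p.@[aag_coord (gam t) 0] = q.[t].
    apply: polyf_line; apply: polyf_pullback => i l.
    by apply: (polyf_precomp (u := gam) _ (pc i l)); apply/polymx_mxvec.
  exists q; first by apply: contra_notN pt0 => /eqP q0; rewrite hq q0 horner0.
  by move=> t /(_ p Ip); rewrite hq.
have notboth z : F 0 z -> A z -> B z -> False.
  by move=> Fz Az Bz; have : (F 0 `&` A `&` B) z by []; rewrite AB0.
have [qA qA0 hA] : exists2 q : {poly K}, q != 0 & forall t, A (gam t) -> q.[t] = 0.
  rewrite EA; apply: (closed IA 1) => Ay; apply: (notboth y) => //.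
  by rewrite EA -g1.
have [qB qB0 hB] : exists2 q : {poly K}, q != 0 & forall t, B (gam t) -> q.[t] = 0.
  rewrite EB; apply: (closed IB 0) => Bx; apply: (notboth x) => //.
  by rewrite EB -g0.
have : qA * qB == 0.
  apply/eqP/poly_eq0_nat => m; rewrite hornerM.
  by have [/hA ->|/hB ->] := sAB _ (Fgam m%:R); rewrite ?mul0r ?mulr0.
by rewrite mulf_eq0 (negbTE qA0) (negbTE qB0).
Qed.

(* F 0 lies in the radical, a torus; a polynomial curve in a torus is constant. *)
Lemma congruence_eq1 u : V u - 1 \in J -> u = 1%g.
Proof.
move=> Fu; have {}Fu : F 0 u by rewrite /F /= expv1.
have [_ [H [[_ Hmax] [r [phi [psi [Hphi psiK _ _ [P hP]]]]]]]] := Gred.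
have FH : F 0 `<=` H.
  apply: Hmax; split.
  - exact: congruence_subgroup.
  - exact: congruence_normal.
  - exact: congruence_solvable.
  - exact: congruence_closed.
  - exact: congruence_connected.
have phiK h : H h -> torus_points (psi h) /\ phi (psi h) = h.
  by rewrite -Hphi => -[t tt <-]; rewrite psiK.
have [gam [Fg g0 g1 pg]] := congruence_curve 1%g Fu.
have {}Fg t : H (gam t) by apply: FH; have := Fg t; rewrite invg1 mul1g.
have coord i : exists q : {poly K}, forall t, torus_coord (psi (gam t)) 0 i = q.[t].
  have [q hq] : exists q : {poly K}, forall t, (P i).@[aag_coord (gam t) 0] = q.[t].
    apply: polyf_line; apply: polyf_pullback => k l.
    by apply: (polyf_precomp (u := gam) _ (pc k l)); apply/polymx_mxvec.
  by exists q => t; rewrite -hq; apply: hP.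
rewrite -(mul1g u) -g1 -g0 -(phiK _ (Fg 0)).2 -(phiK _ (Fg 1)).2; congr phi.
apply/rowP => i.
(* A torus coordinate comes with its inverse: [a] and [b] are mutually inverse polynomials, hence
   constants. *)
have [a ha] := coord (lshift r i); have [b hb] := coord (rshift r i).
have {}ha t : psi (gam t) 0 i = a.[t] by rewrite -ha row_mxEl.
have {}hb t : (psi (gam t) 0 i)^-1 = b.[t] by rewrite -hb row_mxEr mxE.
have ab : a * b = 1.
  apply/eqP; rewrite -subr_eq0; apply/eqP/poly_eq0_nat => m.
  rewrite hornerD hornerN hornerM hornerC -ha -hb divff ?subrr //.
  by have [h _] := phiK _ (Fg m%:R); apply: h.
have /size_poly1P[c _ ac] : size a == 1%N.
  have a0 : a != 0 by apply: contra_eq_neq ab => ->; rewrite mul0r eq_sym oner_neq0.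
  have b0 : b != 0 by apply: contra_eq_neq ab => ->; rewrite mulr0 eq_sym oner_neq0.
  have := size_mul a0 b0; rewrite ab size_poly1.
  have := a0; have := b0; rewrite -!size_poly_eq0.
  by case: (size a) => [//|[|k]] //; case: (size b) => [//|l] _ _; rewrite addSn /= addnS.
by rewrite !ha ac !hornerC.
Qed.

End NilpotentIdeal.

Lemma matrix_span : exists A : {vspace 'M[K]_n.+1}, (forall g, V g \in A) /\
  forall U : {vspace 'M[K]_n.+1}, (forall g, V g \in U) -> (A <= U)%VS.
Proof.
have [|A hA] := @linear_set_vspace K 'M[K]_n.+1
  [set M | forall U : {vspace 'M[K]_n.+1}, (forall g, V g \in U) -> M \in U].
  split=> [U _|x y hx hy U hU|c x hx U hU]; first exact: mem0v.
    by apply: rpredD; [exact: hx|exact: hy].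
  by apply: rpredZ; exact: hx.
exists A; split=> [g|U hU]; first by apply/hA => U.
by apply/subvP => x /hA; apply.
Qed.

(** By Engel's theorem a power of [U] vanishes, so with [A] the span of [V(G)] the product [J = A U]
    is a nilpotent ideal of [A]. For [X] in [U] the curve [exp(tX)] stays in the group and in
    [1 + J], where [congruence_eq1] leaves only the identity. *)
Lemma nilpotent_ideal_trivial (U : {vspace 'M[K]_n.+1}) :
  (forall X, X \in U -> lie V X) -> (forall X g, X \in U -> V g * X * (V g)^-1 \in U) ->
  (forall X, X \in U -> exists m, X ^+ m = 0) -> forall X, X \in U -> X = 0.
Proof.
move=> Ulie UAd Unil X XU.
have pVm : polymx (fun g => mxvec (V g)) V by exact: polymx_coord.
have dinv Y : lie V Y -> dmx V Y (fun g => V g^-1%g) = - Y.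
  move=> hY; have := dmxM hV hY pVm (lg_inv hV).
  rewrite dmxV // invg1 (lg1 hV) mulmx1 mul1mx.
  rewrite (_ : (fun g => _) = fun=> 1%:M) ?dmx_cst // => [/eqP|].
    by rewrite eq_sym addrC addr_eq0 => /eqP.
  by apply: funext => g; rewrite -[_ *m _]/(V g * V g^-1%g) -(lgM hV) mulgV (lg1 hV).
(* The bracket is the derivative in the direction [Y] of [V g * Z * V g^-1], which stays in [U]. *)
have Ul : lie_closed U.
  move=> Y Z hY hZ; have lY := Ulie _ hY.
  have pVZ : polymx (fun g => mxvec (V g)) (fun g => V g *m Z).
    by apply: polymx_mul => //; apply: polymx_cst.
  have -> : Y * Z - Z * Y = dmx V Y (fun g => (V g *m Z) *m V g^-1%g).
    rewrite dmxM //; last exact: (lg_inv hV).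
    rewrite dinv // invg1 (lg1 hV) mulmx1 mul1mx mulmxN.
    rewrite (_ : (fun g => _) = fun g => 1%:M *m V g *m Z) ?dmx_mul ?dmxV ?mul1mx //.
    by apply: funext => g; rewrite mul1mx.
  apply: (dmx_mem hV lY) => [|g]; first by apply: polymx_mul => //; exact: (lg_inv hV).
  by rewrite (lgV hV); apply: UAd.
have [N0 UN] := engel Ul Unil.
(* At least two terms of the exponential series are kept, because [X] is read off at the end as the
   coefficient of [t]. *)
pose N := N0.+2; have {}UN : (U ^+ N)%VS = 0%VS by rewrite !expvSl UN !prodv0.
have [A [VA Amin]] := matrix_span.
have AE (P : set 'M[K]_n.+1) : linear_set P -> (forall g, P (V g)) -> forall a, a \in A -> P a.
  move=> /linear_set_vspace[T hT] hP a aA; apply/hT; apply: (subvP (Amin T _)) aA => g.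
  by apply/hT.
pose J := (A * U)%VS.
have VA1 g a : a \in A -> V g * a \in A.
  apply: (AE [set a | V g * a \in A]) => [|h]; last by rewrite /= -(lgM hV).
  split=> [|x y hx hy|c x hx] /=; first by rewrite mulr0 mem0v.
    by rewrite mulrDr; apply: rpredD.
  by rewrite -scalerAr; apply: rpredZ.
have A1 : (1 <= A)%VS by rewrite -memvE -(lg1 hV).
have AA : (A * A <= A)%VS.
  apply/prodvP => a b aA bA; move: a aA; apply: (AE [set a | a * b \in A]) => [|g]; last exact: VA1.
  split=> [|x y hx hy|c x hx] /=; first by rewrite mul0r mem0v.
    by rewrite mulrDl; apply: rpredD.
  by rewrite -scalerAl; apply: rpredZ.
have UA : (U * A <= A * U)%VS.
  apply/prodvP => x a xU; move: a; apply: (AE [set a | x * a \in J]) => [|g] /=.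
    split=> [|u v hu hv|c u hu] /=; first by rewrite mulr0 mem0v.
      by rewrite mulrDr; apply: rpredD.
    by rewrite -scalerAr; apply: rpredZ.
  have -> : x * V g = V g * (V g^-1%g * x * (V g^-1%g)^-1).
    rewrite !mulrA -(lgM hV) mulgV (lg1 hV) mul1r (lgV hV) invrK //.
  by apply: memv_mul => //; apply: UAd.
have JJ : (J * A <= J)%VS.
  by rewrite /J -prodvA; apply: subv_trans (prodvSr _ UA) _; rewrite prodvA prodvSl.
have AJ : (A * J <= J)%VS by rewrite /J prodvA prodvSl.
have Jk k : (J ^+ k <= A * U ^+ k)%VS.
  elim: k => [|k IH]; first by rewrite !expv0 prodv1.
  rewrite expvSr; apply: subv_trans (prodvSl _ IH) _.
  rewrite /J -prodvA [X in (A * X <= _)%VS]prodvA.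
  have Uk m : (U ^+ m * A <= A * U ^+ m)%VS.
    elim: m => [|m IHm]; first by rewrite expv0 prodv1 prod1v.
    rewrite expvSl -prodvA; apply: subv_trans (prodvSr _ IHm) _.
    by rewrite !prodvA; apply: prodvSl.
  apply: subv_trans (prodvSr _ (prodvSl _ (Uk k))) _.
  by rewrite expvSr !prodvA; do 2!apply: prodvSl.
have JN : (J ^+ N)%VS = 0%VS by apply/eqP; rewrite -subv0; apply: subv_trans (Jk N) _; rewrite UN prodv0.
have XN : X ^+ N = 0.
  by apply/eqP; rewrite -memv0 -UN memvE -expv_line; apply: expvS; exact: XU.
have XJ : X \in J by rewrite -[X]mul1r; apply: memv_mul => //; rewrite memvE.
have JX k : X ^+ k.+1 \in J.
  elim: k => [|k IH]; first by rewrite expr1.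
  rewrite exprS; apply: (subvP AJ); apply: memv_mul => //.
  have := dmx_mem hV (Ulie _ XU) (polymx_coord V) VA.
  by rewrite dmxV //; apply: Ulie.
pose E t := map_mx (horner_eval t) (expp X N).
have E1 t : E t = 1.
  have [h hh] : exists h, V h = E t.
    apply: (lg_closed hV) => p Ip; apply: (exp_mem XN (I := IG V)) => //.
      exact: (lie_der hV (Ulie _ XU)).
    by move=> q Iq; rewrite -(lg1 hV); apply: Iq.
  rewrite -hh (congruence_eq1 _ _ JN (u := h)) ?(lg1 hV) //.
  - by move=> g x xJ; apply: (subvP AJ); apply: memv_mul.
  - by move=> g x xJ; apply: (subvP JJ); apply: memv_mul.
  have -> : V h = \sum_(k < N) (k`!%:R^-1 * t ^+ k) *: X ^+ k.
    rewrite hh; apply/matrixP => a b; rewrite !mxE summxE /horner_eval horner_sum.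
    by apply: eq_bigr => k _; rewrite hornerZ hornerXn mxE mulrAC.
  rewrite big_ord_recl expr0 fact0 invr1 mul1r expr0 scale1r addrC addKr.
  by apply: rpred_sum => k _; apply: rpredZ; apply: JX.
apply/matrixP => a b; rewrite [RHS]mxE.
have : expp X N a b - ((a == b)%:R)%:P = 0.
  apply: poly_eq0_nat => m; rewrite hornerD hornerN hornerC.
  have := congr1 (fun M : 'M_n.+1 => M a b) (E1 m%:R); rewrite !mxE /horner_eval => ->.
  exact: subrr.
move=> /(congr1 (fun p : {poly K} => p`_1)); rewrite coef0 coefB coefC subr0 mxE coef_sum.
rewrite big_ord_recl big_ord_recl big1 => [|k _]; rewrite !coefZ !coefXn /=.
  by rewrite mulr0 add0r mulr1 addr0 expr1 invr1 mul1r.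
by rewrite mulr0.
Qed.

End UnipotentRadical.

(** * Replicas *)

Section Spectral.
Variables (K : fieldType) (E : lmodType K) (T : E -> E).
Hypotheses (TD : forall x y, T (x + y) = T x + T y) (TZ : forall c x, T (c *: x) = c *: T x).

(** [(T - v)^N] as an iteration, since it also serves for derivations of the polynomial ring, in
    infinite dimension. *)
Definition opn (v : K) N x := iter N (fun y => T y - v *: y) x.

Lemma opnD v N x y : opn v N (x + y) = opn v N x + opn v N y.
Proof.
by elim: N => [//|N IH]; rewrite /opn !iterS -!/(opn _ _ _) IH TD scalerDr opprD addrACA.
Qed.

Lemma opnZ v N c x : opn v N (c *: x) = c *: opn v N x.
Proof.
elim: N => [//|N IH]; rewrite /opn !iterS -!/(opn _ _ _) IH TZ scalerBr.
by rewrite !scalerA mulrC.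
Qed.

Lemma opn0 v N : opn v N 0 = 0.
Proof. by rewrite -[X in opn _ _ X](scale0r 0) opnZ scale0r. Qed.

Lemma opn_sum v N (J : Type) (r : seq J) (P : pred J) F :
  opn v N (\sum_(j <- r | P j) F j) = \sum_(j <- r | P j) opn v N (F j).
Proof. by apply: (big_morph (opn v N)); [exact: opnD|exact: opn0]. Qed.

Lemma opnC v N u M x : opn v N (opn u M x) = opn u M (opn v N x).
Proof.
have C1 y : T (T y - v *: y) - u *: (T y - v *: y) = T (T y - u *: y) - v *: (T y - u *: y).
  have TB a b : T (a - b) = T a - T b by rewrite TD -scaleN1r TZ scaleN1r.
  rewrite !TB !TZ !scalerBr !scalerA !opprB [v * u]mulrC !addrA.
  by rewrite [LHS]addrAC [RHS]addrAC; congr (_ + _); rewrite addrAC.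
have step N' y : opn v N' (T y - u *: y) = T (opn v N' y) - u *: opn v N' y.
  by elim: N' => [//|N' IH]; rewrite /opn !iterS -!/(opn _ _ _) IH -C1.
elim: M => [//|M IH]; rewrite /opn iterS -/(opn _ _ _) step.
by rewrite [RHS]iterS -!/(opn _ _ _) IH.
Qed.

Variable I : set E.
Hypotheses (lI : linear_set I) (TI : forall x, I x -> I (T x)).

Lemma opn_stable v N x : I x -> I (opn v N x).
Proof.
elim: N => [//|N IH] /IH h; rewrite /opn iterS; apply: linear_setB => //.
  exact: TI.
by have [_ _ hZ] := lI; apply: hZ.
Qed.

(** By induction [(T - v) x] and [(T - u) x] lie in [I], and their difference is a nonzero multiple
    of [x]. *)
Lemma opn_coprime v N u M x : v != u -> I (opn v N x) -> I (opn u M x) -> I x.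
Proof.
move=> vu; have [k] := ubnP (N + M)%N; elim: k N M x => [//|k IH] N M x hk hN hM.
case: N hk hN => [//|N] hk hN; case: M hk hM => [//|M] hk hM.
have h1 : I (T x - v *: x).
  apply: (IH N M.+1).
  - by rewrite -ltnS (leq_trans _ hk).
  - by move: hN; rewrite /opn iterSr.
  - rewrite -[T x - _]/(opn v 1 x) opnC; exact: opn_stable.
have h2 : I (T x - u *: x).
  apply: (IH N.+1 M).
  - by rewrite -ltnS -addnS (leq_trans _ hk).
  - rewrite -[T x - _]/(opn u 1 x) opnC; exact: opn_stable.
  - by move: hM; rewrite /opn iterSr.
have := linear_setB lI h2 h1.
rewrite opprB addrC addrA subrK -scalerBl => h.
have [_ _ hZ] := lI; have := hZ (v - u)^-1 _ h.
by rewrite scalerA mulVf ?scale1r // subr_eq0.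
Qed.

Lemma opn_coprime_list v N (s : seq K) M x : v \notin s -> I (opn v N x) ->
  I (foldr (fun u y => opn u M y) x s) -> I x.
Proof.
elim: s => [//|u s IH]; rewrite inE negb_or => /andP[vu vs] hx /= hs.
apply: IH => //.
set y := foldr _ _ _ in hs *; apply: (opn_coprime vu _ hs (N := N)).
have -> : opn v N y = foldr (fun u y => opn u M y) (opn v N x) s.
  by rewrite /y; elim: (s) => [//|w t IHt] /=; rewrite opnC IHt.
elim: (s) => [//|w t IHt] /=; exact: opn_stable.
Qed.

(** A stable subspace that contains the sum contains the partial sum of each eigenvalue, hence every
    reweighting by a function of the eigenvalue. The [p j] are generalised eigenvectors modulo [I]
    only. *)
Lemma spectral_sum (J : finType) (v : J -> K) (p : J -> E) N :
  (forall j, I (opn (v j) N (p j))) -> I (\sum_j p j) ->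
  forall phi : K -> K, I (\sum_j phi (v j) *: p j).
Proof.
move=> hp hs phi; have [I0 ID IZ] := lI.
suff main (s : seq K) : forall A : pred J, (forall j, A j -> v j \in s) ->
    I (\sum_(j | A j) p j) -> I (\sum_(j | A j) phi (v j) *: p j).
  by apply: (main [seq v j | j <- enum J]) => // j _; apply: map_f; rewrite mem_enum.
elim: s => [|v0 s IH] A hA hsum.
  by rewrite big_pred0 // => j; apply/negP => /hA.
pose A' j := A j && (v j != v0).
pose A0 j := A j && ~~ (v j != v0).
have split (F : J -> E) : \sum_(j | A j) F j = \sum_(j | A' j) F j + \sum_(j | A0 j) F j.
  by rewrite (bigID (fun j => v j != v0)).
have h0 : I (opn v0 N (\sum_(j | A0 j) p j)).
  rewrite opn_sum; apply: linear_set_sum => // j /andP[_]; rewrite negbK => /eqP <-.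
  exact: hp.
have hA' : I (\sum_(j | A' j) p j).
  apply: (@opn_coprime_list v0 N [seq u <- s | u != v0] N); first by rewrite mem_filter eqxx.
    have -> : \sum_(j | A' j) p j = \sum_(j | A j) p j - \sum_(j | A0 j) p j.
      by rewrite (split p) addrK.
    rewrite -scaleN1r opnD opnZ scaleN1r; apply: linear_setB => //.
    exact: opn_stable.
  have kill (t : seq K) u x : u \in t -> I (opn u N x) ->
      I (foldr (fun u y => opn u N y) x t).
    elim: t => [//|w t IHt]; rewrite inE /= => /predU1P[<-|ut] hx; last first.
      by apply: opn_stable; apply: IHt.
    have -> : opn u N (foldr (fun u y => opn u N y) x t) =
        foldr (fun u y => opn u N y) (opn u N x) t.
      by elim: (t) => [//|w' t' IHt'] /=; rewrite opnC IHt'.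
    by elim: (t) => [//|w' t' IHt'] /=; apply: opn_stable.
  have -> : foldr (fun u y => opn u N y) (\sum_(j | A' j) p j) [seq u <- s | u != v0] =
      \sum_(j | A' j) foldr (fun u y => opn u N y) (p j) [seq u <- s | u != v0].
    by elim: [seq _ <- _ | _] => [//|w t IHt] /=; rewrite IHt opn_sum.
  apply: linear_set_sum => // j /andP[Aj vj]; apply: (kill _ (v j)) => //.
  by rewrite mem_filter vj; have := hA _ Aj; rewrite inE (negbTE vj).
rewrite split; apply: ID.
  by apply: IH => // j /andP[Aj vj]; have := hA _ Aj; rewrite inE (negbTE vj).
have -> : \sum_(j | A0 j) phi (v j) *: p j = phi v0 *: \sum_(j | A0 j) p j.
  by rewrite scaler_sumr; apply: eq_bigr => j /andP[_]; rewrite negbK => /eqP ->.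
apply: IZ; move: hsum; rewrite split => hsum.
have -> : \sum_(j | A0 j) p j = \sum_(j | A' j) p j + \sum_(j | A0 j) p j - \sum_(j | A' j) p j.
  by rewrite addrAC subrr add0r.
exact: linear_setB.
Qed.

End Spectral.

Lemma partition_of_unity (K : fieldType) (s : seq K) N : uniq s -> s != [::] ->
  exists a : K -> {poly K},
    \sum_(u <- s) a u * \prod_(w <- s | w != u) ('X - w%:P) ^+ N = 1.
Proof.
elim: s => [//|l s IH] /= /andP[ls us] _.
have [->|/(IH us)[a ha]] := eqVneq s [::].
  by exists (fun=> 1); rewrite big_seq1 /= mul1r big_cons big_nil eqxx.
pose F : {poly K} := \prod_(w <- s) ('X - w%:P) ^+ N.
have cop : coprimep F (('X - l%:P) ^+ N).
  apply: coprimep_expr; rewrite coprimep_sym.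
  rewrite /F; elim: (s) ls => [|w t IHt]; first by rewrite big_nil coprimep1.
  rewrite inE negb_or big_cons coprimepMr => /andP[lw lt]; rewrite IHt // andbT.
  by apply: coprimep_expr; rewrite coprimep_XsubC root_XsubC eq_sym.
have [[u v] /= huv] := Bezout_eq1_coprimepP _ _ cop.
exists (fun w => if w == l then u else v * a w).
rewrite big_cons eqxx big_cons eqxx /=.
have -> : \prod_(w <- s | w != l) ('X - w%:P) ^+ N = F.
  rewrite /F big_seq_cond [RHS]big_seq_cond; apply: eq_bigl => w.
  by have [->|//] := eqVneq w l; rewrite (negbTE ls).
rewrite -[RHS]huv; congr (_ + _).
rewrite -[RHS]mulr1 -[X in _ = _ * X]ha mulr_sumr big_seq [RHS]big_seq; apply: eq_bigr => w ws.
have wl : w != l by apply: contraNneq ls => <-.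
rewrite (negbTE wl) big_cons eq_sym wl.
by rewrite -!mulrA; congr (_ * _); rewrite mulrCA.
Qed.

Section SpectralProjections.
Variables (K : numClosedFieldType) (m : nat).
Implicit Types T S e : 'M[K]_m.+1.

Lemma spectral_projections T : exists (s : seq K) (P : K -> 'M[K]_m.+1) N,
  [/\ uniq s, \sum_(l <- s) P l = 1, forall l, l \in s -> (T - l%:M) ^+ N * P l = 0 &
      forall l, exists q, P l = horner_mx T q].
Proof.
have [r hr] := closed_field_poly_normal (char_poly T).
have : char_poly T \is monic := char_poly_monic T.
rewrite hr monicE lead_coefZ lead_coef_prod_XsubC mulr1 => /eqP lc.
rewrite lc scale1r in hr.
pose s := undup r; pose N := size r.
have s0 : s != [::].
  apply/eqP => /undup_nil h; have := size_char_poly T.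
  by rewrite hr h big_nil size_poly1.
have [a ha] := partition_of_unity N (undup_uniq r) s0.
exists s, (fun u => horner_mx T (a u * \prod_(w <- s | w != u) ('X - w%:P) ^+ N)), N.
split=> [||l ls|l]; last by exists (a l * \prod_(w <- s | w != l) ('X - w%:P) ^+ N).
- exact: undup_uniq.
- by rewrite -rmorph_sum ha rmorph1.
have -> : T - l%:M = horner_mx T ('X - l%:P) by rewrite rmorphB /= horner_mx_X horner_mx_C.
rewrite -rmorphXn -rmorphM /= mulrCA.
have -> : ('X - l%:P) ^+ N * \prod_(w <- s | w != l) ('X - w%:P) ^+ N =
    \prod_(w <- s) ('X - w%:P) ^+ N.
  by rewrite (bigD1_seq l) //= undup_uniq.
have : char_poly T %| \prod_(w <- s) ('X - w%:P) ^+ N.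
  rewrite hr -prodr_undup_exp_count /s /N.
  elim: (undup r) => [|w t IHt]; first by rewrite !big_nil dvdpp.
  by rewrite !big_cons; apply: dvdp_mul => //; apply: dvdp_exp2l; rewrite count_size.
by move=> /dvdpP[q ->]; rewrite mulrA rmorphM /= Cayley_Hamilton mulr0.
Qed.

End SpectralProjections.

Lemma mxtrace_idempotent (K : fieldType) m (e : 'M[K]_m) : e *m e = e ->
  \tr e = (\rank e)%:R.
Proof.
move=> ee; suff h r (C : 'M_(m, r)) (R : 'M_(r, m)) :
    C *m R = e -> row_full C -> row_free R -> \tr e = r%:R.
  by apply: (h _ (col_base e) (row_base e)); rewrite ?mulmx_base ?col_base_full ?row_base_free.
move=> CR /row_fullP[C' CC'] /row_freeP[R' RR'].
suff RC : R *m C = 1%:M by rewrite -{1}CR mxtrace_mulC RC mxtrace1.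
have -> : R *m C = C' *m (C *m R *m (C *m R)) *m R'.
  by rewrite !mulmxA CC' mul1mx -!mulmxA RR' mulmx1.
by rewrite CR ee -CR !mulmxA CC' mul1mx RR'.
Qed.

(** A nilpotent [e] of positive size is singular. A rank factorisation [e = C R] gives
    [tr e = tr (R C)], and [R C] is nilpotent of smaller size. *)
Lemma mxtrace_nilpotent (K : fieldType) m (e : 'M[K]_m) N :
  iter N (mulmx e) 1%:M = 0 -> \tr e = 0.
Proof.
have [k] := ubnP m; elim: k m e N => [//|k IH] m e N mk eN.
have [m0|m0] := posnP m.
  by move: e {eN}; rewrite m0 => e; rewrite [e]flatmx0 linear0.
have re : (\rank e < m)%N.
  rewrite ltn_neqAle rank_leq_row andbT; apply/eqP => re.
  have eu : e \in unitmx by rewrite -row_full_unit /row_full re.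
  have : iter N (mulmx e) 1%:M \in unitmx.
    by elim: N {eN} => [|N IHN]; rewrite ?unitmx1 // iterS unitmx_mul eu.
  by rewrite eN; case: m m0 {IH mk e eN re eu} => // m _; rewrite -[_ \in _]/(0 \is a GRing.unit) unitr0.
move: (mulmx_base e) re; move: (\rank e) (col_base e) (row_base e) => r C R CR re.
rewrite -CR mxtrace_mulC; apply: (IH _ _ N.+1); first exact: leq_trans re _.
have shift M : iter M.+1 (mulmx (R *m C)) 1%:M = R *m iter M (mulmx e) 1%:M *m C.
  elim: M => [|M IHM]; first by rewrite /= !mulmx1.
  by rewrite iterS IHM iterS -CR !mulmxA.
by rewrite shift eN mulmx0 mul0mx.
Qed.

Section Replica.
Variables (K : numClosedFieldType) (m : nat).
Implicit Types T S e : 'M[K]_m.+1.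

(* S acts on the generalised eigenspace of T for l as the scalar l^*. *)
Definition replica T S := forall l N (w : 'cV[K]_m.+1),
  opn (mulmx T) l N w = 0 -> S *m w = l^* *: w.

Lemma opn_mulmx T l N (w : 'cV[K]_m.+1) : opn (mulmx T) l N w = (T - l%:M) ^+ N *m w.
Proof.
elim: N => [|N IH]; first by rewrite mul1mx.
by rewrite /opn iterS -/(opn _ _ _ _) IH exprS -mulmxA mulmxBl mul_scalar_mx.
Qed.

Let TD T (x y : 'cV[K]_m.+1) : T *m (x + y) = T *m x + T *m y. Proof. exact: mulmxDr. Qed.
Let TZ T c (x : 'cV[K]_m.+1) : T *m (c *: x) = c *: (T *m x).
Proof. by rewrite -scalemxAr. Qed.

Lemma spectral_kill T (P : K -> 'M[K]_m.+1) N l u M (w : 'cV[K]_m.+1) :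
  (T - u%:M) ^+ N * P u = 0 -> (exists q, P u = horner_mx T q) ->
  u != l -> opn (mulmx T) l M w = 0 -> P u *m w = 0.
Proof.
move=> hPu [q hq] ul hw.
have l0 : linear_set [set x : 'cV[K]_m.+1 | x = 0].
  by split=> // [x y -> ->|c x ->]; rewrite ?addr0 ?scaler0.
apply: (opn_coprime (TD T) (TZ T) l0 _ ul (N := N) (M := M)) => /=.
- by move=> x ->; rewrite mulmx0.
- by rewrite opn_mulmx mulmxA -[_ *m P u]/(_ * P u) hPu mul0mx.
- rewrite opn_mulmx mulmxA -[_ *m P u]/(_ * P u).
  have -> : (T - l%:M) ^+ M * P u = P u * (T - l%:M) ^+ M.
    have -> : T - l%:M = horner_mx T ('X - l%:P) by rewrite rmorphB /= horner_mx_X horner_mx_C.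
    by rewrite hq -rmorphXn -!rmorphM mulrC.
  by rewrite -mulmxA -opn_mulmx hw mulmx0.
Qed.

Lemma spectral_orth T (s : seq K) (P : K -> 'M[K]_m.+1) N l u :
  (forall l, l \in s -> (T - l%:M) ^+ N * P l = 0) ->
  (forall l, exists q, P l = horner_mx T q) ->
  l \in s -> u \in s -> u != l -> P u * P l = 0.
Proof.
move=> PN Pq ls us' ul; apply/matrixP => i j.
have := @spectral_kill T P N l u N (col j (P l)) (PN _ us') (Pq _) ul.
rewrite opn_mulmx !colE mulmxA -[_ *m P l]/(_ * P l) PN // mul0mx mulmxA => /(_ erefl)/colP/(_ i).
by rewrite -colE !mxE.
Qed.

Lemma replica_exists T : exists S, replica T S.
Proof.
have [s [P [N [us P1 PN Pq]]]] := spectral_projections T.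
exists (\sum_(l <- s) l^* *: P l) => l M w hw.
have kill u : u \in s -> u != l -> P u *m w = 0.
  by move=> us' ul; apply: spectral_kill hw => //; exact: PN.
rewrite mulmx_suml; transitivity (\sum_(u <- s) l^* *: (P u *m w)).
  rewrite big_seq [RHS]big_seq; apply: eq_bigr => u us'; rewrite -scalemxAl.
  by have [->//|ul] := eqVneq u l; rewrite kill // !scaler0.
by rewrite -scaler_sumr -mulmx_suml P1 mul1mx.
Qed.

(** The trace is the sum over the eigenvalues [l] of [T] of [|l|^2] times the rank of [e * P l]. If
    it vanishes, [e] kills every eigenspace with [l] nonzero, and on the remaining one [S] is 0. *)
Lemma replica_trace T S e : replica T S -> e * T = T * e -> e * e = e ->
  \tr (e * T * S) = 0 -> e * S = 0.
Proof.
move=> TS eT ee tr0.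
have [s [P [N [us P1 PN Pq]]]] := spectral_projections T.
have SP l : l \in s -> S * P l = l^* *: P l.
  move=> ls; apply/matrixP => i j.
  have := TS l N (col j (P l)); rewrite opn_mulmx !colE mulmxA -[_ *m P l]/(_ * P l) PN //.
  rewrite mul0mx mulmxA => /(_ erefl)/colP/(_ i).
  by rewrite -colE scalemxAl -colE !mxE.
have PI l : l \in s -> P l * P l = P l.
  move=> ls; rewrite -[RHS]mulr1 -P1 mulr_sumr (bigD1_seq l) //= big_seq_cond.
  rewrite big1 ?addr0 // => u /andP[us' ul].
  by apply: (spectral_orth PN Pq) => //; rewrite eq_sym.
have eP l : e * P l = P l * e.
  by have [q ->] := Pq l; symmetry; apply: comm_horner_mx.
have trP l : l \in s -> \tr (e * T * P l) = l * (\rank (e *m P l))%:R.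
  move=> ls.
  have -> : e * T * P l = l *: (e * P l) + e * (T - l%:M) * P l.
    rewrite mulrBr mulrBl -[e * l%:M]/(e *m l%:M) mul_mx_scalar -scalerAl.
    by rewrite addrC subrK.
  rewrite mxtraceD mxtraceZ [X in _ + X](_ : _ = 0) ?addr0.
    congr (_ * _); apply: mxtrace_idempotent.
    by rewrite -[_ *m _]/(_ * _) mulrA -(mulrA e) -eP mulrA ee -mulrA PI.
  apply: (@mxtrace_nilpotent _ _ _ N.+1).
  have TP : GRing.comm (T - l%:M) (P l).
    have -> : T - l%:M = horner_mx T ('X - l%:P) by rewrite rmorphB /= horner_mx_X horner_mx_C.
    by have [q ->] := Pq l; rewrite /GRing.comm -!rmorphM mulrC.
  have eTl : GRing.comm e (T - l%:M).
    by rewrite /GRing.comm mulrBr mulrBl eT; congr (_ - _); rewrite -[LHS]/(e *m _) scalar_mxC.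
  have iterE (M : 'M[K]_m.+1) k : iter k (mulmx M) 1%:M = M ^+ k.
    by elim: k => [//|k IHk]; rewrite iterS IHk exprS.
  rewrite iterE exprMn_comm; last first.
    by rewrite /GRing.comm -mulrA TP mulrA eP mulrA.
  have A0 : (T - l%:M) ^+ N.+1 * P l ^+ N.+1 = 0.
    by rewrite (exprS (T - _)) (exprS (P l)) -mulrA (mulrA (_ ^+ N)) PN // mul0r mulr0.
  by rewrite exprMn_comm // -mulrA A0 mulr0.
have tr1 : \tr (e * T * S) = \sum_(l <- s) `|l| ^+ 2 * (\rank (e *m P l))%:R.
  have -> : e * T * S = \sum_(l <- s) l^* *: (e * T * P l).
    rewrite -[S]mulr1 -P1 !mulr_sumr big_seq [RHS]big_seq; apply: eq_bigr => l ls.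
    by rewrite SP // -scalerAr.
  rewrite raddf_sum big_seq [RHS]big_seq; apply: eq_bigr => l ls /=.
  by rewrite mxtraceZ trP // mulrA normCKC.
have eP0 l : l \in s -> l != 0 -> e * P l = 0.
  move=> ls l0; move: tr0; rewrite tr1 => /eqP.
  rewrite psumr_eq0 => [/allP/(_ l ls)/=|u _]; last by rewrite mulr_ge0 // exprn_ge0.
  rewrite mulf_eq0 expf_eq0 normr_eq0 (negbTE l0) /= pnatr_eq0 mxrank_eq0.
  by move/eqP.
rewrite -[S]mulr1 -P1 !mulr_sumr big_seq big1 // => l ls; rewrite SP // -scalerAr.
by have [->|l0] := eqVneq l 0; rewrite ?conjC0 ?scale0r // eP0 // scaler0.
Qed.

End Replica.

Section ReplicaDerivation.
Variables (K : numClosedFieldType) (n : nat) (X Y : 'M[K]_n.+1).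
Hypothesis XY : replica X Y.
Notation P := {mpoly K[(n.+1 * n.+1)]}.
Let T : P -> P := lder X.
Let S : P -> P := lder Y.

Let TD p q : T (p + q) = T p + T q. Proof. exact: vfieldD. Qed.
Let TZ c p : T (c *: p) = c *: T p. Proof. exact: vfieldZ. Qed.

Lemma opn_le v M N (p : P) : (M <= N)%N -> opn T v M p = 0 -> opn T v N p = 0.
Proof.
move=> /subnK <- h; rewrite /opn iterD -[iter M _ _]/(opn T v M p) h; exact: (opn0 TZ).
Qed.

Lemma opn_mul u v M N (p q : P) : opn T u M p = 0 -> opn T v N q = 0 ->
  opn T (u + v) (M + N) (p * q) = 0.
Proof.
have [k] := ubnP (M + N)%N; elim: k M N p q => [//|k IH] M N p q hk hp hq.
case: M hp hk => [hp _|M hp hk]; first by rewrite (hp : p = 0) mul0r; exact: (opn0 TZ).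
case: N hq hk => [hq _|N hq hk]; first by rewrite (hq : q = 0) mulr0; exact: (opn0 TZ).
have E : T (p * q) - (u + v) *: (p * q) = (T p - u *: p) * q + p * (T q - v *: q).
  rewrite /T /lder vfieldM mulrBl mulrBr -scalerAl -scalerAr scalerDl opprD.
  by rewrite addrACA.
rewrite addSn /opn iterSr E -/(opn _ _ _ _) (opnD TD).
have e1 : opn T (u + v) (M + N.+1) ((T p - u *: p) * q) = 0.
  by apply: IH => //; move: hp; rewrite /opn iterSr.
have e2 : opn T (u + v) (M + N.+1) (p * (T q - v *: q)) = 0.
  by rewrite -addSnnS; apply: IH => //; [rewrite addSnnS|move: hq; rewrite /opn iterSr].
by rewrite e1 e2 addr0.
Qed.

Definition spectral_sum_of (p : P) := exists (J : finType) (v : J -> K) (q : J -> P) N,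
  [/\ forall j, opn T (v j) N (q j) = 0, forall j, S (q j) = (v j)^* *: q j &
      p = \sum_j q j].

(** The coordinates in a row of the generic matrix form a copy of the column space on which [lder A]
    acts as [A], so the eigenprojections of [X] apply. In products eigenvalues add up, and [lder Y]
    follows because conjugation is additive. *)
Lemma spectral_decomposition p : spectral_sum_of p.
Proof.
elim/mpoly_alg_ind: p => [c|k|p1 p2 [J1 [v1 [q1 [N1 [h1 s1 ->]]]]] [J2 [v2 [q2 [N2 [h2 s2 ->]]]]]
  |p1 p2 [J1 [v1 [q1 [N1 [h1 s1 ->]]]]] [J2 [v2 [q2 [N2 [h2 s2 ->]]]]]].
- exists unit, (fun=> 0), (fun=> c%:MP), 1%N; split=> [_|_|].
  + by rewrite /opn /= /T /lder vfieldC scale0r subr0.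
  + by rewrite /S /lder vfieldC conjC0 scale0r.
  + by rewrite (bigD1 tt) //= big1 ?addr0 // => -[].
- case/mxvec_indexP: k => i j.
  pose ell (w : 'cV[K]_n.+1) : P := \sum_b w b 0 *: 'X_(mxvec_index i b).
  have ellD w w' : ell (w + w') = ell w + ell w'.
    by rewrite -big_split; apply: eq_bigr => b _; rewrite mxE scalerDl.
  have ellZ c w : ell (c *: w) = c *: ell w.
    by rewrite scaler_sumr; apply: eq_bigr => b _; rewrite mxE scalerA.
  have ell0 : ell 0 = 0 by rewrite -[X in ell X](scale0r 0) ellZ scale0r.
  have ell_der A w : lder A (ell w) = ell (A *m w).
    rewrite /lder vfield_sum.
    transitivity (\sum_b \sum_c (A c b * w b 0) *: 'X_(mxvec_index i c) : P).
      apply: eq_bigr => b _; rewrite vfieldZ vfieldX mxvecE mxE scaler_sumr.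
      by apply: eq_bigr => c _; rewrite !mxE mulrC mul_mpolyC scalerA mulrC.
    by rewrite exchange_big; apply: eq_bigr => c _; rewrite mxE scaler_suml.
  have ell_opn l N w : opn T l N (ell w) = ell (opn (mulmx X) l N w).
    elim: N => [//|N IH]; rewrite /opn !iterS -!/(opn _ _ _ _) IH /T ell_der.
    by rewrite -!scaleN1r ellD !ellZ.
  pose ej : 'cV[K]_n.+1 := delta_mx j 0.
  have [s [Q [N [us Q1 QN _]]]] := spectral_projections X.
  have QN' (a : 'I_(size s)) : opn (mulmx X) s`_a N (Q s`_a *m ej) = 0.
    by rewrite opn_mulmx mulmxA -[_ *m Q _]/(_ * Q _) QN ?mem_nth // mul0mx.
  exists 'I_(size s), (fun a : 'I_(size s) => s`_a), (fun a : 'I_(size s) => ell (Q s`_a *m ej)), N.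
  split=> [a|a|].
  + by rewrite ell_opn QN' ell0.
  + by rewrite /S ell_der (XY (QN' a)) ellZ.
  + rewrite -(big_mkord xpredT (fun a => ell (Q s`_a *m ej))).
    rewrite -(big_nth 0 xpredT (fun l => ell (Q l *m ej))).
    rewrite -(big_morph ell ellD ell0) -mulmx_suml Q1 mul1mx /ell /ej.
    rewrite (bigD1 j) //= mxE !eqxx scale1r big1 ?addr0 // => b bj.
    by rewrite mxE (negbTE bj) scale0r.
- exists (J1 + J2)%type, (fun j => match j with inl j => v1 j | inr j => v2 j end),
    (fun j => match j with inl j => q1 j | inr j => q2 j end), (maxn N1 N2).
  split=> [[j|j]|[j|j]|]; rewrite ?s1 ?s2 //.
  + exact: opn_le (leq_maxl _ _) (h1 j).
  + exact: opn_le (leq_maxr _ _) (h2 j).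
  + by rewrite big_sumType.
- exists (J1 * J2)%type, (fun j => v1 j.1 + v2 j.2), (fun j => q1 j.1 * q2 j.2), (N1 + N2)%N.
  split=> [j|j|].
  + exact: opn_mul.
  + rewrite /S /lder vfieldM -/(lder Y _) -/(lder Y _) -/(S _) -/(S _) s1 s2 rmorphD /= scalerDl.
    by rewrite -scalerAl -scalerAr.
  + rewrite mulr_suml -(pair_bigA _ (fun i j => q1 i * q2 j)) /=.
    by apply: eq_bigr => i _; rewrite mulr_sumr.
Qed.

Variable I : set P.
Hypotheses (lI : linear_set I) (TI : forall p, I p -> I (T p)).

Lemma replica_lder_eigen p mu M : I (opn T mu M p) -> I (S p - mu^* *: p).
Proof.
move=> hp; have [J [v [q [N [hq sq E]]]]] := spectral_decomposition p.
have [I0 _ _] := lI.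
(* Adjoining [- p], of eigenvalue [mu] modulo [I], makes the total sum 0, so that [spectral_sum]
   speaks of [p] itself. *)
pose v' (j : J + unit) := if j is inl j then v j else mu.
pose q' (j : J + unit) := if j is inl j then q j else - p.
have sum1 (F : unit -> P) : \sum_j F j = F tt by rewrite (bigD1 tt) //= big1 ?addr0 // => -[].
have := @spectral_sum _ _ T TD TZ I lI TI _ v' q' (maxn N M) _ _ (fun l => l^*).
rewrite !big_sumType /= !sum1 {1}E subrr scalerN.
have Sp : S p = \sum_j (v j)^* *: q j.
  transitivity (\sum_j S (q j)); first by rewrite [in LHS]E; apply: vfield_sum.
  by apply: eq_bigr => j _; exact: sq.
rewrite Sp; apply=> // -[j|[]] /=; first by rewrite (opn_le (leq_maxl _ _) (hq j)).
rewrite -scaleN1r (opnZ TZ) scaleN1r; apply: linear_setN => //.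
rewrite /opn -(subnK (leq_maxr N M)) iterD -[iter M _ _]/(opn T mu M p).
exact: (opn_stable lI TI).
Qed.

Lemma replica_lder_stable p : I p -> I (S p).
Proof.
move=> Ip; have [J [v [q [N [hq sq E]]]]] := spectral_decomposition p.
have [I0 _ _] := lI.
have -> : S p = \sum_j (v j)^* *: q j.
  transitivity (\sum_j S (q j)); first by rewrite [in LHS]E; apply: vfield_sum.
  by apply: eq_bigr => j _; exact: sq.
apply: (@spectral_sum _ _ T TD TZ I lI TI _ v q N _ _ (fun l => l^*)) => [j|].
  by rewrite hq.
by rewrite -E.
Qed.

End ReplicaDerivation.

Section ReplicaRep.
Variables (K : numClosedFieldType) (G : groupType) (n : nat) (V : G -> 'M[K]_n.+1).
Hypothesis hV : linear_group V.
Variables (X Y : 'M[K]_n.+1).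
Hypotheses (XY : replica X Y) (hX : lie V X).
Notation P := {mpoly K[(n.+1 * n.+1)]}.

Let lI : linear_set (IG V).
Proof.
have iI := IG_ideal V; split=> [|p q|c p]; [exact: ideal0|exact: idealD|].
by rewrite -mul_mpolyC; apply: idealMl.
Qed.

(** Chevalley's closure of algebraic Lie algebras under replicas: [lder Y] preserves every subspace
    that [lder X] preserves, in particular the ideal of the group. *)
Lemma replica_lie : lie V Y.
Proof.
move=> p Ip; have := replica_lder_stable XY lI (lie_der hV hX) Ip.
by move=> /(_ 1%g); rewrite lder_eval (lg1 hV) mul1r.
Qed.

(** [dmx V X W] acts on a vector [w] as [lder X] acts on the functions [(W g *m w) i 0], so the
    eigenvalue relation between the two fields modulo [IG] transfers to [W]. *)
Lemma replica_dmx m (W : G -> 'M[K]_m.+1) : rational_rep V W ->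
  replica (dmx V X W) (dmx V Y W).
Proof.
move=> hW mu N w hw; apply/colP => i.
have regW (w' : 'cV[K]_m.+1) i' : reg V (fun g => (W g *m w') i' 0).
  by apply: polymx_mul; [exact: (rr_poly hW)|exact: polymx_cst].
have [p hp] := regW w i.
have derE Z (w' : 'cV[K]_m.+1) q : lie V Z ->
    (forall g, (W g *m w') i 0 = q.@[mxvec (V g) 0]) ->
    forall g, (W g *m (dmx V Z W *m w')) i 0 = (lder Z q).@[mxvec (V g) 0].
  move=> hZ hq g; rewrite -(dleftE hV hZ hq) mulmxA.
  have := dmx_left hV hW 1%:M w' i 0 g hZ; rewrite mul1mx => <-.
  by congr dleft; apply: funext => h; rewrite mul1mx.
have opnE M : forall g, (W g *m opn (mulmx (dmx V X W)) mu M w) i 0 =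
    (opn (lder X) mu M p).@[mxvec (V g) 0].
  elim: M => [|M IH] g //; rewrite /opn !iterS -!/(opn _ _ _ _).
  by rewrite mevalB mevalZ -IH -(derE _ _ _ hX IH) mulmxBr -scalemxAr !mxE.
have hI : IG V (opn (lder X) mu N p) by move=> g; rewrite -opnE hw mulmx0 mxE.
have := replica_lder_eigen XY lI (lie_der hV hX) hI => /(_ 1%g).
rewrite mevalB mevalZ -hp -(derE _ _ _ replica_lie hp) (rr1 hW) !mul1mx.
by move=> /eqP; rewrite subr_eq0 => /eqP ->; rewrite mxE.
Qed.

End ReplicaRep.

(** * The Casimir element *)

Lemma replica0_nilpotent (K : numClosedFieldType) m (X : 'M[K]_m.+1) :
  replica X 0 -> exists N, X ^+ N = 0.
Proof.
move=> X0; have [s [P [N [us P1 PN _]]]] := spectral_projections X.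
exists N; rewrite -[LHS]mulr1 -P1 mulr_sumr big_seq big1 // => l ls.
have [l0|l0] := eqVneq l 0; first by have := PN _ ls; rewrite l0 raddf0 subr0.
suff -> : P l = 0 by rewrite mulr0.
apply/matrixP => i j; have := X0 l N (col j (P l)).
rewrite opn_mulmx !colE mulmxA -[_ *m P l]/(_ * P l) PN // mul0mx mul0mx => /(_ erefl)/esym/eqP.
by rewrite scaler_eq0 conjC_eq0 (negbTE l0) -colE /= => /eqP/colP/(_ i); rewrite !mxE.
Qed.

Lemma mxtrace_mxvec (K : fieldType) m (X B : 'M[K]_m) :
  \tr (X *m B) = (mxvec X *m (mxvec B^T)^T) 0 0.
Proof.
rewrite mxE /mxtrace.
under eq_bigr do rewrite mxE.
rewrite pair_bigA /= (reindex _ (curry_mxvec_bij _ _)) /=.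
by apply: eq_bigr => -[i j] _; rewrite /= !mxE !mxvecE mxE.
Qed.

Section Casimir.
Variables (K : numClosedFieldType) (G : groupType) (n : nat) (V : G -> 'M[K]_n.+1).
Hypotheses (hV : linear_group V) (hconn : zariski_connected (fun g => mxvec (V g)) setT).
Hypothesis hnil : forall U : {vspace 'M[K]_n.+1}, (forall X, X \in U -> lie V X) ->
  (forall X g, X \in U -> V g * X * (V g)^-1 \in U) ->
  (forall X, X \in U -> exists m, X ^+ m = 0) -> forall X, X \in U -> X = 0.
Variables (m : nat) (W : G -> 'M[K]_m.+1).
Hypothesis hW : rational_rep V W.
Notation dW X := (dmx V X W).

(** The columns of [M] lie in the image of the Lie algebra action. The explicit form later turns
    matrix coefficients into sums of derivatives. *)
Definition in_der_image (M : 'M[K]_m.+1) := exists k (X : 'I_k -> 'M[K]_n.+1) (B : 'I_k -> 'M[K]_m.+1),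
  (forall i, lie V (X i)) /\ M = \sum_i dW (X i) * B i.

Lemma in_der_image0 : in_der_image 0.
Proof. by exists 0%N, (fun=> 0), (fun=> 0); split=> [[]//|]; rewrite big_ord0. Qed.

Lemma in_der_imageD M M' : in_der_image M -> in_der_image M' -> in_der_image (M + M').
Proof.
move=> [k [X [B [hX ->]]]] [l [Y [C [hY ->]]]].
exists (k + l)%N, (fun i => match split i with inl j => X j | inr j => Y j end),
  (fun i => match split i with inl j => B j | inr j => C j end).
split=> [i|]; first by case: split.
rewrite big_split_ord /=; congr (_ + _); apply: eq_bigr => i _.
  by rewrite (unsplitK (inl i : 'I_k + 'I_l)).
by rewrite (unsplitK (inr i : 'I_k + 'I_l)).
Qed.

Lemma in_der_imageMr M C : in_der_image M -> in_der_image (M * C).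
Proof.
move=> [k [X [B [hX ->]]]]; exists k, X, (fun i => B i * C); split=> //.
by rewrite mulr_suml; apply: eq_bigr => i _; rewrite mulrA.
Qed.

Lemma in_der_imageZ c M : in_der_image M -> in_der_image (c *: M).
Proof. by move=> /(in_der_imageMr c%:A); rewrite -scalerAr mulr1. Qed.

Section Idempotent.
Variable e : 'M[K]_m.+1.
Hypotheses (ee : e * e = e) (eW : forall g, e * W g = W g * e).

Let e_dW X : lie V X -> e * dW X = dW X * e.
Proof. by move=> hX; apply: (dmx_comm hV hW). Qed.

Let WVW g : W g^-1%g * W g = 1. Proof. exact: (rrVl hW). Qed.

Let dWc X g : lie V X -> dW (V g * X * (V g)^-1) = W g * dW X * W g^-1%g.
Proof. by move=> hX; apply: (dmx_conj hV hW). Qed.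

(* By the replica trick, the part of the radical of the trace form orthogonal to
   the kernel of e W on the Lie algebra consists of nilpotents. *)
Lemma trace_form_radical X : lie V X -> (forall Y, lie V Y -> \tr (e * dW X * dW Y) = 0) ->
  e * dW X = 0.
Proof.
move=> hX trX; have [l0 lD lZ] := lie_linear V.
have dW0 : dW 0 = 0 by have := dmxZr V 0 0 W; rewrite !scale0r.
pose R := [set X | lie V X /\ forall Y, lie V Y -> \tr (e * dW X * dW Y) = 0].
have [|Rv hR] := @linear_set_vspace _ _ R.
  split=> [|A B [hA tA] [hB tB]|c A [hA tA]]; split.
  - exact: l0.
  - by move=> Y _; rewrite dW0 mulr0 mul0r mxtrace0.
  - exact: lD.
  - by move=> Y hY; rewrite dmxDr mulrDr mulrDl mxtraceD tA ?tB ?addr0.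
  - exact: lZ.
  - by move=> Y hY; rewrite dmxZr -scalerAr -scalerAl mxtraceZ tA ?mulr0.
pose k := [set X | lie V X /\ e * dW X = 0].
have [|Kv hK] := @linear_set_vspace _ _ k.
  split=> [|A B [hA tA] [hB tB]|c A [hA tA]]; split.
  - exact: l0.
  - by rewrite dW0 mulr0.
  - exact: lD.
  - by rewrite dmxDr mulrDr tA tB addr0.
  - exact: lZ.
  - by rewrite dmxZr -scalerAr tA scaler0.
have [|Av hA] := @linear_set_vspace _ _ [set X | R X /\ forall Z, k Z -> \tr (X * Z) = 0].
  split=> [|A B [/hR hA tA] [/hR hB tB]|c A [/hR hA tA]]; split.
  - by apply/hR; rewrite mem0v.
  - by move=> Z _; rewrite mul0r mxtrace0.
  - by apply/hR; apply: rpredD.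
  - by move=> Z hZ; rewrite mulrDl mxtraceD tA ?tB ?addr0.
  - by apply/hR; apply: rpredZ.
  - by move=> Z hZ; rewrite -scalerAl mxtraceZ tA ?mulr0.
have invc g Y : lie V Y -> lie V ((V g)^-1 * Y * V g).
  by move=> hY; have := lie_conj hV g^-1%g hY; rewrite (lgV hV) invrK.
have A0 Y : Y \in Av -> Y = 0.
  apply: hnil Y => Y; first by move=> /hA[[]].
    move=> g /hA[[hY tY] kY]; apply/hA; split.
      split=> [|Z hZ]; first exact: lie_conj.
      have := tY _ (invc g Z hZ); have := dWc g^-1%g hZ; rewrite (lgV hV) invgK invrK => ->.
      move=> <-; rewrite dWc // !mulrA eW -!mulrA [LHS]mxtrace_mulC mulmxE.
      by rewrite -!mulrA.
    move=> Z [hZ eZ].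
    have -> : \tr (V g * Y * (V g)^-1 * Z) = \tr (Y * ((V g)^-1 * Z * V g)).
      by rewrite -!mulrA [LHS]mxtrace_mulC mulmxE -!mulrA.
    apply: kY; split; first exact: invc.
    have := dWc g^-1%g hZ; rewrite (lgV hV) invrK invgK => ->.
    by rewrite !mulrA eW -(mulrA _ e) eZ mulr0 mul0r.
  (* The replica [S] is in the Lie algebra, so the trace of [e * dW Y * dW S] vanishes and [S] is in
     the kernel. Then [tr (Y * S) = 0], and [replica_trace] with the idempotent 1 gives [S = 0]. *)
  move=> /hA[[hY tY] kY]; have [S YS] := replica_exists Y.
  have hS := replica_lie hV YS hY.
  have eS : e * dW S = 0.
    apply: (replica_trace (replica_dmx hV YS hY hW)) => //; first exact: e_dW.
    exact: tY.
  have S0 : S = 0.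
    rewrite -[S]mul1r; apply: (replica_trace YS); rewrite ?mul1r ?mulr1 //.
    by apply: kY.
  by apply: replica0_nilpotent; rewrite -S0.
have KR : (Kv <= Rv)%VS.
  apply/subvP => Y /hK[hY eY]; apply/hR; split=> // Z hZ.
  by rewrite eY mul0r mxtrace0.
(* An element of the radical orthogonal to the kernel is 0, so the radical embeds in the dual of the
   kernel, which it contains. *)
have dimRK : (\dim Rv <= \dim Kv)%N.
  pose M := \matrix_(p < n.+1 * n.+1, i < \dim Kv) (mxvec ((vbasis Kv)`_i)^T) 0 p.
  pose f := linfun (mulmxr M \o mxvec).
  have fE Y i : f Y 0 i = \tr (Y * (vbasis Kv)`_i).
    rewrite lfunE /= -[Y * _]/(Y *m _) mxtrace_mxvec !mxE.
    by apply: eq_bigr => p _; rewrite !mxE.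
  rewrite -(limg_dim_eq (f := f)).
    by apply: leq_trans (dimvS (subvf _)) _; rewrite dimvf /dim /= mul1n.
  apply/eqP; rewrite -subv0; apply/subvP => Y; rewrite memv_cap memv_ker memv0 => /andP[/hR RY /eqP fY].
  apply/eqP; apply: A0; apply/hA; split=> // Z /hK ZK.
  rewrite (coord_vbasis ZK) mulr_sumr raddf_sum big1 // => i _ /=.
  by rewrite -scalerAr mxtraceZ -fE fY mxE mulr0.
have /eqP RK : (Kv == Rv)%VS by rewrite eqEdim KR.
by have /hR : R X by []; rewrite -RK => /hK[].
Qed.

(** The trace form on the space of the [e * dW X] is nondegenerate by [trace_form_radical]. [Om] is
    its Casimir element, whose trace is the dimension of this space, nonzero in characteristic 0. *)
Lemma casimir : (forall X, lie V X -> e * dW X = 0) \/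
  exists Om : 'M[K]_m.+1, [/\ \tr Om != 0, e * Om = Om, Om * e = Om,
    (forall g, Om * W g = W g * Om) /\ in_der_image Om &
    forall w : 'cV_m.+1, (forall X, lie V X -> dW X *m w = 0) -> Om *m w = 0].
Proof.
have [l0 lD lZ] := lie_linear V.
pose L := [set A | exists2 X, lie V X & A = e * dW X].
have [|Lv hL] := @linear_set_vspace _ _ L.
  split=> [|_ _ [X hX ->] [Y hY ->]|c _ [X hX ->]].
  - exists 0 => //; have := dmxZr V 0 0 W; by rewrite !scale0r => ->; rewrite mulr0.
  - by exists (X + Y); rewrite ?dmxDr ?mulrDr //; apply: lD.
  - by exists (c *: X); rewrite ?dmxZr ?scalerAr //; apply: lZ.
have [L0|L0] := eqVneq (\dim Lv) 0%N.
  left=> X hX; have : e * dW X \in Lv by apply/hL; exists X.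
  by have /eqP := L0; rewrite dimv_eq0 => /eqP ->; rewrite memv0 => /eqP.
right; pose r := \dim Lv; pose b (i : 'I_r) := (vbasis Lv)`_i.
have bL i : b i \in Lv by apply: vbasis_mem; rewrite mem_nth ?size_tuple.
have bE i : exists2 X, lie V X & b i = e * dW X by apply/hL.
pose Gm := \matrix_(i, j) \tr (b i * b j).
have GmT : Gm^T = Gm by apply/matrixP => i j; rewrite !mxE mxtrace_mulC.
have Gu : Gm \in unitmx.
  rewrite -row_free_unit -kermx_eq0; apply/rowV0P => u /sub_kermxP uG.
  pose x := \sum_i u 0 i *: b i.
  have xL : x \in Lv by apply: rpred_sum => i _; apply: rpredZ.
  have xb j : \tr (x * b j) = 0.
    have := congr1 (fun M : 'rV_r => M 0 j) uG; rewrite !mxE => h; rewrite -[RHS]h.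
    rewrite mulr_suml raddf_sum; apply: eq_bigr => i _ /=.
    by rewrite -scalerAl mxtraceZ mxE.
  have x0 : x = 0.
    have /hL[X hX xX] := xL; rewrite xX; apply: trace_form_radical => // Y hY.
    have eYL : e * dW Y \in Lv by apply/hL; exists Y.
    have -> : e * dW X * dW Y = x * (e * dW Y).
      by rewrite xX mulrA -(mulrA e (dW X) e) -e_dW // mulrA ee.
    rewrite (coord_vbasis eYL) mulr_sumr raddf_sum big1 // => i _ /=.
    by rewrite -scalerAr mxtraceZ xb mulr0.
  apply/rowP => i; rewrite [RHS]mxE.
  by have := vbasisP Lv => /basis_free/freeP; apply.
pose Gi := invmx Gm.
pose Om := \sum_i \sum_j Gi i j *: (b i * b j).
have eb i : e * b i = b i by have [X hX ->] := bE i; rewrite mulrA ee.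
have be i : b i * e = b i by have [X hX ->] := bE i; rewrite -mulrA -e_dW // mulrA ee.
exists Om; split.
- have -> : \tr Om = r%:R; last by rewrite pnatr_eq0.
  rewrite -(mxtrace1 K r) -(mulVmx Gu) -/Gi /Om raddf_sum; apply: eq_bigr => i _ /=.
  rewrite raddf_sum mxE; apply: eq_bigr => j _ /=.
  by rewrite mxtraceZ !mxE mxtrace_mulC.
- rewrite mulr_sumr; apply: eq_bigr => i _; rewrite mulr_sumr; apply: eq_bigr => j _.
  by rewrite -scalerAr mulrA eb.
- rewrite mulr_suml; apply: eq_bigr => i _; rewrite mulr_suml; apply: eq_bigr => j _.
  by rewrite -scalerAl -mulrA be.
- split; last first.
    apply: (big_ind in_der_image) => [||i _]; [exact: in_der_image0|exact: in_der_imageD|].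
    apply: (big_ind in_der_image) => [||j _]; [exact: in_der_image0|exact: in_der_imageD|].
    apply: in_der_imageZ; apply: in_der_imageMr; have [X hX ->] := bE i; rewrite e_dW //.
    apply: in_der_imageMr; exists 1%N, (fun=> X), (fun=> 1); split=> //.
    by rewrite big_ord1 mulr1.
  move=> g; suff E : W g * Om * W g^-1%g = Om by rewrite -{1}E -mulrA WVW mulr1.
  have conjL i : W g * b i * W g^-1%g \in Lv.
    have [X hX ->] := bE i; apply/hL; exists (V g * X * (V g)^-1); first exact: lie_conj.
    by rewrite dWc // !mulrA eW.
  (* [C] is conjugation by [g] on the basis. It preserves the trace form [Gm], hence the inverse
     form [Gi], hence [Om]. *)
  pose C := \matrix_(i, j) coord (vbasis Lv) j (W g * b i * W g^-1%g).
  have CE i : W g * b i * W g^-1%g = \sum_j C i j *: b j.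
    by rewrite {1}(coord_vbasis (conjL i)); apply: eq_bigr => j _; rewrite mxE.
  have CG : C *m Gm *m C^T = Gm.
    apply/matrixP => i j; transitivity (\tr ((W g * b i * W g^-1%g) * (W g * b j * W g^-1%g))).
      rewrite !CE mulr_suml raddf_sum /=.
      under [RHS]eq_bigr do rewrite mulr_sumr raddf_sum /=.
      rewrite mxE exchange_big /=; apply: eq_bigr => k' _; rewrite mxE mulr_suml.
      by apply: eq_bigr => l' _; rewrite -scalerAl -scalerAr !mxtraceZ !mxE mulrAC mulrA.
    rewrite -!mulrA (mulrA _ (W g)) WVW mul1r [LHS]mxtrace_mulC mulmxE -!mulrA WVW mulr1 mxE.
    by [].
  have Cu : C \in unitmx.
    by have := Gu; rewrite -{1}CG !unitmx_mul => /andP[/andP[]].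
  have CtG : C^T *m Gi *m C = Gi.
    apply: (can_inj (mulmxK Gu)); rewrite mulVmx //.
    have CtU : C^T \in unitmx by rewrite unitmx_tr.
    apply: (can_inj (mulmxK CtU)); rewrite mul1mx -!mulmxA (mulmxA C) CG.
    by rewrite mulVmx // mulmx1.
  have -> : W g * Om * W g^-1%g =
      \sum_i \sum_j Gi i j *: ((W g * b i * W g^-1%g) * (W g * b j * W g^-1%g)).
    rewrite /Om mulr_sumr mulr_suml; apply: eq_bigr => i _.
    rewrite mulr_sumr mulr_suml; apply: eq_bigr => j _.
    by rewrite -scalerAr -scalerAl -!mulrA (mulrA _ (W g)) WVW mul1r.
  rewrite [in RHS]/Om -[in RHS]CtG.
  have -> : \sum_i \sum_j Gi i j *: (W g * b i * W g^-1%g * (W g * b j * W g^-1%g)) =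
      \sum_i \sum_j \sum_k \sum_l (C i k * Gi i j * C j l) *: (b k * b l).
    apply: eq_bigr => i _; apply: eq_bigr => j _; rewrite !CE mulr_suml scaler_sumr.
    apply: eq_bigr => k _; rewrite mulr_sumr scaler_sumr; apply: eq_bigr => l _.
    by rewrite -scalerAl -scalerAr !scalerA [Gi i j * _]mulrC.
  have -> : \sum_i \sum_j (C^T *m Gi *m C) i j *: (b i * b j) =
      \sum_k \sum_l \sum_j \sum_i (C i k * Gi i j * C j l) *: (b k * b l).
    apply: eq_bigr => k _; apply: eq_bigr => l _; rewrite mxE scaler_suml.
    apply: eq_bigr => j _; rewrite mxE mulr_suml scaler_suml; apply: eq_bigr => i _.
    by rewrite mxE.
  pose F i j k l := (C i k * Gi i j * C j l) *: (b k * b l).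
  rewrite (eq_bigr (fun i => \sum_k \sum_j \sum_l F i j k l)) => [|i _]; last exact: exchange_big.
  rewrite exchange_big; apply: eq_bigr => k _ /=.
  rewrite (eq_bigr (fun i => \sum_l \sum_j F i j k l)) => [|i _]; last exact: exchange_big.
  by rewrite exchange_big; apply: eq_bigr => l _ /=; exact: exchange_big.
- move=> w hw; have bw i : b i *m w = 0.
    by have [X hX ->] := bE i; rewrite -[_ * _]/(e *m dW X) -mulmxA hw ?mulmx0.
  rewrite mulmx_suml big1 // => i _; rewrite mulmx_suml big1 // => j _.
  by rewrite -scalemxAl -[b i * b j]/(b i *m b j) -mulmxA bw mulmx0 scaler0.
Qed.

End Idempotent.
End Casimir.

Section InvariantProjection.
Variables (K : numClosedFieldType) (G : groupType) (n : nat) (V : G -> 'M[K]_n.+1).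
Hypotheses (hV : linear_group V) (hconn : zariski_connected (fun g => mxvec (V g)) setT).
Hypothesis hnil : forall U : {vspace 'M[K]_n.+1}, (forall X, X \in U -> lie V X) ->
  (forall X g, X \in U -> V g * X * (V g)^-1 \in U) ->
  (forall X, X \in U -> exists m, X ^+ m = 0) -> forall X, X \in U -> X = 0.
Variables (m : nat) (W : G -> 'M[K]_m.+1).
Hypothesis hW : rational_rep V W.
Notation dW X := (dmx V X W).

(** [u] collects the eigenprojections of the Casimir element for nonzero eigenvalues; it is nonzero
    because a nilpotent matrix has trace 0. *)
Lemma casimir_idempotent (e : 'M[K]_m.+1) : e * e = e -> (forall g, e * W g = W g * e) ->
  (forall X, lie V X -> e * dW X = 0) \/
  exists u : 'M[K]_m.+1, [/\ u != 0, (e * u = u /\ u * e = u) /\ u * u = u,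
    forall g, u * W g = W g * u, in_der_image V W u &
    forall w : 'cV_m.+1, (forall X, lie V X -> dW X *m w = 0) -> u *m w = 0].
Proof.
move=> ee eW; have [|[Om [tOm eOm Ome [OmW OmD] Omw]]] := casimir hV hnil hW ee eW; first by left.
right; have [s [P [N [us P1 PN Pq]]]] := spectral_projections Om.
pose u := \sum_(l <- s | l != 0) P l; exists u.
have PW l g : P l * W g = W g * P l.
  by have [q ->] := Pq l; apply: comm_horner_mx; exact: OmW.
have Pe l : P l * e = e * P l.
  by have [q ->] := Pq l; apply: comm_horner_mx; rewrite /comm_mx !mulmxE eOm Ome.
have Pe1 l : l \in s -> l != 0 -> e * P l = P l.
  move=> ls l0; apply/eqP; rewrite eq_sym -subr_eq0 -{1}[P l]mul1r -mulrBl; apply/eqP.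
  have h k : (1 - e) * ((Om - l%:M) ^+ k * P l) = (- l) ^+ k *: ((1 - e) * P l).
    elim: k => [|k IH]; first by rewrite !expr0 mul1r scale1r.
    have E : (1 - e) * (Om - l%:M) = - l *: (1 - e).
      rewrite mulrBr [(1 - e) * Om]mulrBl mul1r eOm subrr sub0r.
      by rewrite -[_ * l%:M]/(_ *m l%:M) mul_mx_scalar scaleNr.
    by rewrite exprS -(mulrA (Om - _)) (mulrA (1 - e)) E -scalerAl IH scalerA -exprS.
  have := h N; rewrite PN // mulr0 => /esym/eqP.
  by rewrite scaler_eq0 expf_eq0 oppr_eq0 (negbTE l0) andbF /= => /eqP.
(* Modulo the image of the Lie algebra [Om] is 0, so [(Om - l)^N P_l = 0] reads
   [(- l)^N P_l = 0]. *)
have DP l : l \in s -> l != 0 -> in_der_image V W (P l).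
  move=> ls l0.
  have h k : in_der_image V W ((Om - l%:M) ^+ k * P l - (- l) ^+ k *: P l).
    elim: k => [|k IH]; first by rewrite !expr0 mul1r scale1r subrr; apply: in_der_image0.
    rewrite !exprS -mulrA; set A := _ ^+ k * P l in IH *.
    have -> : (Om - l%:M) * A - (- l * (- l) ^+ k) *: P l =
        Om * A + (- l) *: (A - (- l) ^+ k *: P l).
      rewrite mulrBl scalerBr scalerA addrA; congr (_ + _ - _).
      by rewrite scaleNr; congr (- _); rewrite -[_ * A]/(_ *m A) mul_scalar_mx.
    by apply: in_der_imageD; [exact: in_der_imageMr|exact: in_der_imageZ].
  have := in_der_imageZ (- (- l) ^- N) (h N).
  rewrite PN // sub0r scalerN scaleNr opprK scalerA mulVf ?scale1r //.
  by rewrite expf_eq0 oppr_eq0 (negbTE l0) andbF.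
have uu : u * u = u.
  rewrite /u mulr_sumr big_seq_cond [RHS]big_seq_cond; apply: eq_bigr => l /andP[ls l0].
  rewrite -[RHS]mul1r -P1 !mulr_suml [RHS](bigID (fun k => k != 0)) /=.
  rewrite [X in _ = _ + X]big_seq_cond [X in _ = _ + X]big1 ?addr0 // => k /andP[ks].
  rewrite negbK => /eqP k0; apply: (spectral_orth PN Pq) => //.
  by rewrite k0 eq_sym.
split.
- apply: contra_neq tOm => u0.
  suff OmN : Om ^+ N = 0.
    apply: (@mxtrace_nilpotent _ _ _ N).
    have -> // : iter N (mulmx Om) 1%:M = Om ^+ N.
    by elim: (N) => [//|k IHk]; rewrite iterS IHk exprS.
  rewrite -[LHS]mulr1 -P1 (bigID (fun l => l != 0)) /= -/u u0 add0r mulr_sumr.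
  rewrite big_seq_cond big1 // => l /andP[ls]; rewrite negbK => /eqP l0.
  by have := PN _ ls; rewrite l0 raddf0 subr0.
- split=> //; split; rewrite /u ?mulr_sumr ?mulr_suml big_seq_cond [RHS]big_seq_cond.
    by apply: eq_bigr => l /andP[ls l0]; apply: Pe1.
  by apply: eq_bigr => l /andP[ls l0]; rewrite Pe; apply: Pe1.
- move=> g; rewrite mulr_suml mulr_sumr; apply: eq_bigr => l _; exact: PW.
- rewrite /u big_seq_cond; apply: (big_ind (in_der_image V W)) => [||l /andP[ls l0]].
  + exact: in_der_image0.
  + exact: in_der_imageD.
  + exact: DP.
- move=> w hw; rewrite mulmx_suml big_seq_cond big1 // => l /andP[ls l0].
  apply: (@spectral_kill _ _ Om P N 0 l 1 w (PN _ ls) (Pq _) l0).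
  by rewrite /opn /= scale0r subr0 Omw.
Qed.

(** From [e = 1], Casimir idempotents are subtracted, each lowering the rank, until [e * dW X = 0]
    throughout. Then [e * W g] has zero derivative and connectedness makes it constant. *)
Theorem invariant_projection : exists e : 'M[K]_m.+1, [/\ forall g, e * W g = e /\ W g * e = e,
  in_der_image V W (1 - e) &
  forall w : 'cV_m.+1, (forall X, lie V X -> dW X *m w = 0) -> e *m w = w].
Proof.
suff main k (e : 'M[K]_m.+1) : (\rank e < k)%N -> e * e = e -> (forall g, e * W g = W g * e) ->
    in_der_image V W (1 - e) ->
    (forall w : 'cV_m.+1, (forall X, lie V X -> dW X *m w = 0) -> e *m w = w) ->
    exists e : 'M[K]_m.+1, [/\ forall g, e * W g = e /\ W g * e = e, in_der_image V W (1 - e) &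
    forall w : 'cV_m.+1, (forall X, lie V X -> dW X *m w = 0) -> e *m w = w].
  apply: (main m.+2 1) => //.
  - by rewrite ltnS rank_leq_row.
  - by rewrite mulr1.
  - by move=> g; rewrite mul1r mulr1.
  - by rewrite subrr; apply: in_der_image0.
  - by move=> w _; rewrite mul1mx.
elim: k e => [//|k IH] e rk ee eW eD ew.
have [e0|[u [u0 [[eu ue] uu] uW uD uw]]] := casimir_idempotent ee eW.
  exists e; split=> // g; suff E : e * W g = e by rewrite -eW E.
  apply/matrixP => i j.
  have := @der_eq0_const _ _ _ _ hV hconn (fun g => (e *m W g *m 1%:M) i j) _ _ g.
  rewrite (rr1 hW) !mulmx1; apply.
    apply: polymx_mul; last exact: polymx_cst.
    by apply: polymx_mul; [exact: polymx_cst|exact: (rr_poly hW)].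
  move=> X hX h; rewrite (dmx_left hV hW) // mulmx1.
  by rewrite -[e *m W h]/(e * W h) eW mulmxE -mulrA e0 // mulr0 mxE.
apply: (IH (e - u)).
- rewrite -ltnS; apply: leq_trans rk; rewrite ltnS.
  have sub : ((e - u)%R <= e)%MS.
    by apply/submxP; exists (e - u); rewrite mulmxE mulrBl ee ue.
  rewrite ltn_neqAle mxrankS // andbT; apply: contra u0 => /eqP req.
  have : (e <= (e - u)%R)%MS by rewrite -(geq_leqif (mxrank_leqif_sup sub)) req.
  move=> /submxP[D hD].
  by rewrite -eu [X in X * u]hD mulmxE -mulrA mulrBl eu uu subrr mulr0.
- by rewrite mulrBl !mulrBr ee eu ue uu subrr subr0.
- by move=> g; rewrite mulrBl mulrBr eW uW.
- by rewrite opprB addrA addrAC addrC; apply: in_der_imageD.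
- by move=> w hw; rewrite mulmxBl ew // uw // subr0.
Qed.

End InvariantProjection.

(** * The Haar functional *)

Section Haar.
Variables (K : numClosedFieldType) (G : groupType) (n : nat) (V : G -> 'M[K]_n.+1).
Hypotheses (hV : linear_group V).
Notation reg := (reg V).

Lemma reg_split f : reg f -> exists r (a b : 'I_r -> G -> K),
  [/\ forall k, reg (a k), forall k, reg (b k) &
    forall g h, f (g * h)%g = \sum_k a k g * b k h].
Proof.
apply: mul_split_of => i; case/mxvec_indexP: i => i j.
apply: polyf_ext (_ : polyf _ (fun xy : G * G => (V xy.1 *m V xy.2) i j)) => [xy|].
  by rewrite mxvecE (lgM hV).
apply: polymx_mul => k l.
  apply: polyf_ext (polyf_coord _ (lshift _ (mxvec_index k l))) => xy.
  by rewrite row_mxEl mxvecE.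
apply: polyf_ext (polyf_coord _ (rshift _ (mxvec_index k l))) => xy.
by rewrite row_mxEr mxvecE.
Qed.

Lemma rep_of_family s (f : G -> 'rV[K]_s) : polymx (fun g => mxvec (V g)) f ->
  exists r (a : G -> 'rV_r.+1) (W : G -> 'M_r.+1) (B : 'M_(r.+1, s)),
  [/\ rational_rep V W, forall g h, a (g * h)%g = a g *m W h,
    (forall u : 'cV_r.+1, (forall g, a g *m u = 0) -> u = 0) & forall g, f g = a g *m B].
Proof.
move=> hf; pose f1 g : 'rV_(1 + s) := row_mx 1%:M (f g).
have pf1 : polymx (fun g => mxvec (V g)) f1.
  move=> i j; rewrite /f1; case: (split_ordP j) => k ->.
    by apply: polyf_ext (polyf_cst _ (1%:M i k)) => g; rewrite row_mxEl.
  by apply: polyf_ext (hf i k) => g; rewrite row_mxEr.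
have [r [a [W [B [pa pW inda fa [aW W1 WM]]]]]] := local_finite reg_split pf1.
case: r a W B pa pW inda fa aW W1 WM => [|r] a W B pa pW inda fa aW W1 WM.
  have := fa 1%g; rewrite [a 1%g]thinmx0 mul0mx => /rowP/(_ (lshift _ 0))/eqP.
  by rewrite row_mxEl !mxE oner_eq0.
exists r, a, W, (rsubmx B); split=> // g.
by rewrite mulmx_rsub -fa row_mxKr.
Qed.

Lemma rep_left r (a : G -> 'rV[K]_r.+1) (W : G -> 'M_r.+1) X (b : 'cV_r.+1) g :
  rational_rep V W -> (forall g h, a (g * h)%g = a g *m W h) -> lie V X ->
  dleft V X (fun h => (a h *m b) 0 0) g = (a g *m dmx V X W *m b) 0 0.
Proof.
move=> hW aW hX; have := dmx_left hV hW (a 1%g) b 0 0 g hX.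
rewrite -aW mul1g => <-; congr dleft; apply: funext => h.
by rewrite -aW mul1g.
Qed.

(** Sums of derivatives along left-invariant fields: the future kernel of the mean value. *)
Definition dspan (f : G -> K) := exists k (X : 'I_k -> 'M[K]_n.+1) (h : 'I_k -> G -> K),
  [/\ forall i, lie V (X i), forall i, reg (h i) & forall g, f g = \sum_i dleft V (X i) (h i) g].

Lemma dspanD f1 f2 : dspan f1 -> dspan f2 -> dspan (fun g => f1 g + f2 g).
Proof.
move=> [k [X [h [hX rh E]]]] [l [Y [h' [hY rh' E']]]].
exists (k + l)%N, (fun i => match split i with inl j => X j | inr j => Y j end),
  (fun i => match split i with inl j => h j | inr j => h' j end).
split=> [i|i|g]; try by case: split.
rewrite E E' big_split_ord /=; congr (_ + _); apply: eq_bigr => i _.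
  by rewrite (unsplitK (inl i : 'I_k + 'I_l)).
by rewrite (unsplitK (inr i : 'I_k + 'I_l)).
Qed.

Lemma dspanZ c f : dspan f -> dspan (fun g => c * f g).
Proof.
move=> [k [X [h [hX rh E]]]]; exists k, X, (fun i g => c * h i g); split=> // [i|g].
  exact/polyfZ/rh.
rewrite E mulr_sumr; apply: eq_bigr => i _; rewrite /dleft der1Z //.
exact/reg_mulx/rh.
Qed.

Lemma dspan_ext f1 f2 : f1 =1 f2 -> dspan f1 -> dspan f2.
Proof. by move=> /funext ->. Qed.

Lemma dspan_mulx x f : dspan f -> dspan (fun g => f (x * g)%g).
Proof.
move=> [k [X [h [hX rh E]]]]; exists k, X, (fun i g => h i (x * g)%g); split=> // [i|g].
  exact/reg_mulx/rh.
rewrite E; apply: eq_bigr => i _; rewrite /dleft; congr der1.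
by apply: funext => y; rewrite mulgA.
Qed.

(** Right translation does not commute with a left-invariant field; it conjugates its direction by
    [V x]. *)
Lemma dspan_mulxr x f : dspan f -> dspan (fun g => f (g * x)%g).
Proof.
move=> [k [X [h [hX rh E]]]].
exists k, (fun i => V x * X i * (V x)^-1), (fun i g => h i (g * x)%g); split=> [i|i|g].
- exact: lie_conj.
- exact/reg_mulxr/rh.
rewrite E; apply: eq_bigr => i _; rewrite /dleft der1_conj //.
  congr der1; apply: funext => y.
  by rewrite -!mulgA mulVg mulg1.
by apply: (@reg_mulx _ _ _ _ hV g (fun y => h i (y * x)%g)); apply/reg_mulxr/rh.
Qed.

Hypothesis hconn : zariski_connected (fun g => mxvec (V g)) setT.
Hypothesis hnil : forall U : {vspace 'M[K]_n.+1}, (forall X, X \in U -> lie V X) ->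
  (forall X g, X \in U -> V g * X * (V g)^-1 \in U) ->
  (forall X, X \in U -> exists m, X ^+ m = 0) -> forall X, X \in U -> X = 0.

(** In a representation carrying [f], the part through the invariant projection is constant, and the
    part through [1 - e] is a sum of derivatives. *)
Lemma dspan_exists f : reg f -> exists c, dspan (fun g => f g - c).
Proof.
move=> rf; have [|r [a [W [B [hW aW _ fa]]]]] := @rep_of_family 1 (fun g => (f g)%:M).
  by move=> i j; apply: polyf_ext rf => g; rewrite !ord1 mxE eqxx.
have [e [eW [k [X [C [hX eC]]]] _]] := invariant_projection hV hconn hnil hW.
exists ((a 1%g *m e *m B) 0 0), k, X, (fun i g => (a g *m (C i *m B)) 0 0); split=> // [i|g].
  apply: (polymx_mul _ (polymx_cst _ _)) => j l.
  apply: polyf_ext (_ : polyf _ (fun g => (a 1%g *m W g) j l)) => [g|].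
    by rewrite -aW mul1g.
  by apply: polymx_mul; [exact: polymx_cst|exact: (rr_poly hW)].
have -> : f g = (a g *m B) 0 0 by rewrite -fa mxE eqxx.
have -> : a 1%g *m e *m B = a g *m e *m B.
  by have [_ {1}<-] := eW g; rewrite -[W g * e]/(W g *m e) mulmxA -aW mul1g.
transitivity ((a g *m (1 - e) *m B) 0 0); first by rewrite mulmxBr mulmx1 mulmxBl !mxE.
rewrite eC mulmx_sumr mulmx_suml summxE; apply: eq_bigr => i _.
by rewrite (rep_left _ _ hW aW (hX i)) !mulmxA.
Qed.

(** The sum of derivatives is [a g *m u] with [u] in the image of the Lie algebra, so [e *m u = 0].
    Being constant, it forces the Lie algebra to annihilate [u], so [e *m u = u]. *)
Lemma dspan_cst c : dspan (fun=> c) -> c = 0.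
Proof.
move=> [k [X [h [hX rh E]]]].
have [|r [a [W [B [hW aW inda ha]]]]] := @rep_of_family k (fun g => \row_i h i g).
  by move=> i j; apply: polyf_ext (rh j) => g; rewrite mxE.
have [e [eW _ eu]] := invariant_projection hV hconn hnil hW.
pose u := \sum_i dmx V (X i) W *m col i B.
have cu g : c = (a g *m u) 0 0.
  rewrite (E g) mulmx_sumr summxE; apply: eq_bigr => i _.
  rewrite mulmxA -(rep_left _ _ hW aW (hX i)); congr dleft; apply: funext => x.
  by rewrite colE mulmxA -ha -colE !mxE.
have e0 : e *m u = 0.
  rewrite mulmx_sumr big1 // => i _; rewrite mulmxA.
  have := dmx_mul hV (hX i) e 1%:M (rr_poly hW); rewrite mulmx1 => <-.
  rewrite (_ : (fun g => _) = fun=> e) ?dmx_cst ?mul0mx //.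
  by apply: funext => g; rewrite mulmx1; have [] := eW g.
have u0 : u = 0.
  rewrite -e0 eu // => Y hY; apply: inda => g; apply/rowP => j; rewrite !ord1 mulmxA.
  rewrite -(rep_left _ _ hW aW hY) mxE -(der1_cst hY c); rewrite /dleft.
  by congr der1; apply: funext => x; rewrite -cu.
by rewrite (cu 1%g) u0 mulmx0 mxE.
Qed.

(** [H f] is the only constant [c] for which [f - c] is a sum of derivatives; both invariances hold
    because [dspan] is stable under left and right translations. *)
Theorem haar_functional : exists H : (G -> K) -> K,
  [/\ forall c, H (fun=> c) = c,
      forall f1 f2, reg f1 -> reg f2 -> H (fun g => f1 g + f2 g) = H f1 + H f2,
      forall c f, reg f -> H (fun g => c * f g) = c * H f,
      forall x f, reg f -> H (fun g => f (x * g)%g) = H f &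
      forall x f, reg f -> H (fun g => f (g * x)%g) = H f].
Proof.
pose H f := xget 0 [set c | dspan (fun g => f g - c)].
have uniq f c c' : dspan (fun g => f g - c) -> dspan (fun g => f g - c') -> c = c'.
  move=> h /(dspanZ (-1)) h'; have := dspanD h h' => hh.
  apply/esym/eqP; rewrite -subr_eq0; apply/eqP; apply: dspan_cst.
  by apply: dspan_ext hh => g; rewrite mulN1r opprB addrC addrA subrK.
have HP f : reg f -> dspan (fun g => f g - H f).
  move=> /dspan_exists[c hc].
  exact: (xgetI 0 (hc : [set c | dspan (fun g => f g - c)] c)).
have HE f c : reg f -> dspan (fun g => f g - c) -> H f = c.
  by move=> rf; apply: uniq; apply: HP.
exists H; split=> [c|f1 f2 r1 r2|c f rf|x f rf|x f rf]; apply: HE.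
- exact: polyf_cst.
- by exists 0%N, (fun=> 0), (fun _ _ => 0); split=> [[]|[]|g] //; rewrite subrr big_ord0.
- exact: polyfD.
- by apply: dspan_ext (dspanD (HP _ r1) (HP _ r2)) => g; rewrite opprD addrACA.
- exact: polyfZ.
- by apply: dspan_ext (dspanZ c (HP _ rf)) => g; rewrite mulrBr.
- exact: reg_mulx.
- exact: (dspan_mulx x (HP _ rf)).
- exact: reg_mulxr.
- exact: (dspan_mulxr x (HP _ rf)).
Qed.

End Haar.

(** * Closed orbits *)

Lemma polymx_fst (K : fieldType) (T U : Type) M N (c : T -> 'rV[K]_M) (d : U -> 'rV[K]_N) :
  polymx (fun xy : T * U => row_mx (c xy.1) (d xy.2)) (fun xy => c xy.1).
Proof.
move=> i j; rewrite ord1; apply: polyf_ext (polyf_coord _ (lshift _ j)) => xy.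
by rewrite row_mxEl.
Qed.

Lemma polymx_snd (K : fieldType) (T U : Type) M N (c : T -> 'rV[K]_M) (d : U -> 'rV[K]_N) :
  polymx (fun xy : T * U => row_mx (c xy.1) (d xy.2)) (fun xy => d xy.2).
Proof.
move=> i j; rewrite ord1; apply: polyf_ext (polyf_coord _ (rshift _ j)) => xy.
by rewrite row_mxEr.
Qed.

Lemma polymxZ (K : fieldType) (T : Type) N (c : T -> 'rV[K]_N) m n (a : T -> K)
    (A : T -> 'M_(m, n)) : polyf c a -> polymx c A -> polymx c (fun x => a x *: A x).
Proof.
by move=> ha hA i j; apply: polyf_ext (polyfM ha (hA i j)) => x; rewrite [RHS]mxE.
Qed.

Lemma linear_set_rows (K : fieldType) m (S : set 'rV[K]_m) : linear_set S ->
  exists p (M : 'M_(p, m)), forall x, S x <-> exists y, x = y *m M.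
Proof.
move=> /linear_set_vspace[U hU]; pose B := vbasis U.
exists (\dim U), (\matrix_i B`_i) => x; split=> [/hU Ux|[y ->]].
  exists (\row_i coord B i x); rewrite [LHS](coord_vbasis Ux); apply/rowP => j.
  by rewrite summxE mxE; apply: eq_bigr => i _; rewrite !mxE.
apply/hU; rewrite mulmx_sum_row; apply: memv_suml => i _; rewrite rowK.
by apply: memvZ; apply: vbasis_mem; rewrite mem_nth ?size_tuple.
Qed.

(** By hypothesis [M *m N] has the left kernel of [M], hence the column space of [M]. *)
Lemma nondegenerate_pairing (K : fieldType) m p q (M : 'M[K]_(p, m)) (N : 'M_(m, q)) (c : 'cV_m) :
  (forall x : 'rV_p, x *m M *m N = 0 -> x *m M = 0) -> exists y : 'cV_q, M *m c = M *m (N *m y).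
Proof.
move=> h; suff /submxP[y hy] : ((M *m c)^T <= (M *m N)^T)%MS.
  by exists y^T; rewrite mulmxA; apply: trmx_inj; rewrite hy [RHS]trmx_mul trmxK.
rewrite submxE; set X := cokermx _; have hX : X^T *m M = 0.
  apply/row_matrixP => i; rewrite row0 row_mul; apply: h.
  by rewrite -mulmxA -row_mul -[M *m N]trmxK -trmx_mul mulmx_coker trmx0 row0.
by apply/eqP; apply: trmx_inj; rewrite trmx_mul trmxK mulmxA hX mul0mx trmx0.
Qed.

Section ClosedOrbit.
Variables (K : numClosedFieldType) (G : groupType) (n : nat) (V : G -> 'M[K]_n.+1).
Hypotheses (hV : linear_group V) (uncK : big_fibre K).
Notation reg := (reg V).
Notation ev p A := (p.@[mxvec A 0]).
Notation P := {mpoly K[(n.+1 * n.+1)]}.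

Variable H : (G -> K) -> K.
Hypotheses (H1 : forall c, H (fun=> c) = c)
  (HD : forall f1 f2, reg f1 -> reg f2 -> H (fun g => f1 g + f2 g) = H f1 + H f2)
  (HZ : forall c f, reg f -> H (fun g => c * f g) = c * H f)
  (HL : forall x f, reg f -> H (fun g => f (x * g)%g) = H f)
  (HR : forall x f, reg f -> H (fun g => f (g * x)%g) = H f).

Lemma haar_sum r (F : 'I_r -> G -> K) : (forall i, reg (F i)) ->
  H (fun g => \sum_i F i g) = \sum_i H (F i).
Proof.
elim: r F => [|r IH] F hF.
  by rewrite big_ord0 -[RHS]H1; congr H; apply: funext => g; rewrite big_ord0.
rewrite big_ord_recl -IH => [|i]; last exact: hF.
rewrite -HD; [|exact: hF|by apply: polyf_sum => i; apply: hF].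
by congr H; apply: funext => g; rewrite big_ord_recl.
Qed.

Lemma haar_polyf (T : Type) N (c : T -> 'rV[K]_N) f :
  polyf (fun xy : G * T => row_mx (mxvec (V xy.1)) (c xy.2)) f ->
  polyf c (fun t => H (fun g => f (g, t))).
Proof.
move=> /(polyf_split (c := fun g => mxvec (V g)))[r [a [b [ha hb E]]]].
apply: polyf_ext (_ : polyf c (fun t => \sum_k H (a k) * b k t)) => [t|].
  rewrite (_ : (fun g => _) = fun g => \sum_k b k t * a k g).
    rewrite haar_sum => [|k]; last exact/polyfZ/ha.
    by apply: eq_bigr => k _; rewrite HZ 1?mulrC //; apply: ha.
  by apply: funext => g; rewrite E; apply: eq_bigr => k _; rewrite mulrC.
by apply: polyf_sum => k; apply: polyfZ.
Qed.

Lemma reg_inv f : reg f -> reg (fun g => f g^-1%g).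
Proof. by apply: polyf_precomp; apply/polymx_mxvec; exact: (lg_inv hV). Qed.

Definition haarmx m p (f : G -> 'M[K]_(m, p)) := \matrix_(i, j) H (fun g => f g i j).

Lemma haarmx_mul m p q r (A : 'M_(m, p)) (f : G -> 'M_(p, q)) (B : 'M_(q, r)) :
  polymx (fun g => mxvec (V g)) f -> haarmx (fun g => A *m f g *m B) = A *m haarmx f *m B.
Proof.
move=> hf; apply/matrixP => i j; rewrite !mxE.
rewrite (_ : (fun g => _) = fun g => \sum_k \sum_l B k j * A i l * f g l k).
  rewrite haar_sum => [|k]; last by apply: polyf_sum => l; apply/polyfZ/hf.
  apply: eq_bigr => k _; rewrite haar_sum => [|l]; last by apply/polyfZ/hf.
  rewrite mxE mulr_suml; apply: eq_bigr => l _.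
  rewrite HZ; last exact: hf.
  by rewrite [haarmx _ _ _]mxE mulrAC mulrC [X in _ * X]mulrC mulrA.
apply: funext => g; rewrite mxE; apply: eq_bigr => k _; rewrite mxE mulr_suml.
by apply: eq_bigr => l _; rewrite [LHS]mulrC mulrA.
Qed.

Variables (d k : nat) (C : G -> 'M[K]_d) (b0 : 'M[K]_(d, k)).
Hypothesis hC : rational_rep V C.
Let orb g := C g *m b0.
Let orbc g := mxvec (orb g).
Hypothesis orb_closed : forall b : 'M[K]_(d, k),
  (forall p : {mpoly K[(d * k)]}, (forall g, p.@[orbc g 0] = 0) -> p.@[mxvec b 0] = 0) ->
  exists g, b = orb g.
Notation A0 := (polyf orbc).

Lemma orbc_poly : polymx (fun g => mxvec (V g)) orbc.
Proof. by apply/polymx_mxvec/polymx_mul; [exact: (rr_poly hC)|exact: polymx_cst]. Qed.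

Lemma A0_reg f : A0 f -> reg f.
Proof. exact: polyf_trans orbc_poly. Qed.

Lemma orbM x g : orb (x * g)%g = C x *m orb g.
Proof. by rewrite /orb (rrM hC) mulmxA. Qed.

Lemma A0_mulx x f : A0 f -> A0 (fun g => f (x * g)%g).
Proof.
apply: polyf_precomp; apply/polymx_mxvec => i j.
apply: polyf_ext (_ : A0 (fun g => (C x *m orb g) i j)) => [g|]; first by rewrite orbM.
by apply: polymx_mul; [exact: polymx_cst|exact: polymx_coord].
Qed.

(** Because the orbit is closed, a point of affine space off the orbit is excluded by some relation
    of the orbit, and a point on it by some element of [S]; the Nullstellensatz applies. *)
Lemma A0_unit_ideal (S : set (G -> K)) : S (fun=> 0) ->
  (forall f h, S f -> S h -> S (fun g => f g + h g)) ->
  (forall a f, A0 a -> S f -> S (fun g => a g * f g)) ->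
  (forall f, S f -> A0 f) -> (forall g, exists2 f, S f & f g != 0) -> S (fun=> 1).
Proof.
move=> S0 SD SM SA Snz; pose I := [set p | S (fun g => p.@[orbc g 0])].
suff : I 1 by rewrite /I /=; congr S; apply: funext => g; rewrite meval1.
apply: (nullstellensatz1 uncK) => [|a].
  split=> [|p q hp hq|p q hq]; rewrite /I /=.
  - by move: S0; congr S; apply: funext => g; rewrite meval0.
  - by move: (SD _ _ hp hq); congr S; apply: funext => g; rewrite mevalD.
  - have hp : A0 (fun g => p.@[orbc g 0]) by exists p.
    by move: (SM _ _ hp hq); congr S; apply: funext => g; rewrite mevalM.
pose b : 'M_(d, k) := vec_mx (\row_i a i).
have ab (p : {mpoly K[(d * k)]}) : p.@[a] = p.@[mxvec b 0].
  by apply: meval_eq => i; rewrite vec_mxK mxE.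
have [/orb_closed[g bg]|/existsNP[p /not_implyP[hp pb]]] :=
    pselect (forall p : {mpoly K[(d * k)]}, (forall g, p.@[orbc g 0] = 0) -> p.@[mxvec b 0] = 0).
  have [f Sf fg] := Snz g; have [p hp] := SA f Sf.
  exists p; last by rewrite ab bg -[mxvec _]/(orbc g) -hp.
  by move: Sf; rewrite /I /=; congr S; apply: funext.
exists p; last by rewrite ab; apply/eqP.
by move: S0; rewrite /I /=; congr S; apply: funext => g; rewrite hp.
Qed.

(** The value [a (g * h)] is polynomial in the entries of [V g] and the orbit coordinates of [h];
    averaging over [g] keeps the latter dependence. *)
Lemma haar_A0 a f : A0 a -> reg f -> A0 (fun h => H (fun g => a (g * h)%g * f g)).
Proof.
move=> ha hf; apply: (haar_polyf (f := fun xy => a (xy.1 * xy.2)%g * f xy.1)).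
have p1 := @polymx_fst _ _ _ _ _ (fun g => mxvec (V g)) orbc.
have p2 := @polymx_snd _ _ _ _ _ (fun g => mxvec (V g)) orbc.
apply: polyfM; last exact: (polyf_precomp (u := fst) p1 hf).
apply: (polyf_precomp (u := fun xy => (xy.1 * xy.2)%g) _ ha); apply/polymx_mxvec => i j.
apply: polyf_ext (_ : polyf _ (fun xy : G * G => (C xy.1 *m orb xy.2) i j)) => [xy|].
  by rewrite orbM.
apply: polymx_mul => i' j'.
  exact: (polyf_precomp (u := fst) p1 (rr_poly hC i' j')).
exact: (polyf_precomp (u := snd) p2 (polymx_coord _ i' j')).
Qed.

Definition perp f := forall a, A0 a -> H (fun g => f g * a g) = 0.

Lemma perpM a f : A0 a -> perp f -> perp (fun g => a g * f g).
Proof.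
move=> ha hf a' ha'; rewrite -(hf _ (polyfM ha ha')); congr H; apply: funext => g.
by rewrite mulrAC mulrC.
Qed.

Lemma perpD f1 f2 : reg f1 -> reg f2 -> perp f1 -> perp f2 -> perp (fun g => f1 g + f2 g).
Proof.
move=> r1 r2 h1 h2 a ha; have ra := A0_reg ha.
rewrite -[RHS]addr0 -[X in X + _](h1 a ha) -[X in _ + X](h2 a ha) -HD; try exact: polyfM.
by congr H; apply: funext => g; rewrite mulrDl.
Qed.

Lemma perp_mulx x f : reg f -> perp f -> perp (fun g => f (x * g)%g).
Proof.
move=> rf hf a ha; have ha' := A0_mulx x^-1%g ha.
rewrite -(hf _ ha') -[RHS](HL x); last by apply: polyfM => //; apply: A0_reg.
by congr H; apply: funext => g; rewrite mulKg.
Qed.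

(** [A0] meets [perp] in an ideal of [A0] stable under left translation. If nonzero, it has no zero
    on the group and contains 1, although [H 1 = 1]. *)
Lemma A0_perp0 f : A0 f -> perp f -> f =1 fun=> 0.
Proof.
move=> Af pf x; apply/eqP; apply: contrapT => /negP fx.
pose S := [set h | A0 h /\ perp h].
suff [_ /(_ (fun=> 1))] : S (fun=> 1).
  rewrite (_ : (fun g => _) = fun=> 1) ?H1; last by apply: funext => g; rewrite mulr1.
  by move=> /(_ (polyf_cst _ _))/eqP; rewrite oner_eq0.
apply: A0_unit_ideal => [|h1 h2 [A1 p1] [A2 p2]|a h Aa [Ah ph]|h []//|g].
- split=> [|a ha]; first exact: polyf_cst.
  by rewrite (_ : (fun g => _) = fun=> 0) ?H1 //; apply: funext => g; rewrite mul0r.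
- by split; [exact: polyfD|apply: perpD => //; apply: A0_reg].
- by split; [exact: polyfM|exact: perpM].
- exists (fun h => f (x * g^-1 * h)%g); last by rewrite -mulgA mulVg mulg1.
  by split; [exact: A0_mulx|apply: perp_mulx => //; exact: A0_reg].
Qed.


(** Orthogonal projection onto [A0], carried out in a finite-dimensional representation [W]
    containing [f]. [E] and [E'] are the vectors and covectors whose orbits have entries in [A0];
    averages against [A0] land in them. *)
Lemma A0_decomp f : reg f ->
  exists a b, [/\ A0 a, reg b, perp b & forall g, f g = a g + b g].
Proof.
move=> rf; have [|m [r [W [B [hW rW _ fr]]]]] := @rep_of_family _ _ _ _ hV 1 (fun g => (f g)%:M).
  by move=> i j; apply: polyf_ext rf => g; rewrite !ord1 mxE eqxx.
have pW := rr_poly hW.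
have pW' : polymx (fun g => mxvec (V g)) (fun g => W g^-1%g).
  by move=> i j; apply: (reg_inv (f := fun g => W g i j)); apply: pW.
pose E : set 'rV_m.+1 := [set w | polymx orbc (fun g => W g *m w^T)].
pose E' : set 'rV_m.+1 := [set x | polymx orbc (fun g => x *m W g^-1%g)].
have [|q [N hN]] := @linear_set_rows _ _ E.
  split=> [i j|x y hx hy i j|c x hx i j].
  - by apply: polyf_ext (polyf_cst _ 0) => g; rewrite trmx0 mulmx0 mxE.
  - by apply: polyf_ext (polyfD (hx i j) (hy i j)) => g; rewrite linearD mulmxDr [RHS]mxE.
  - by apply: polyf_ext (polyfZ c (hx i j)) => g; rewrite linearZ -scalemxAr [RHS]mxE.
have [|p [M hM]] := @linear_set_rows _ _ E'.
  split=> [i j|x y hx hy i j|c x hx i j].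
  - by apply: polyf_ext (polyf_cst _ 0) => g; rewrite mul0mx mxE.
  - by apply: polyf_ext (polyfD (hx i j) (hy i j)) => g; rewrite mulmxDl [RHS]mxE.
  - by apply: polyf_ext (polyfZ c (hx i j)) => g; rewrite -scalemxAl [RHS]mxE.
have avgE a (u : 'cV_m.+1) : A0 a ->
    E (haarmx (fun g => a g *: (W g^-1%g *m u)))^T.
  move=> ha i j; pose h0 x := (W x^-1%g *m u) i j.
  have rh0 : reg h0 by apply: (polymx_mul pW' (polymx_cst _ _)).
  apply: polyf_ext (haar_A0 ha rh0) => h.
  rewrite trmxK -[W h *m _]mulmx1 -haarmx_mul; last first.
    exact: polymxZ (A0_reg ha) (polymx_mul pW' (polymx_cst _ u)).
  rewrite mxE -(HR h^-1%g); last by apply: polyfM => //; apply: (@reg_mulxr _ _ _ _ hV h); apply: A0_reg.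
  congr H; apply: funext => g; rewrite mulmx1 -scalemxAr [RHS]mxE mulmxA -(rrM hW).
  by rewrite -mulgA mulVg mulg1 /h0 invgM invgK.
have avgE' a (x : 'rV_m.+1) : A0 a ->
    E' (x *m haarmx (fun g => a g *: W g)).
  move=> ha i j; pose h0 y := (x *m W y) i j.
  have rh0 : reg h0 by apply: (polymx_mul (polymx_cst _ _) pW).
  apply: polyf_ext (haar_A0 ha rh0) => h.
  rewrite -haarmx_mul; last first.
    exact: polymxZ (A0_reg ha) pW.
  rewrite mxE -[RHS](HR h); last first.
    apply: (polymx_mul _ (polymx_cst _ (W h^-1%g)) i j).
    exact: polymx_mul (polymx_cst _ _) (polymxZ (A0_reg ha) pW).
  congr H; apply: funext => g; rewrite -scalemxAr -scalemxAl [RHS]mxE.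
  by rewrite -!mulmxA -(rrM hW) mulgK.
(* By [A0_perp0] no nonzero covector of [E'] is orthogonal to [E], so some vector of [E] has the
   same products with [E'] as [B]. It yields the component of [f] in [A0]. *)
have [y hy] : exists y : 'cV_q, M *m B = M *m (N^T *m y).
  apply: nondegenerate_pairing => x.
  have := hM (x *m M); set z := x *m M => -[_ /(_ (ex_intro _ x erefl)) hz] zN.
  apply/rowP => j; pose u : 'cV[K]_m.+1 := delta_mx j 0.
  have hq : A0 (fun g => (z *m W g^-1%g *m u) 0 0) by apply: polymx_mul hz (polymx_cst _ _) 0 0.
  have /(A0_perp0 hq)/(_ 1%g) : perp (fun g => (z *m W g^-1%g *m u) 0 0).
    move=> a ha; have /hN[y hy] := avgE a u ha.
    transitivity ((z *m haarmx (fun g => a g *: (W g^-1%g *m u))) 0 0); last first.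
      by rewrite -[haarmx _]trmxK hy trmx_mul mulmxA zN mul0mx mxE.
    rewrite -[z *m _]mulmx1 -haarmx_mul; last first.
      exact: polymxZ (A0_reg ha) (polymx_mul pW' (polymx_cst _ u)).
    rewrite mxE; congr H; apply: funext => g.
    by rewrite mulmx1 -scalemxAr [RHS]mxE mulmxA mulrC.
  by rewrite invg1 (rr1 hW) mulmx1 -colE !mxE.
have ra g : r g = r 1%g *m W g by rewrite -rW mul1g.
exists (fun g => (r g *m (N^T *m y)) 0 0), (fun g => (r g *m (B - N^T *m y)) 0 0); split.
- apply: polyf_ext (_ : A0 (fun g => (r 1%g *m (W g *m (N^T *m y))) 0 0)) => [g|].
    by rewrite mulmxA -ra.
  apply: polymx_mul; first exact: polymx_cst.
  have /hN : exists x, (N^T *m y)^T = x *m N by exists y^T; rewrite trmx_mul trmxK.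
  by rewrite /E /= trmxK.
- apply: polyf_ext (_ : reg (fun g => (r 1%g *m W g *m (B - N^T *m y)) 0 0)) => [g|].
    by rewrite -ra.
  exact: polymx_mul (polymx_mul (polymx_cst _ _) pW) (polymx_cst _ _) _ _.
- move=> a ha; have /hM[x hx] := avgE' a (r 1%g) ha.
  transitivity ((r 1%g *m haarmx (fun g => a g *: W g) *m (B - N^T *m y)) 0 0); last first.
    by rewrite hx -mulmxA mulmxBr hy subrr mulmx0 mxE.
  rewrite -haarmx_mul; last first.
    exact: polymxZ (A0_reg ha) pW.
  rewrite mxE; congr H; apply: funext => g.
  by rewrite -scalemxAr -scalemxAl [RHS]mxE ra mulrC.
- move=> g; set u := N^T *m y; have -> : f g = (r g *m B) 0 0 by rewrite -fr mxE eqxx.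
  transitivity ((r g *m u + r g *m (B - u)) 0 0); last by rewrite [LHS]mxE.
  by rewrite -mulmxDr addrC subrK.
Qed.


(** * Functions invariant under the stabilizer of the point *)

Definition orb_inv (f : G -> K) := forall g z, orb z = b0 -> f (g * z)%g = f g.

Lemma orb1 : orb 1%g = b0.
Proof. by rewrite /orb (rr1 hC) mul1mx. Qed.

Lemma A0_orb_inv f : A0 f -> orb_inv f.
Proof. by move=> [p hp] g z hz; rewrite !hp /orbc orbM hz. Qed.

(* The extension to the regular functions of the ideal of the point b0. *)
Definition J (f : G -> K) := exists r (m h : 'I_r -> G -> K),
  [/\ forall i, A0 (m i) /\ m i 1%g = 0, forall i, reg (h i) & forall g, f g = \sum_i m i g * h i g].

Lemma J_ext f1 f2 : f1 =1 f2 -> J f1 -> J f2.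
Proof. by move=> /funext ->. Qed.

Lemma J_reg f : J f -> reg f.
Proof.
move=> [r [m [h [hm hh E]]]].
apply: polyf_ext (_ : reg (fun g => \sum_i m i g * h i g)) => //.
by apply: polyf_sum => i; apply: polyfM (hh i); apply: A0_reg; case: (hm i).
Qed.

Lemma J_at1 f : J f -> f 1%g = 0.
Proof. by move=> [r [m [h [hm _ ->]]]]; rewrite big1 // => i _; rewrite (hm i).2 mul0r. Qed.

Lemma J_transr f z : orb z = b0 -> J f -> J (fun g => f (g * z)%g).
Proof.
move=> hz [r [m [h [hm hh E]]]]; exists r, m, (fun i g => h i (g * z)%g); split=> // [i|g].
  exact: reg_mulxr.
by rewrite E; apply: eq_bigr => i _; rewrite (A0_orb_inv (hm i).1).
Qed.

Lemma J_A0 f : A0 f -> f 1%g = 0 -> J f.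
Proof.
move=> Af f1; exists 1%N, (fun=> f), (fun _ _ => 1); split=> // [_|g].
  exact: polyf_cst.
by rewrite big_ord1 mulr1.
Qed.

Definition IJ : set P := [set p | J (fun g => ev p (V g))].

Lemma IJ_ideal : is_ideal IJ.
Proof.
split=> [|p q [r [m [h [hm hh E]]]] [r' [m' [h' [hm' hh' E']]]]|p q [r [m [h [hm hh E]]]]].
- exists 0%N, (fun _ _ => 0), (fun _ _ => 0); split=> [[]//|[]//|g].
  by rewrite meval0 big_ord0.
- exists (r + r')%N,
    (fun k g => match split k with inl j => m j g | inr j => m' j g end),
    (fun k g => match split k with inl j => h j g | inr j => h' j g end).
  split=> [i|i|g]; try by case: split.
  rewrite mevalD E E' big_split_ord /=; congr (_ + _); apply: eq_bigr => i _.
    by rewrite (unsplitK (inl i : 'I_r + 'I_r')).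
  by rewrite (unsplitK (inr i : 'I_r + 'I_r')).
- exists r, m, (fun i g => ev p (V g) * h i g); split=> // [i|g].
    by apply: polyfM (hh i); exists p.
  by rewrite mevalM E mulr_sumr; apply: eq_bigr => i _; rewrite mulrCA.
Qed.

Lemma IG_IJ p : IG V p -> IJ p.
Proof.
move=> hp; apply: J_ext (J_A0 (polyf_cst _ 0) _) => // g.
Qed.

Lemma IJ_at1 p : IJ p -> ev p 1 = 0.
Proof. by move=> /J_at1; rewrite (lg1 hV). Qed.

Lemma IJ_zero (a : 'I_(n.+1 * n.+1) -> K) : (forall q, IJ q -> q.@[a] = 0) ->
  exists2 z, orb z = b0 & forall q : P, q.@[a] = ev q (V z).
Proof.
move=> ha; pose A : 'M_n.+1 := vec_mx (\row_i a i).
have aA (q : P) : q.@[a] = ev q A by apply: meval_eq => i; rewrite vec_mxK mxE.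
have [q hq|z zA] := @lg_closed _ _ _ _ hV A; first by rewrite -aA; apply/ha/IG_IJ.
exists z => [|q]; last by rewrite aA zA.
apply/matrixP => i j; apply/eqP; rewrite -subr_eq0; apply/eqP.
have A0ij : A0 (fun g => orb g i j - b0 i j).
  by apply: polyfB; [exact: polymx_coord|exact: polyf_cst].
have [q hq] := A0_reg A0ij; rewrite hq zA -aA; apply: ha.
by apply: (J_ext hq); apply: J_A0 => //; rewrite orb1 subrr.
Qed.

Section Tangent.
Variable X : 'M[K]_n.+1.
Hypothesis hX : forall q, IJ q -> ddir q (mxvec 1) (mxvec X) = 0.

Lemma J_lie : lie V X.
Proof. by move=> p /IG_IJ/hX. Qed.

Lemma J_der1 f : J f -> der1 V X f = 0.
Proof.
move=> Jf; have [p hp] := J_reg Jf.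
rewrite (der1E J_lie hp); apply: hX; apply: J_ext Jf.
exact: hp.
Qed.

Lemma der1_shift f g : reg f -> der1 V X (fun h => f h - f g) = der1 V X f.
Proof. by move=> rf; rewrite der1D ?der1_cst ?addr0 //; [exact: J_lie|exact: J_lie|exact: polyf_cst]. Qed.

(** A left translate of a function in [A0], minus its value at 1, is in [J], which [X] annihilates
    at 1. Hence only the coefficients [h i] are differentiated in [J_dleft]. *)
Lemma J_dleft_A0 f g : A0 f -> dleft V X f g = 0.
Proof.
move=> Af; rewrite /dleft -(der1_shift 1%g); last exact/reg_mulx/A0_reg.
apply: J_der1; apply: J_A0; last by rewrite subrr.
by apply: polyfB; [exact: A0_mulx|exact: polyf_cst].
Qed.

Lemma J_dleft f : J f -> J (dleft V X f).
Proof.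
move=> [r [m [h [hm hh E]]]]; exists r, m, (fun i => dleft V X (h i)); split=> // [i|g].
  by apply: dleft_reg => //; exact: J_lie.
have rm i : reg (m i) by apply: A0_reg; case: (hm i).
rewrite /dleft (der1_ext _ _ (h := fun y => \sum_i m i (g * y)%g * h i (g * y)%g)); last first.
  by move=> y; rewrite E.
rewrite der1_sum; [|exact: J_lie|by move=> i; apply: polyfM; apply: reg_mulx].
apply: eq_bigr => i _; rewrite der1M ?mulg1 //; [|exact: J_lie|exact: reg_mulx|exact: reg_mulx].
by rewrite -[der1 _ _ _]/(dleft V X (m i) g) J_dleft_A0 ?mul0r ?add0r //; case: (hm i).
Qed.

Lemma IJ_lder p : IJ p -> IJ (lder X p).
Proof.
move=> /J_dleft; apply: J_ext => g; rewrite (dleftE hV J_lie (p := p)) //.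
Qed.

Lemma lder_expS p m : lder X (p ^+ m.+1) = m.+1%:R *: (p ^+ m * lder X p).
Proof.
elim: m => [|m IH]; first by rewrite expr1 mul1r scale1r.
rewrite exprS /lder vfieldM -![vfield _ _]/(lder X _) IH -scalerAr mulrA -exprS.
by rewrite mulrC -[m.+2]addn1 natrD scalerDl scale1r addrC.
Qed.

(** In characteristic 0 the radical of a differential ideal is differential. Differentiating
    [p^(r+1) q^s] with [q = lder X p], then multiplying by [q], trades a factor [p] for two factors
    [q] modulo the ideal. *)
Lemma IJ_lder_pow p r : IJ (p ^+ r) -> exists s, IJ (lder X p ^+ s).
Proof.
suff h s : IJ (p ^+ r * lder X p ^+ s) -> exists s, IJ (lder X p ^+ s).
  by move=> ?; apply: (h 0%N); rewrite mulr1.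
have iJ := IJ_ideal; elim: r s => [|r IH] s hs; first by exists s; rewrite -[_ ^+ _]mul1r.
apply: (IH s.+2); have /(idealMl iJ ((r.+1%:R^-1)%:MP * lder X p)) := IJ_lder hs.
rewrite [in lder _ (_ * _)]/lder vfieldM -![vfield _ _]/(lder X _) lder_expS mulrDr => h.
have : IJ ((r.+1%:R^-1)%:MP * lder X p * (p ^+ r.+1 * lder X (lder X p ^+ s))).
  case: s hs {h} => [|s] hs.
    rewrite expr0 /lder -mpolyC1 vfieldC !mulr0; exact: ideal0.
  rewrite lder_expS -mul_mpolyC; set c := _%:MP; set c' := _%:MP; set q := lder X p in hs *.
  rewrite (_ : _ * _ = c * c' * lder X q * (p ^+ r.+1 * q ^+ s.+1)); first exact: idealMl.
  rewrite !exprS; ring.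
move=> h'; have := idealB iJ h h'; rewrite addrK -mul_mpolyC.
have : (r.+1%:R^-1)%:MP * (r.+1%:R)%:MP = 1 :> P.
  by rewrite -mpolyCM mulVf ?pnatr_eq0.
set c := _%:MP; set c' := _%:MP; set q := lder X p => cc.
have -> : c * q * (c' * (p ^+ r * q) * q ^+ s) = c * c' * (p ^+ r * q ^+ s.+2).
  by rewrite !exprS; ring.
by rewrite cc mul1r.
Qed.

End Tangent.


Lemma orb_inv_shift f g : orb_inv f -> orb_inv (fun h => f (g * h)%g - f g).
Proof. by move=> fz h z hz; rewrite mulgA (fz _ z hz). Qed.

(** [f] vanishes on the stabilizer, so a power of it lies in [IJ]; then a power of its derivative
    does too, and vanishes at 1. This stands in for a proof that [IJ] is radical. *)
Lemma orb_inv_der1 X f : (forall q, IJ q -> ddir q (mxvec 1) (mxvec X) = 0) ->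
  reg f -> orb_inv f -> f 1%g = 0 -> der1 V X f = 0.
Proof.
move=> hX [p hp] fz f1; rewrite (der1E (J_lie hX) hp).
have [|r /(IJ_lder_pow hX)[s /IJ_at1/eqP]] := nullstellensatz uncK (p := p) IJ_ideal.
  by move=> a /IJ_zero[z hz ->]; rewrite -hp -[z]mul1g fz.
by rewrite rmorphXn expf_eq0 => /andP[_ /eqP]; rewrite /= lder_eval mul1r.
Qed.

(** The derivatives of [f] along the stabilizer vanish, so [s f] is in [J] for some [s] equal to 1
    at the identity. Translates of [s] serve at the other points of the stabilizer, and with [IJ]
    these multipliers generate the unit ideal. *)
Lemma orb_inv_J f : reg f -> orb_inv f -> f 1%g = 0 -> J f.
Proof.
move=> rf fz f1; have [p hp] := rf.
have p1 : ev p 1 = 0 by rewrite -(lg1 hV) -hp.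
have [|||s s1 Js] := lie_annihilated_locally IJ_ideal _ _ p1.
- exact: IJ_at1.
- by move=> X hX q; exact: IJ_lder.
- move=> X hX; apply: J_ext (J_A0 (polyf_cst _ 0) _) => // g.
  rewrite -(dleftE hV (J_lie hX) hp) /dleft -(der1_shift hX 1%g); last exact: reg_mulx.
  rewrite mulg1; apply/esym/orb_inv_der1 => //; last by rewrite mulg1 subrr.
    by apply: polyfB; [exact: reg_mulx|exact: polyf_cst].
  exact: orb_inv_shift.
pose Q : set P := [set t | IJ (t * p)]; have iJ := IJ_ideal.
suff : Q 1 by rewrite /Q /= mul1r; apply: J_ext => g; rewrite hp.
apply: (nullstellensatz1 uncK) => [|a].
  split=> [|x y hx hy|x y hx]; rewrite /Q /=.
  - by rewrite mul0r; apply: ideal0.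
  - by rewrite mulrDl; apply: idealD.
  - by rewrite -mulrA; apply: idealMl.
have [/IJ_zero[z zb aE]|/existsNP[q /not_implyP[Jq qa]]] := pselect (forall q, IJ q -> q.@[a] = 0); last first.
  by exists q; [exact: idealMr|apply/eqP].
have zb' : orb z^-1%g = b0.
  have : C z^-1%g *m orb z = b0 by rewrite -orbM mulVg orb1.
  by rewrite zb.
have [t ht] : reg (fun g => ev s (V (g * z^-1)%g)).
  by apply: (@reg_mulxr _ _ _ _ hV z^-1%g (fun g => ev s (V g))); exists s.
exists t; last by rewrite aE -ht mulgV (lg1 hV) s1 oner_eq0.
apply: J_ext (J_transr zb' Js) => g.
by rewrite !mevalM -ht -!hp fz.
Qed.

(** It suffices to treat the value at 1. Write [b - b 1%g] as a combination of the [m i] and replace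
    the coefficients [h i] by their components [a i] in [A0]: the change lies in [perp]. The
    resulting [u] is in [A0] and in [perp], hence 0, while [u 1%g = b 1%g]. *)
Lemma orb_inv_perp0 f : reg f -> orb_inv f -> perp f -> f =1 fun=> 0.
Proof.
suff h b : reg b -> orb_inv b -> perp b -> b 1%g = 0.
  move=> rf fz pf x; have := h (fun g => f (x * g)%g); rewrite mulg1; apply.
  - exact: reg_mulx.
  - by move=> g z hz; rewrite mulgA (fz _ z hz).
  - exact: perp_mulx.
move=> rb bz pb.
have [|||r [m [h [hm hh E]]]] := @orb_inv_J (fun g => b g - b 1%g).
- by apply: polyfB => //; exact: polyf_cst.
- by move=> g z hz; rewrite bz.
- by rewrite subrr.
have /choice[a ha] i : exists a, A0 a /\ perp (fun g => h i g - a g).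
  have [a [c [Aa rc pc ac]]] := A0_decomp (hh i); exists a; split=> //.
  by rewrite (_ : (fun g => _) = c) //; apply: funext => g; rewrite ac addrC addKr.
pose u g := b 1%g + \sum_i m i g * a i g.
have Au : A0 u.
  by apply: polyfD (polyf_cst _ _) _; apply: polyf_sum => i; apply: polyfM (hm i).1 (ha i).1.
have pu : perp u.
  move=> c Ac; pose w g := \sum_i m i g * (h i g - a i g).
  have rw i : reg (fun g => m i g * (h i g - a i g)).
    by apply: polyfM (A0_reg (hm i).1) (polyfB (hh i) (A0_reg (ha i).1)).
  have : H (fun g => b g * c g) = H (fun g => u g * c g) + H (fun g => w g * c g).
    rewrite -HD; [|exact: polyfM (A0_reg Au) (A0_reg Ac)|].
      congr H; apply: funext => g; rewrite -mulrDl /u /w -addrA -big_split /=; congr (_ * _).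
      rewrite (eq_bigr (fun i => m i g * h i g)) => [|i _]; last by rewrite -mulrDr addrC subrK.
      by rewrite -E addrC subrK.
    by apply: polyfM (A0_reg Ac); apply: polyf_sum.
  rewrite pb // (_ : (fun g => w g * c g) = fun g => \sum_i m i g * (h i g - a i g) * c g).
    rewrite haar_sum => [|i]; last exact: polyfM (rw i) (A0_reg Ac).
    rewrite big1 ?addr0 // => i _; rewrite -[RHS]((perpM (hm i).1 (ha i).2) c Ac) //.
  by apply: funext => g; rewrite mulr_suml.
have := A0_perp0 Au pu 1%g; rewrite /u big1 ?addr0 // => i _.
by rewrite (hm i).2 mul0r.
Qed.

Lemma orb_inv_A0 f : reg f -> orb_inv f -> A0 f.
Proof.
move=> rf fz; have [a [b [Aa rb pb ab]]] := A0_decomp rf.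
have bE g : b g = f g - a g by rewrite ab addrC addKr.
apply: polyf_ext (Aa) => g; rewrite ab (orb_inv_perp0 rb) ?addr0 // => h z hz.
by rewrite !bE fz // (A0_orb_inv Aa).
Qed.

Hypothesis orb_free : forall g, orb g = b0 -> C g = 1%:M.

Theorem orbit_section : exists F : 'M[K]_(d, k) -> 'M[K]_d,
  [/\ polymx mxvec F, forall g b, F (C g *m b) = C g *m F b & F b0 = 1%:M].
Proof.
have /choice[p hp] (ij : 'I_d * 'I_d) : exists p : {mpoly K[(d * k)]}, forall g,
    C g ij.1 ij.2 = p.@[orbc g 0].
  apply: orb_inv_A0 => [|g z /orb_free hz]; first exact: (rr_poly hC).
  by rewrite (rrM hC) hz mulmx1.
pose F0 (b : 'M_(d, k)) : 'M_d := \matrix_(i, j) (p (i, j)).@[mxvec b 0].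
have F0E g : F0 (orb g) = C g by apply/matrixP => i j; rewrite mxE -hp.
have pF0 : polymx mxvec F0 by move=> i j; exists (p (i, j)) => b; rewrite mxE.
have pC' : polymx (fun g => mxvec (V g)) (fun g => C g^-1%g).
  by move=> i j; apply: (reg_inv (f := fun g => C g i j)); apply: (rr_poly hC).
pose f b g := C g^-1%g *m F0 (C g *m b).
have pf b : polymx (fun g => mxvec (V g)) (f b).
  apply: polymx_mul => // i j; apply: (polyf_precomp (u := fun g => C g *m b) _ (pF0 i j)).
  apply/polymx_mxvec; apply: polymx_mul (rr_poly hC) (polymx_cst _ _).
exists (fun b => haarmx (f b)); split=> [i j|g b|].
- pose f2 (xy : G * 'M_(d, k)) := f xy.2 xy.1 i j.
  apply: polyf_ext (_ : polyf _ (fun b => H (fun g => f2 (g, b)))) => [b|].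
    by rewrite mxE.
  apply: haar_polyf; rewrite /f2 /f.
  have p1 := @polymx_fst _ _ _ _ _ (fun g => mxvec (V g)) (@mxvec K d k).
  have p2 := @polymx_snd _ _ _ _ _ (fun g => mxvec (V g)) (@mxvec K d k).
  apply: (polymx_mul (A := fun xy => C xy.1^-1%g)
    (B := fun xy : G * 'M_(d, k) => F0 (C xy.1 *m xy.2))) => i' j'.
    exact: (polyf_precomp (u := fst) p1 (pC' i' j')).
  apply: (polyf_precomp (u := fun xy => C xy.1 *m xy.2) _ (pF0 i' j')).
  apply/polymx_mxvec; apply: polymx_mul => a c.
    exact: (polyf_precomp (u := fst) p1 (rr_poly hC a c)).
  exact: (polyf_precomp (u := snd) p2 (polymx_coord _ a c)).
- rewrite -[RHS]mulmx1 -haarmx_mul //; apply/matrixP => i j; rewrite !mxE.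
  (* Replacing [h] by [h g] under the mean turns [C(g) C(h)^-1] into [C(h)^-1] and [C(h) b] into
     [C(h) C(g) b]. *)
  rewrite -[RHS](HR g); last exact: polymx_mul (polymx_mul (polymx_cst _ _) (pf b)) (polymx_cst _ _) _ _.
  congr H; apply: funext => h; rewrite mulmx1 /f invgM !(rrM hC) !mulmxA.
  by rewrite (rrV hC) mul1mx.
- apply/matrixP => i j; rewrite mxE -[RHS]H1; congr H; apply: funext => g.
  by rewrite /f F0E (rrVl hC).
Qed.

End ClosedOrbit.

(** * Representations in conjugation coordinates *)

Lemma multiplicative_of (A B : groupType) (f : A -> B) :
  (forall x y, f (x * y)%g = (f x * f y)%g) -> exists r : {multiplicative A -> B}, r =1 f.
Proof.
by move=> fM; exists (Multiplicative.Pack (Multiplicative.Class (isMultiplicative.Build _ _ f fM))).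
Qed.

Lemma multiplicative1 (A B : groupType) (r : {multiplicative A -> B}) : r 1%g = 1%g.
Proof. by apply: (mulgI (r 1%g)); rewrite -gmulfM !mulg1. Qed.

Lemma multiplicativeV (A B : groupType) (r : {multiplicative A -> B}) x : r x^-1%g = (r x)^-1%g.
Proof. by apply: (mulgI (r x)); rewrite -gmulfM !mulgV multiplicative1. Qed.

Section ZariskiClosure.
Variables (K : fieldType) (m k : nat).

Definition zariski_closure (S : set 'M[K]_(m, k)) : set 'M[K]_(m, k) :=
  [set b | forall p : {mpoly K[(m * k)]}, (forall x, S x -> p.@[mxvec x 0] = 0) -> p.@[mxvec b 0] = 0].

Lemma zariski_closure_eq S b f h : zariski_closure S b -> polyf mxvec f -> polyf mxvec h ->
  (forall x, S x -> f x = h x) -> f b = h b.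
Proof.
move=> Sb pf ph fh; have [p hp] := polyfB pf ph.
apply/eqP; rewrite -subr_eq0 hp; apply/eqP; apply: Sb => x Sx.
by rewrite -hp fh ?subrr.
Qed.

Lemma zariski_closure_eqmx S b r t (f h : 'M_(m, k) -> 'M_(r, t)) : zariski_closure S b ->
  polymx mxvec f -> polymx mxvec h -> (forall x, S x -> f x = h x) -> f b = h b.
Proof.
move=> Sb pf ph fh; apply/matrixP => i j.
by apply: (zariski_closure_eq Sb (pf i j) (ph i j)) => x /fh ->.
Qed.

End ZariskiClosure.

Lemma zariski_closure_image (K : fieldType) m k r t (S : set 'M[K]_(m, k)) b
    (f : 'M_(m, k) -> 'M_(r, t)) : polymx mxvec f -> zariski_closure S b ->
  zariski_closure (f @` S) (f b).
Proof.
move=> pf Sb p hp; apply: (zariski_closure_eq (f := fun x => p.@[mxvec (f x) 0]) (h := fun=> 0) Sb) => [||x Sx].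
- by apply: polyf_pullback; apply/polymx_mxvec.
- exact: polyf_cst.
- by apply: hp; exists x.
Qed.

Lemma polymx_id (K : fieldType) m k : polymx (@mxvec K m k) id.
Proof. exact: polymx_coord. Qed.

(** [M = F F(B)^-1] recovers [C g] from the point [C g *m B]. At a limit point [b], [M b *m b0] lies
    in the closed orbit of [b0], so it is some [C g *m b0]; applying [F] gives [M b = C g], and
    [b = M b *m B] by continuity. *)
Lemma section_orbit_closed (K : fieldType) (G : Type) d k (C : G -> 'M[K]_d)
    (b0 B b : 'M[K]_(d, k)) (F : 'M_(d, k) -> 'M_d) :
  zariski_closure (range (fun g => C g *m b0)) `<=` range (fun g => C g *m b0) ->
  polymx mxvec F -> (forall g x, F (C g *m x) = C g *m F x) -> F b0 = 1%:M ->
  F B \in unitmx -> zariski_closure (range (fun g => C g *m B)) b -> exists g, b = C g *m B.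
Proof.
move=> cl0 pF FC F0 uB hb.
pose M x := F x *m invmx (F B).
have pM : polymx mxvec M by apply: polymx_mul pF (polymx_cst _ _).
have MC g : M (C g *m B) = C g by rewrite /M FC -mulmxA mulmxV ?mulmx1.
have pMb N : polymx mxvec (fun x => M x *m (N : 'M_(d, k))) by apply: polymx_mul (pM) (polymx_cst _ _).
have [g _ hg] : range (fun g => C g *m b0) (M b *m b0).
  apply: cl0 => p hp; apply: (zariski_closure_image (pMb b0) hb) => _ [_ [h _ <-] <-].
  by rewrite MC; apply: hp; exists h.
exists g; have <- : M b = C g.
  rewrite -[RHS]mulmx1 -F0 -FC hg.
  apply: (zariski_closure_eqmx (f := M) (h := fun x => F (M x *m b0)) hb pM) => [|_ [h _ <-]].
    by move=> i j; apply: polyf_precomp (pF i j); apply/polymx_mxvec.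
  by rewrite MC FC F0 mulmx1.
apply: (zariski_closure_eqmx (f := id) hb (@polymx_id _ _ _) (pMb B)) => _ [h _ <-].
by rewrite MC.
Qed.

(** [P] takes coordinates on the span of the [f j] and [Q] embeds it back. Coordinates on the span,
    rather than on the whole space, let a linear operator be identified by its values on the
    [f j]. *)
Lemma spanning_coordinates (K : fieldType) (J : Type) N (f : J -> 'rV[K]_N) :
  exists d (P : 'M_(N, d)) (Q : 'M_(d, N)), (forall j, f j *m P *m Q = f j) /\
    forall u : 'cV_d, (forall j, f j *m P *m u = 0) -> u = 0.
Proof.
pose S := [set x : 'rV_N | forall u : 'cV_N, (forall j, f j *m u = 0) -> x *m u = 0].
have [|p [M hM]] := @linear_set_rows _ _ S.
  split=> [u _|x y hx hy u hu|c x hx u hu]; first exact: mul0mx.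
    by rewrite mulmxDl hx // hy // addr0.
  by rewrite -scalemxAl hx // scaler0.
exists (\rank M), (pinvmx (row_base M)), (row_base M).
have fE j : f j *m pinvmx (row_base M) *m row_base M = f j.
  rewrite mulmxKpV // (eq_row_base M); apply/submxP.
  by apply/hM => u; apply.
split=> // u hu; have fM : row_base M *m pinvmx (row_base M) = 1%:M.
  by apply: mulmxVp; exact: row_base_free.
rewrite -[u]mul1mx -fM -mulmxA; apply/row_matrixP => i; rewrite row0 row_mul.
have /hM : exists y, row i (row_base M) = y *m M.
  by apply/submxP; rewrite -(eq_row_base M) row_sub.
by apply=> j; rewrite mulmxA hu.
Qed.

Section ConjugationCoordinates.
Variables (K : numClosedFieldType) (G : affineAlgGroup K) (n : nat) (V : G -> 'M[K]_n.+1).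
Hypotheses (hV : linear_group V) (pV : polymx (@aag_coord K G) V)
  (pc : polymx (fun g => mxvec (V g)) (@aag_coord K G)).
Variables (d : nat) (P : 'M[K]_(n.+1 * n.+1, d)) (Q : 'M[K]_(d, n.+1 * n.+1)).
Hypotheses (PQ : forall g, mxvec (V g) *m P *m Q = mxvec (V g))
  (Psep : forall u : 'cV_d, (forall g, mxvec (V g) *m P *m u = 0) -> u = 0).

Let al g := mxvec (V g) *m P.

Lemma al_inj : injective al.
Proof.
move=> g h gh; apply: (lg_inj hV); apply: (can_inj mxvecK).
by rewrite -PQ -[mxvec (V h)]PQ -![_ *m P]/(al _) gh.
Qed.

Lemma al_sep m (A B : 'M_(d, m)) : (forall g, al g *m A = al g *m B) -> A = B.
Proof.
move=> AB; apply/matrixP => i j; apply/eqP; rewrite -subr_eq0.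
have /colP/(_ i) : col j (A - B) = 0.
  by apply: Psep => g; rewrite -/(al g) colE mulmxA mulmxBr AB subrr mul0mx.
by rewrite !mxE => ->.
Qed.

Let L g := lin_mx (mulmxr (V g^-1%g) \o mulmx (V g)).

(* Conjugation by V g on the linear span of V(G), in the coordinates al; it is
   transposed so as to be multiplicative in g. *)
Definition conj_rep g : 'M_d := (Q *m L g *m P)^T.

Lemma al_conj g x : al (g * x * g^-1)%g = al x *m (conj_rep g)^T.
Proof.
rewrite trmxK !mulmxA PQ mul_vec_lin /= /al !(lgM hV).
by [].
Qed.

Lemma conj_rep_rational : rational_rep V conj_rep.
Proof.
split=> [i j||g h].
- apply: polyf_ext (_ : polyf _ (fun g => (Q *m L g *m P) j i)) => [g|]; first by rewrite /conj_rep [RHS]mxE.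
  apply: polymx_mul (polymx_cst _ _) _ _; apply: polymx_mul (polymx_cst _ _) _ => i' j'.
  case/mxvec_indexP: j' => a b.
  apply: polyf_ext (_ : polyf _ (fun g => (V g *m vec_mx (delta_mx 0 i') *m V g^-1%g) a b)) => [g|].
    by rewrite /L /lin_mx /lin1_mx [RHS]mxE /= mxvecE.
  apply: polymx_mul (lg_inv hV) _ _; apply: polymx_mul (polymx_cst _ _).
  exact: polymx_coord.
- apply: trmx_inj; apply: al_sep => g.
  by rewrite -al_conj mul1g invg1 mulg1 trmx1 mulmx1.
- apply: trmx_inj; apply: al_sep => x; rewrite -al_conj trmx_mul mulmxA -!al_conj invgM.
  by rewrite !mulgA.
Qed.

Lemma conj_rep1 g : conj_rep g = 1%:M <-> group_center g.
Proof.
split=> [Cg x|gc].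
  have := al_conj g x; rewrite Cg trmx1 mulmx1 => /al_inj gx.
  by rewrite /commute -[in RHS]gx mulgVK.
apply: trmx_inj; apply: al_sep => x.
by rewrite -al_conj gc mulgK trmx1 mulmx1.
Qed.

Variables (Gamma : groupType) (k : nat) (s : 'I_k -> Gamma).
Hypothesis sgen : generated_subgroup (range s) = setT.
Implicit Types rho : {multiplicative Gamma -> G}.

Definition rep_coord rho : 'M_(d, k) := (\matrix_(i < k) al (rho (s i)))^T.

Lemma rep_coord_conj g rho rho' : (forall x, rho' x = (g * rho x * g^-1)%g) ->
  rep_coord rho' = conj_rep g *m rep_coord rho.
Proof.
move=> h; rewrite /rep_coord -[conj_rep g]trmxK -trmx_mul; congr trmx; apply/row_matrixP => i.
by rewrite row_mul !rowK h al_conj.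
Qed.

(** Induction along a word in the generators: products are matrix products, and inverses are
    polynomial by [lg_inv]. *)
Lemma rep_coord_word x : exists2 q : 'M_(d, k) -> 'M_n.+1, polymx mxvec q &
  forall rho, V (rho x) = q (rep_coord rho).
Proof.
have : generated_subgroup (range s) x by rewrite sgen.
move=> /(_ [set x | exists2 q : 'M_(d, k) -> 'M_n.+1, polymx mxvec q &
  forall rho, V (rho x) = q (rep_coord rho)]); apply=> [|_ [i _ <-]]; first split.
- exists (fun=> 1); first exact: polymx_cst.
  by move=> rho; rewrite multiplicative1 (lg1 hV).
- move=> y z [q pq qE] [r pr rE]; exists (fun b => q b * r b); first exact: polymx_mul.
  by move=> rho; rewrite gmulfM (lgM hV) qE rE.
- move=> y [q pq qE].
  have /choice[p hp] (ij : 'I_n.+1 * 'I_n.+1) : exists p : {mpoly K[(n.+1 * n.+1)]},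
      forall g, V g^-1%g ij.1 ij.2 = p.@[mxvec (V g) 0] by exact: (lg_inv hV).
  exists (fun b => \matrix_(i, j) (p (i, j)).@[mxvec (q b) 0]) => [i j|rho].
    apply: polyf_ext (_ : polyf _ (fun b => (p (i, j)).@[mxvec (q b) 0])) => [b|].
      by rewrite mxE.
    by apply: polyf_pullback; apply/polymx_mxvec.
  by apply/matrixP => i j; rewrite mxE multiplicativeV -qE -hp.
- exists (fun b => vec_mx ((col i b)^T *m Q)) => [a c|rho].
    apply: polyf_ext (_ : polyf _ (fun b => ((col i b)^T *m Q) 0 (mxvec_index a c))) => [b|].
      by rewrite [RHS]mxE.
    apply: polymx_mul (polymx_cst _ _) _ _ => a' c'.
    by apply: polyf_ext (polymx_coord _ c' i) => b; rewrite !mxE.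
  by rewrite /rep_coord -tr_row trmxK rowK PQ mxvecK.
Qed.

Lemma rep_coord_inj rho rho' : rep_coord rho = rep_coord rho' -> rho =1 rho'.
Proof.
move=> E x; have [q _ hq] := rep_coord_word x.
by apply: (lg_inj hV); rewrite !hq E.
Qed.

(** At a limit point [b] the word polynomials take values in the closed group, and multiplicativity,
    a polynomial identity valid at every representation, persists at [b]. *)
Lemma rep_coord_closed : zariski_closure (range rep_coord) `<=` range rep_coord.
Proof.
move=> b hb; have /choice[q hq] x : exists q : 'M_(d, k) -> 'M_n.+1, polymx mxvec q /\
  forall rho, V (rho x) = q (rep_coord rho) by have [q pq hq] := rep_coord_word x; exists q.
have /choice[r hr] x : exists g, V g = q x b.
  apply: (lg_closed hV) => p hp; apply: (zariski_closure_image (hq x).1 hb) => _ [_ [rho _ <-] <-].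
  by rewrite -(hq x).2.
have [x y|rho hrho] := @multiplicative_of _ _ r.
  apply: (lg_inj hV); rewrite (lgM hV) !hr.
  apply: (zariski_closure_eqmx (h := fun b => q x b *m q y b) hb (hq _).1).
    exact: polymx_mul (hq x).1 (hq y).1.
  by move=> _ [rho _ <-]; rewrite -!(hq _).2 gmulfM (lgM hV).
exists rho => //.
pose f b := (\matrix_(i < k) (mxvec (q (s i) b) *m P))^T.
have -> : rep_coord rho = f b.
  by rewrite /rep_coord /f; congr trmx; apply/row_matrixP => i; rewrite !rowK hrho /al hr.
apply: (zariski_closure_eqmx (f := f) (h := id) hb _ (@polymx_id _ _ _)) => [i j|_ [rho' _ <-]].
  apply: polyf_ext (_ : polyf _ (fun b => (mxvec (q (s j) b) *m P) 0 i)) => [c|].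
    by rewrite !mxE.
  apply: polymx_mul (polymx_cst _ _) _ _; apply/polymx_mxvec; exact: (hq _).1.
rewrite /rep_coord /f; congr trmx; apply/row_matrixP => i.
by rewrite !rowK -(hq _).2.
Qed.

(** Together with [hom_coord_poly], this makes both coordinate systems define the same Zariski
    topology on the representations. *)
Lemma rep_coord_poly : polymx (hom_coord s) rep_coord.
Proof.
move=> i j; apply: polyf_ext (_ : polyf _ (fun rho => al (rho (s j)) 0 i)) => [rho|].
  by rewrite !mxE.
apply: polymx_mul (polymx_cst _ _) _ _; apply/polymx_mxvec => a b.
apply: (polyf_precomp (u := fun rho => rho (s j)) _ (pV a b)) => a' b'.
apply: polyf_ext (polyf_coord _ (mxvec_index j b')) => rho.
by rewrite mxvecE mxE ord1.
Qed.

Lemma hom_coord_poly : polymx (fun rho => mxvec (rep_coord rho)) (hom_coord s).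
Proof.
apply/polymx_mxvec => i j.
apply: polyf_ext (_ : polyf _ (fun rho => aag_coord (rho (s i)) 0 j)) => [rho|].
  by rewrite mxE.
apply: (polyf_precomp (u := fun rho => rho (s i)) _ (pc 0 j)); apply/polymx_mxvec => a b.
apply: polyf_ext (_ : polyf _ (fun rho => ((col i (rep_coord rho))^T *m Q) 0 (mxvec_index a b))) => [rho|].
  by rewrite /rep_coord -tr_row trmxK rowK PQ mxvecE.
apply: polymx_mul (polymx_cst _ _) _ _ => a' c'.
by apply: polyf_ext (polymx_coord _ c' i) => rho; rewrite !mxE.
Qed.

Lemma conj_hom g rho : exists rho', forall x, rho' x = (g * rho x * g^-1)%g.
Proof.
apply: (@multiplicative_of _ _ (fun x => (g * rho x * g^-1)%g)) => x y.
by rewrite gmulfM !mulgA mulgVK.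
Qed.

Lemma conj_orbit_coord rho rho' :
  conj_orbit rho rho' <-> exists g, rep_coord rho' = conj_rep g *m rep_coord rho.
Proof.
split=> [[g /rep_coord_conj]|[g hg]]; first by exists g.
have [rho1 h1] := conj_hom g rho; exists g => x.
by rewrite -h1; apply: rep_coord_inj; rewrite hg (rep_coord_conj h1).
Qed.

Lemma conj_orbit_closed_coord rho : zariski_closed (hom_coord s) (conj_orbit rho) ->
  zariski_closure (range (fun g => conj_rep g *m rep_coord rho)) `<=`
    range (fun g => conj_rep g *m rep_coord rho).
Proof.
move=> [I hI] b hb.
have [|rho' _ Eb] := rep_coord_closed (t := b).
  move=> p hp; apply: hb => _ [g _ <-]; apply: hp.
  by have [rho' h] := conj_hom g rho; exists rho' => //; apply: rep_coord_conj.
suff /conj_orbit_coord[g hg] : conj_orbit rho rho' by exists g; rewrite // -hg.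
rewrite hI => p Ip; have [q hq] := polyf_pullback p hom_coord_poly.
rewrite hq Eb; apply: hb => _ [g _ <-].
have [rho1 h] := conj_hom g rho; rewrite -(rep_coord_conj h) -hq.
have : conj_orbit rho rho1 by exists g.
by rewrite hI; apply.
Qed.

Lemma conj_orbit_coord_closed rho :
  zariski_closure (range (fun g => conj_rep g *m rep_coord rho)) `<=`
    range (fun g => conj_rep g *m rep_coord rho) ->
  zariski_closed (hom_coord s) (conj_orbit rho).
Proof.
move=> cl; apply: zariski_closed_sep => rho' nO; apply: contrapT => hf; apply: nO.
apply/conj_orbit_coord; suff [g _ hg] : range (fun g => conj_rep g *m rep_coord rho) (rep_coord rho').
  by exists g.
apply: cl => p hp; apply: contrapT => h; apply: hf; exists (fun rho => p.@[mxvec (rep_coord rho) 0]).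
split=> // [|rho1 /conj_orbit_coord[g ->]]; last by apply: hp; exists g.
by apply: polyf_pullback; apply/polymx_mxvec; exact: rep_coord_poly.
Qed.

Lemma conj_stabilizer_coord rho g :
  conj_stabilizer rho g <-> conj_rep g *m rep_coord rho = rep_coord rho.
Proof.
have [rho' h] := conj_hom g rho; rewrite -(rep_coord_conj h).
split=> [gs|E x]; last by rewrite -h; apply: rep_coord_inj.
by rewrite /rep_coord; congr trmx; apply/row_matrixP => i; rewrite !rowK h gs.
Qed.

Lemma good_open_of_sections :
  (forall b0, zariski_closure (range (fun g => conj_rep g *m b0)) `<=`
       range (fun g => conj_rep g *m b0) ->
     (forall g, conj_rep g *m b0 = b0 -> conj_rep g = 1%:M) ->
     exists F : 'M_(d, k) -> 'M_d,
       [/\ polymx mxvec F, forall g b, F (conj_rep g *m b) = conj_rep g *m F b & F b0 = 1%:M]) ->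
  zariski_open (@hom_coord _ G _ _ s) [set rho | good s rho].
Proof.
(* The set of representations that are not good is closed once each good [rho0] has a function
   vanishing on that set but not at [rho0]. *)
move=> sect; apply: zariski_closed_sep => rho0 /contrapT[cl0 st0].
have cl := conj_orbit_closed_coord cl0.
have [g /conj_stabilizer_coord|F [pF FC F0]] := sect _ cl.
  by rewrite st0 => /conj_rep1.
have pFB : polymx (hom_coord s) (fun rho => F (rep_coord rho)).
  move=> i j; apply: (polyf_precomp (u := rep_coord) _ (pF i j)).
  by apply/polymx_mxvec; exact: rep_coord_poly.
exists (fun rho => \det (F (rep_coord rho))); split; first exact: polyf_det; last first.
  by rewrite F0 det1 => /eqP; rewrite oner_eq0.
move=> rho; apply: contra_notP => /eqP uF; split.
  apply: conj_orbit_coord_closed => b hb.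
  have [|g ->] := section_orbit_closed cl pF FC F0 _ hb; last by exists g.
  by rewrite unitmxE unitfE.
apply/seteqP; split=> g; rewrite conj_stabilizer_coord => hg.
  (* A stabilizing [g] fixes the invertible matrix [F (rep_coord rho)] under left multiplication by
     [conj_rep g], so [conj_rep g] is the identity. *)
  apply/conj_rep1; have := FC g (rep_coord rho).
  rewrite hg => /(congr1 (mulmx^~ (invmx (F (rep_coord rho))))).
  by rewrite -mulmxA mulmxV ?mulmx1 // unitmxE unitfE.
by move/conj_rep1: hg => ->; rewrite mul1mx.
Qed.

End ConjugationCoordinates.

Theorem proposition33 (R : realType) (G : affineAlgGroup R[i])
  (Gred : reductive G) (Gamma : groupType) (k : nat) (s : 'I_k -> Gamma)
  (sgen : generated_subgroup (range s) = setT) :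
  zariski_open (hom_coord s)
    [set rho : {multiplicative Gamma -> G} | good s rho].
Proof.
have [n [V [hV pV pc]]] := aag_linear_group G.
have hconn : zariski_connected (fun g => mxvec (V g)) setT.
  move=> [A [B [[cA cB] AB SA SB AB0]]]; case: Gred => + _; apply.
  have tr S : zariski_closed (fun g => mxvec (V g)) S -> zariski_closed (@aag_coord _ G) S.
    by apply: zariski_closed_trans; apply/polymx_mxvec.
  by exists A, B; split=> //; split; apply: tr.
(* That the radical is a torus enters here, by excluding nonzero invariant spaces of nilpotents in
   the Lie algebra. *)
have [H [H1 HD HZ HL HR]] := haar_functional hV hconn (@nilpotent_ideal_trivial _ _ _ _ hV pV pc Gred).
have [d [P [Q [PQ Psep]]]] := spanning_coordinates (fun g => mxvec (V g)).
apply: (good_open_of_sections hV pV pc PQ Psep sgen) => b0 cl st.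
apply: (orbit_section hV (@complex_big_fibre R) H1 HD HZ HL HR (conj_rep_rational hV PQ Psep) _ st) => b hb.
by have [|g _ <-] := cl b; [move=> p hp; apply: hb => g; apply: hp; exists g|exists g].
Qed.
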